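(* Suppose that the equation of state of a relativistic perfect fluid satisfies the assumptions (A1) $\rho(p,s)$ is a non-increasing function of $s$, for each $p$; (A2) $\eta(p,s)$ is a non-decreasing function of $p$, for each $s$, where the pressure $p$ and the entropy $s$ are used as the thermodynamic variables. Let $\bar n,\bar s>0$ be constants and let $n_0,s_0,\mathbf{u}_0$ be smooth functions on $\mathbb{R}^3$ with $n_0=\bar n$, $s_0=\bar s$, $\mathbf{u}_0=0$ outside the unit ball $B_0=\{\mathbf{x}\in\mathbb{R}^3: |\mathbf{x}|\le 1\}$. Let $\bar\eta=\eta(\bar n,\bar s)$, $\bar\rho=\rho(\bar n,\bar s)$, $\rho_0=\rho(n_0,s_0)$, $p_0=p(n_0,s_0)$, and $$E=\int_{\mathbb{R}^3}\Big[(\rho_0+p_0)|\mathbf{u}_0|^2+\rho_0-\bar\rho\Big]\,d\mathbf{x},\qquad Q(0)=\int_{\mathbb{R}^3}\mathbf{x}\cdot\mathbf{u}_0\,\sqrt{1+|\mathbf{u}_0|^2}\,(\rho_0+p_0)\,d\mathbf{x}.$$ Assume that the initial data satisfy (D1) $\bar\eta<\frac13$; (D2) $E>0$; (D3) $s_0(\mathbf{x})\ge\bar s$ for all $\mathbf{x}\in B_0$; (D4) $\displaystyle Q(0)>\frac{2\bar\eta}{1-3\bar\eta^2}\left(\int_1^\infty\frac{dr}{E r^2+\frac{4\pi}{3}\bar\rho r^5}\right)^{-1}$. Then the Cauchy problem for the relativistic fluid equations $$\partial_\nu(nu^\nu)=0,\qquad (\rho+p)u^\nu\partial_\nu u^\mu+h^{\mu\nu}\partial_\nu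 p=0,\qquad u^\nu\partial_\nu s=0,$$ with initial data $n=n_0$, $s=s_0$, $\mathbf{u}=\mathbf{u}_0$ on the hyperplane $t=0$, cannot have a global-in-time $C^1$ solution (that is, there is no $C^1$ solution $(n,\mathbf{u},s)$ on $[0,\infty)\times\mathbb{R}^3$).
   Context: Setting: $(M,g)$ is Minkowski spacetime with global coordinates $(x^\mu)$, $\mu=0,\dots,3$, $g_{\mu\nu}=\mathrm{diag}(-1,1,1,1)$, $t=x^0$, $\mathbf{x}=(x^1,x^2,x^3)$. Greek indices run from 0 to 3 and Latin ones from 1 to 3; indices are raised and lowered with $g$ and repeated up-and-down indices are summed. The speed of light is 1. Unknowns of a relativistic perfect fluid: the four-velocity $u=(u^0,\mathbf{u})$, a unit future-directed timelike vector field, so $g(u,u)=-1$ and $u^0=\sqrt{1+|\mathbf{u}|^2}$; the number density $n\ge0$; the entropy per particle $s\ge0$. The tensor $h_{\mu\nu}=g_{\mu\nu}+u_\mu u_\nu$ is the projection onto the orthogonal complement of $u$. Equation of state: the proper energy density $\rho\ge0$ is a given function $\rho=\rho(n,s)$, and the pressure is $p=n\frac{\partial\rho}{\partial n}-\rho\ge0$. Standing assumptions: $\frac{\partial\rho}{\partial n}>0$, $\frac{\partial p}{\partial n}>0$, $\frac{\partial\rho}{\partial s}\ge0$ with equality iff $s=0$, and $p\le\rho$. The sound speed $\eta\geq 0$ is defined by $\eta^2=\left(\frac{dp}{d\rho}\right)_s=\frac{\partial p/\partial n}{\partial\rho/\partial n}$. Since $\partial p/\partial n>0$, one may use $p$ in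 place of $n$ as a thermodynamic variable, writing $\rho=\rho(p,s)$ and $\eta=\eta(p,s)$. The energy tensor is $T^{\mu\nu}=(\rho+p)u^\mu u^\nu+pg^{\mu\nu}$; $E$ is the total energy of the perturbation (the integral of $T^{00}-\bar T^{00}$, where the bar denotes the value in the constant background state $n=\bar n$, $s=\bar s$, $\mathbf{u}=0$), and $Q(0)$ is the initial total radial momentum $\int g_{ij}x^iT^{0j}$. *)

(* Defs.v *)
From HB Require Import structures.
From mathcomp Require Import all_boot all_order all_algebra.
From mathcomp Require Import all_classical all_reals all_analysis.

Set Implicit Arguments.
Unset Strict Implicit.
Unset Printing Implicit Defensive.

Import Order.TTheory GRing.Theory Num.Theory.
Import numFieldNormedType.Exports.

Local Open Scope classical_set_scope.
Local Open Scope ring_scope.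

(* Derivatives relative to a set D: the increments h *: v are restricted to
   those that stay in D. In the interior of D this is the library's 'D_v f
   (lemma derive_inE below); at a boundary point of a half-space or of a
   quadrant it is the one-sided derivative. *)
Section relative_derivative.
Context {R : realType} {V : normedModType R}.
Implicit Types (D : set V) (v : V) (f : V -> R) (x : V).

Definition quotient_filter D v x : set_system R :=
  within [set h : R | D (h *: v + x)] 0^'.

Definition derive_in D v f x : R :=
  lim ((fun h : R => h^-1 *: ((f \o shift x) (h *: v) - f x))
       @ quotient_filter D v x).

Definition derivable_in D v f x : Prop :=
  cvg ((fun h : R => h^-1 *: ((f \o shift x) (h *: v) - f x))
       @ quotient_filter D v x).

(* f is of class C^k on D, up to the part of the boundary that lies in D;
   the partial derivatives are taken along the directions in [axes]. *)
Fixpoint Ck (k : nat) (axes : set V) D f : Prop :=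
  {within D, continuous f} /\
  if k is k'.+1 then
    forall v, axes v ->
      (forall x, D x -> derivable_in D v f x) /\
      Ck k' axes D (derive_in D v f)
  else True.

Lemma quotient_filter_interior D v x :
  interior D x -> quotient_filter D v x = 0^'.
Proof.
move=> Dx; apply/seteqP; split => A.
- rewrite /quotient_filter /within /= => HA.
  have H : \forall h \near (0 : R), D (h *: v + x).
    have cv : (fun h : R => h *: v + x) @ (0 : R) --> x.
      rewrite -[X in _ --> X]add0r -[X in _ --> X + _](scale0r v).
      by apply: cvgD; [apply: cvgZr_tmp; exact: cvg_id | exact: cvg_cst].
    exact: (cv _ Dx).
  have H' : \forall h \near (0 : R)^', D (h *: v + x).
    by rewrite /dnbhs /within /=; apply: filterS H => h Dh _.
  by near=> h; apply: (near HA h) => //; near: h.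
- by rewrite /quotient_filter /within /=; apply: filterS => h Ah _.
Unshelve. all: by end_near. Qed.

Lemma derive_inE D v f x : interior D x -> derive_in D v f x = 'D_v f x.
Proof. by move=> Dx; rewrite /derive_in quotient_filter_interior. Qed.

Lemma derivable_inE D v f x : interior D x -> derivable_in D v f x = derivable f x v.
Proof. by move=> Dx; rewrite /derivable_in quotient_filter_interior. Qed.

End relative_derivative.

Section euclidean.
Context {R : realType}.

Definition coord_axes (m : nat) : set 'rV[R]_m :=
  [set delta_mx 0 i | i in [set: 'I_m]].

Definition smooth3 (f : 'rV[R]_3 -> R) : Prop :=
  forall k, Ck k (@coord_axes 3) setT f.

Definition dot (v w : 'rV[R]_3) : R := \sum_(i < 3) v 0 i * w 0 i.

(* The Euclidean norm; the library norm of a row vector is the sup norm. *)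
Definition enorm (v : 'rV[R]_3) : R := Num.sqrt (dot v v).

Definition unit_ball3 : set 'rV[R]_3 := [set x | enorm x <= 1].

Definition vec3 (z : R * R * R) : 'rV[R]_3 :=
  \row_(i < 3) [:: z.1.1; z.1.2; z.2]`_i.

(* Lebesgue integral over R^3, with R * R * R carrying the product measure. *)
Definition integral3 (f : 'rV[R]_3 -> R) : R :=
  (\int[((lebesgue_measure \x lebesgue_measure) \x lebesgue_measure)%E]_z
     f (vec3 z))%R.

End euclidean.

(* A thermodynamic state is q = (n, s); an equation of state is a function
   rho : R * R -> R, used only on the quadrant n >= 0, s >= 0. *)
Section equation_of_state.
Context {R : realType}.
Implicit Types (rho : R * R -> R) (q : R * R).

Definition states : set (R * R) := [set q | 0 <= q.1 /\ 0 <= q.2].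

Definition state_axes : set (R * R) := [set (1, 0); (0, 1)].

Definition d_n (f : R * R -> R) : R * R -> R := derive_in states (1, 0) f.

Definition d_s (f : R * R -> R) : R * R -> R := derive_in states (0, 1) f.

Definition pressure rho q : R := q.1 * d_n rho q - rho q.

Definition sound_speed rho q : R :=
  Num.sqrt (d_n (pressure rho) q / d_n rho q).

(* The strict conditions are imposed for n > 0 only: at n = 0 the conditions
   rho >= 0 and p >= 0 force rho = p = 0 for every s, so that d_s rho = 0. *)
Record equation_of_state rho : Prop := EquationOfState {
  eos_C1_rho : Ck 1 state_axes states rho ;
  eos_C1_pressure : Ck 1 state_axes states (pressure rho) ;
  eos_rho_ge0 : forall q, states q -> 0 <= rho q ;
  eos_pressure_ge0 : forall q, states q -> 0 <= pressure rho q ;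
  eos_d_n_rho_gt0 : forall q, states q -> 0 < q.1 -> 0 < d_n rho q ;
  eos_d_n_pressure_gt0 :
    forall q, states q -> 0 < q.1 -> 0 < d_n (pressure rho) q ;
  eos_d_s_rho_ge0 : forall q, states q -> 0 <= d_s rho q ;
  eos_d_s_rho_eq0 :
    forall q, states q -> 0 < q.1 -> (d_s rho q = 0 <-> q.2 = 0) ;
  eos_pressure_le_rho : forall q, states q -> pressure rho q <= rho q
}.

(* Change of variables from (n, s) to (p, s), for n > 0. *)
Definition pressure_range rho (s : R) : set R :=
  [set pressure rho (n, s) | n in [set n : R | 0 < n]].

Definition density_of rho (p s : R) : R :=
  get [set n : R | 0 < n /\ pressure rho (n, s) = p].

Definition rho_ps rho (p s : R) : R := rho (density_of rho p s, s).

Definition sound_speed_ps rho (p s : R) : R :=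
  sound_speed rho (density_of rho p s, s).

Definition rho_nonincreasing_in_entropy rho : Prop :=
  forall p s1 s2 : R, 0 <= s1 -> s1 <= s2 ->
    pressure_range rho s1 p -> pressure_range rho s2 p ->
    rho_ps rho p s2 <= rho_ps rho p s1.

Definition sound_speed_nondecreasing_in_pressure rho : Prop :=
  forall s p1 p2 : R, 0 <= s -> p1 <= p2 ->
    pressure_range rho s p1 -> pressure_range rho s p2 ->
    sound_speed_ps rho p1 s <= sound_speed_ps rho p2 s.

End equation_of_state.

Section fluid.
Context {R : realType}.
Implicit Types (rho : R * R -> R).

(* The vector of R^4 with time component a and space components v. *)
Definition vec4 (a : R) (v : 'rV[R]_3) : 'rV[R]_4 := row_mx a%:M v.

Definition future : set 'rV[R]_4 := [set x | 0 <= x 0 0].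

Definition partial (mu : 'I_4) (f : 'rV[R]_4 -> R) : 'rV[R]_4 -> R :=
  derive_in future (delta_mx 0 mu) f.

(* diag(-1,1,1,1) is its own inverse: these are g_{mu nu} and g^{mu nu}. *)
Definition minkowski (mu nu : 'I_4) : R :=
  if mu == nu then (if mu == 0 then -1 else 1) else 0.

Definition four_velocity (v : 'rV[R]_3) : 'rV[R]_4 :=
  vec4 (Num.sqrt (1 + dot v v)) v.

(* h^{mu nu} *)
Definition projection (U : 'rV[R]_4) (mu nu : 'I_4) : R :=
  minkowski mu nu + U 0 mu * U 0 nu.

Record fluid_solution rho (n0 s0 : 'rV[R]_3 -> R)
    (u0 : 'rV[R]_3 -> 'rV[R]_3) (n s : 'rV[R]_4 -> R)
    (u : 'rV[R]_4 -> 'rV[R]_3) : Prop := FluidSolution {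
  sol_C1_n : Ck 1 (@coord_axes R 4) future n ;
  sol_C1_s : Ck 1 (@coord_axes R 4) future s ;
  sol_C1_u : forall i, Ck 1 (@coord_axes R 4) future (fun x => u x 0 i) ;
  sol_n_ge0 : forall x, future x -> 0 <= n x ;
  sol_s_ge0 : forall x, future x -> 0 <= s x ;
  sol_particles : forall x, future x ->
    \sum_(nu < 4) partial nu (fun y => n y * four_velocity (u y) 0 nu) x = 0 ;
  sol_momentum : forall x, future x -> forall mu : 'I_4,
    (rho (n x, s x) + pressure rho (n x, s x)) *
      (\sum_(nu < 4) four_velocity (u x) 0 nu *
         partial nu (fun y => four_velocity (u y) 0 mu) x) +
    \sum_(nu < 4) projection (four_velocity (u x)) mu nu *
      partial nu (fun y => pressure rho (n y, s y)) x = 0 ;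
  sol_entropy : forall x, future x ->
    \sum_(nu < 4) four_velocity (u x) 0 nu * partial nu s x = 0 ;
  sol_initial_n : forall y, n (vec4 0 y) = n0 y ;
  sol_initial_s : forall y, s (vec4 0 y) = s0 y ;
  sol_initial_u : forall y, u (vec4 0 y) = u0 y
}.

Section energy_momentum.
Variables (rho : R * R -> R) (nbar sbar : R) (n0 s0 : 'rV[R]_3 -> R)
  (u0 : 'rV[R]_3 -> 'rV[R]_3).

Let rho0 (x : 'rV[R]_3) : R := rho (n0 x, s0 x).
Let p0 (x : 'rV[R]_3) : R := pressure rho (n0 x, s0 x).

Definition energy : R :=
  integral3 (fun x =>
    (rho0 x + p0 x) * dot (u0 x) (u0 x) + rho0 x - rho (nbar, sbar)).

Definition radial_momentum : R :=
  integral3 (fun x =>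
    dot x (u0 x) * Num.sqrt (1 + dot (u0 x) (u0 x)) * (rho0 x + p0 x)).

End energy_momentum.

End fluid.

(* Main.v *)
Require Import Defs.
From HB Require Import structures.
From mathcomp Require Import all_boot all_order all_algebra.
From mathcomp Require Import all_classical all_reals all_analysis.
From mathcomp Require Import ring lra measurable_realfun.
Import Order.TTheory GRing.Theory Num.Theory.
Import numFieldNormedType.Exports.
Local Open Scope classical_set_scope.
Local Open Scope ring_scope.

(** The proof follows the radial momentum Q(t), the integral of x . T^0 over
    the slice at time t, and shows that it would blow up in finite time.

    Outside the ball of radius r(t) = 1 + eta t, where eta is the sound speed of
    the constant state, the solution stays equal to that state (finite_speed).
    Hence all the integrals over slices are integrals of compactly supported
    functions, E is conserved (energy_conserved), and Q may be differentiated
    under the integral sign: the conservation of momentum gives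
    Q' = integral of (rho + p) |u|^2 + 3 (p - pbar)   (radial_derivative).
    As the sound speed increases with p, p is a convex function of rho at fixed
    entropy and lies above its tangent; as rho decreases with s at fixed p, this
    extends to larger entropies: p - pbar >= eta^2 (rho - rhobar) wherever
    s >= sbar (pressure_tangent_entropy). The entropy is transported by the
    flow, so that its initial lower bound sbar persists (entropy_minimum). With
    K(t) the integral of (rho + p) |u|^2 this yields
    Q' >= (1 - 3 eta^2) K + 3 eta^2 E >= (1 - 3 eta^2) K,
    where the coefficient is positive because eta < 1/3. Conversely the
    Cauchy-Schwarz inequality, together with p <= rho and the fact that the
    perturbation lives in the ball of radius r, gives
    Q^2 <= 2 (E r^2 + 4 pi / 3 rhobar r^5) K   (radial_sqr_le).
    Eliminating K leaves the Riccati inequality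
    (1 / Q)' <= - (1 - 3 eta^2) / 2 / (E r^2 + 4 pi / 3 rhobar r^5).
    Integrated over all times, it bounds 1 / Q(0) from below by a multiple of
    the integral over r in the hypothesis on the initial radial momentum
    (riccati, radial_momentum_le), which that hypothesis excludes.

    Finite propagation and the minimum of the entropy both come from one energy
    estimate (cone_vanish): a divergence-free current J whose spatial part is at
    most sigma J^0 >= 0, and whose J^0 vanishes at the base of a backward cone
    of slope sigma, has J^0 = 0 in the whole cone. For the minimum of the
    entropy J = n ((sbar - s)^+)^2 u and sigma = 1. For finite propagation, J
    is the energy current relative to the constant state; since it is positive
    definite and has the right slope only for states close to that state
    (near_background), the cone is climbed in thin slabs, in each of which
    uniform continuity keeps the solution close to its value at the base
    (slab_background, cone_background). *)

Set Implicit Arguments.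
Unset Strict Implicit.
Unset Printing Implicit Defensive.

(** * Directional derivatives of real functions *)

Section directional.
Context {R : realType} {V : normedModType R}.
Implicit Types (f g : V -> R) (x v : V) (a b : R).

Lemma is_derive_lineP f x v a :
  is_derive x v f a <-> is_derive (0 : R) (1 : R) (fun h : R => f (h *: v + x)) a.
Proof.
have E : (fun h : R => h^-1 *: ((f \o shift x) (h *: v) - f x)) =
    (fun h : R => h^-1 *: (((fun h : R => f (h *: v + x)) \o shift (0 : R)) (h *: (1 : R)) -
       f (0 *: v + x))).
  apply/funext => h /=; rewrite scale0r add0r addr0.
  by rewrite [h *: (1 : R)]mulr1.
split=> -[df fa]; split.
- by move: df; rewrite /derivable E.
- by rewrite -fa /derive E.
- by rewrite /derivable E.
- by rewrite -fa /derive E.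
Qed.

Lemma isd_comp (F : R -> R) g x v a b : is_derive (g x) (1 : R) F a ->
  is_derive x v g b -> is_derive x v (fun y => F (g y)) (a * b).
Proof.
move=> dF /is_derive_lineP dg; apply/is_derive_lineP.
by apply: (@is_derive1_comp _ F (fun h : R => g (h *: v + x))) => //; rewrite scale0r add0r.
Qed.

Lemma isd_eq f x v a b : is_derive x v f a -> a = b -> is_derive x v f b.
Proof. by move=> h <-. Qed.

Lemma isd_add f g x v a b : is_derive x v f a -> is_derive x v g b ->
  is_derive x v (fun y => f y + g y) (a + b).
Proof. by move=> fa gb; exact: is_deriveD. Qed.

Lemma isd_sub f g x v a b : is_derive x v f a -> is_derive x v g b ->
  is_derive x v (fun y => f y - g y) (a - b).
Proof. by move=> fa gb; exact: is_deriveB. Qed.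

Lemma isd_mul f g x v a b : is_derive x v f a -> is_derive x v g b ->
  is_derive x v (fun y => f y * g y) (f x * b + g x * a).
Proof. by move=> fa gb; exact: is_deriveM. Qed.

Lemma isd_cst (c : R) x v : is_derive x v (fun=> c) 0.
Proof. exact: is_derive_cst. Qed.

Lemma isd_near f g x v a : {near x, f =1 g} -> is_derive x v f a -> is_derive x v g a.
Proof. by move=> fg; exact: near_eq_is_derive. Qed.

End directional.

Lemma isd_inv {R : realType} (f : R -> R) (x a : R) : f x != 0 -> is_derive x (1 : R) f a ->
  is_derive x (1 : R) (fun y => (f y)^-1) (- a / f x ^+ 2).
Proof.
move=> fx0 fa; have := @is_deriveV R f x a 1 fx0 fa.
rewrite (_ : - f x ^- 2 *: a = - a / f x ^+ 2) //; by rewrite /GRing.scale /= mulNr mulNr mulrC.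
Qed.

Lemma isd_sqr {R : realType} (x : R) : is_derive x (1 : R) (fun y : R => y ^+ 2) (2 * x).
Proof.
have dx : is_derive x (1 : R) (fun y : R => y) 1 by exact: is_derive_id.
by apply: (isd_eq (isd_mul dx dx)); ring.
Qed.

Lemma isd_id {R : realType} (x : R) : is_derive x (1 : R) (fun y : R => y) 1.
Proof. exact: is_derive_id. Qed.

Lemma isd_continuous {R : realType} (f : R -> R) (x a : R) :
  is_derive x (1 : R) f a -> {for x, continuous f}.
Proof. by move=> [df _]; apply: differentiable_continuous; exact/derivable1_diffP. Qed.

Lemma near_eq_cvg_to (T U : Type) (F : set_system T) {FF : Filter F} (f g : T -> U)
    (G : set_system U) : {near F, f =1 g} -> f @ F --> G -> g @ F --> G.
Proof. by move=> h; apply: cvg_trans; exact: (near_eq_cvg h). Qed.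

(** * Measurability of continuous functions on products of lines *)

(** A countable base of the topology that consists of members of M. This
    passes to products, so that the open sets of a product are measurable for
    the product of the Borel sets. *)
Definition box_base (T : topologicalType) (M : set (set T)) : Prop :=
  exists B : nat -> set T, (forall n, M (B n)) /\
    forall x A, nbhs x A -> exists2 n, B n x & B n `<=` A.

Lemma box_base_R (R : realType) : @box_base R (fun A => measurable (A : set (measurableTypeR R))).
Proof.
exists (fun n => if unpickle n is Some (a, b) then `]ratr (a : rat), ratr (b : rat)[%classic else set0).
split; first by move=> n; case: unpickle => [[a b]|]; [exact: measurable_itv|exact: measurable0].
move=> x A /nbhs_ballP[e /= e0 xA].
have [a ax] := @rat_in_itvoo R (x - e) x ltac:(by rewrite ltrBlDr ltrDl).
have [b bx] := @rat_in_itvoo R x (x + e) ltac:(by rewrite ltrDl).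
exists (pickle (a, b)); rewrite pickleK /=.
  by move: ax bx; rewrite !in_itv /= => /andP[_ ->] /andP[-> _].
move=> y /=; rewrite in_itv /= => /andP[ay yb]; apply: xA.
rewrite /ball /=; move: ax bx; rewrite !in_itv /= => /andP[h1 h2] /andP[h3 h4].
rewrite ltr_distl; apply/andP; split; lra.
Qed.

Lemma box_base_prod (T U : topologicalType) (M : set (set T)) (N : set (set U))
    (MN : set (set (T * U))) :
  MN set0 -> (forall A B, M A -> N B -> MN (A `*` B)) ->
  box_base M -> box_base N -> box_base MN.
Proof.
move=> MN0 MNX [B [mB bB]] [C [mC bC]].
exists (fun n => if unpickle n is Some (i, j) then B i `*` C j else set0).
split; first by move=> n; case: unpickle => [[i j]|] //; exact: MNX.
move=> [x y] A [[P Q] /= [xP yQ] PQA].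
have [i Bix BiP] := bB _ _ xP; have [j Cjy CjQ] := bC _ _ yQ.
exists (pickle (i, j)); rewrite pickleK //= => -[u v] [/= Bu Cv].
by apply: PQA; split; [exact: BiP|exact: CjQ].
Qed.

Lemma box_base_open (T : topologicalType) (M : set (set T)) (A : set T) :
  M set0 -> (forall F : nat -> set T, (forall n, M (F n)) -> M (\bigcup_n F n)) ->
  box_base M -> open A -> M A.
Proof.
move=> M0 MU [B [mB bB]] oA.
rewrite (_ : A = \bigcup_n (if `[< B n `<=` A >] then B n else set0)).
  by apply: MU => n; case: asboolP.
apply/seteqP; split => [x Ax|x [n _]].
  have [n Bx BA] := bB x A (open_nbhs_nbhs (conj oA Ax)).
  by exists n => //; case: asboolP.
by case: asboolP => // BA Bx; apply: BA.
Qed.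

Section space3.
Context {R : realType}.
Local Notation leb := (@lebesgue_measure R).
Local Notation leb3 := ((leb \x leb) \x leb)%E.

Lemma continuous_measurable2 (f : R * R -> R) : continuous f ->
  measurable_fun setT f.
Proof.
move=> cf; apply: (measurability _ (measurable_realfun.RGenOpens.measurableE R)) => // _ [_ [a [b ->] <-]].
rewrite setTI.
have : open (f @^-1` `]a, b[%classic) by apply: open_comp => // *; exact: cf.
apply: box_base_open; [exact: measurable0|by move=> F mF; exact: bigcupT_measurable|].
apply: box_base_prod (box_base_R R) (box_base_R R); first exact: measurable0.
by move=> A B mA mB; exact: measurableX.
Qed.

Lemma continuous_measurable3 (f : R * R * R -> R) : continuous f ->
  measurable_fun setT f.
Proof.
move=> cf; apply: (measurability _ (measurable_realfun.RGenOpens.measurableE R)) => // _ [_ [a [b ->] <-]].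
rewrite setTI.
have : open (f @^-1` `]a, b[%classic) by apply: open_comp => // *; exact: cf.
apply: box_base_open; [exact: measurable0|by move=> F mF; exact: bigcupT_measurable|].
apply: box_base_prod (box_base_R R); first exact: measurable0.
  by move=> A B mA mB; exact: (measurableX mA mB).
apply: box_base_prod (box_base_R R) (box_base_R R); first exact: measurable0.
by move=> A B mA mB; exact: measurableX.
Qed.

End space3.

(** * Integrals over three-dimensional space *)

Section space3.
Context {R : realType}.
Local Notation leb := (@lebesgue_measure R).
Local Notation leb3 := ((leb \x leb) \x leb)%E.

Lemma bounded_support_integrable d (T : measurableType d) (mu : {measure set T -> \bar R})
    (D : set T) (M : R) (f : T -> R) :
  measurable D -> (mu D < +oo)%E -> measurable_fun setT f ->
  (forall z, `|f z| <= M) -> (forall z, ~ D z -> f z = 0) ->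
  mu.-integrable setT (EFin \o f).
Proof.
move=> mD muD mf fM f0.
have -> : EFin \o f = (EFin \o f) \_ D.
  apply/funext => z /=; rewrite /patch; case: ifPn => // /negP zD.
  by rewrite f0 // => Dz; apply: zD; rewrite inE.
apply: (proj1 (integrable_mkcond _ mD)); apply: measurable_bounded_integrable => //.
- exact: measurable_funS mf.
- by exists M; split => [|N MN x _ /=]; [exact: num_real|rewrite (le_trans (fM x)) // ltW].
Qed.

Definition cube (L : R) : set (R * R * R) :=
  `[- L, L] `*` `[- L, L] `*` `[- L, L].

Definition square (L : R) : set (R * R) := `[- L, L] `*` `[- L, L].

Lemma measurable_cube L : measurable (cube L).
Proof. by apply: measurableX => //; apply: measurableX. Qed.

Lemma lebesgue_itv_lty (a b : R) : (leb `[a, b]%classic < +oo)%E.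
Proof. by rewrite lebesgue_measure_itv /=; case: ifP => _; rewrite ?ltry // -EFinB ltry. Qed.

Lemma square_lty (L : R) : ((leb \x leb)%E (square L) < +oo)%E.
Proof.
by rewrite product_measure1E //= lte_mul_pinfty ?measure_ge0 ?ge0_fin_numE ?lebesgue_itv_lty ?measure_ge0.
Qed.

Lemma cube_lty L : (leb3 (cube L) < +oo)%E.
Proof.
rewrite product_measure1E //=; last exact: measurableX.
by rewrite lte_mul_pinfty ?measure_ge0 ?ge0_fin_numE ?square_lty ?lebesgue_itv_lty ?measure_ge0.
Qed.

Lemma compact_bound (T : topologicalType) (A : set T) (f : T -> R) :
  compact A -> {within A, continuous f} -> exists M : R, forall z, A z -> `|f z| <= M.
Proof.
move=> cA cf; have := continuous_compact cf cA => /compact_bounded[M [Mr hM]].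
exists (`|M| + 1) => z Az; apply: (hM (`|M| + 1)) => //.
  by rewrite ltr_pwDr // ler_norm.
Qed.

Lemma compact_support_bound (T : topologicalType) (A : set T) (f : T -> R) :
  compact A -> continuous f -> (forall z, ~ A z -> f z = 0) ->
  exists M : R, forall z, `|f z| <= M.
Proof.
move=> cA cf f0; have [M hM] := compact_bound cA (continuous_subspaceT cf).
exists (Num.max M 0) => z; have [Cz|nCz] := pselect (A z).
  by rewrite le_max hM.
by rewrite f0 // normr0 le_max lexx orbT.
Qed.

Lemma continuous_integrable3 L (f : R * R * R -> R) : continuous f ->
  (forall z, ~ cube L z -> f z = 0) -> leb3.-integrable setT (EFin \o f).
Proof.
move=> cf f0; have [|M hM] := compact_support_bound _ cf f0.
  by apply: compact_setX; [apply: compact_setX|]; exact: segment_compact.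
apply: (@bounded_support_integrable _ _ leb3 (cube L) M) => //.
- exact: measurable_cube.
- exact: cube_lty.
- exact: continuous_measurable3.
Qed.

Lemma continuous_integrable2 L (f : R * R -> R) : continuous f ->
  (forall z, ~ square L z -> f z = 0) ->
  (leb \x leb)%E.-integrable setT (EFin \o f).
Proof.
move=> cf f0; have [|M hM] := compact_support_bound _ cf f0.
  by apply: compact_setX; exact: segment_compact.
apply: (@bounded_support_integrable _ _ (leb \x leb)%E (square L) M) => //.
- exact: measurableX.
- exact: square_lty.
- exact: continuous_measurable2.
Qed.

Lemma integral_derivative_eq0 (L : R) (F g : R -> R) : 0 < L ->
  (forall x : R, is_derive x (1 : R) F (g x)) -> continuous g ->
  (forall x, L < `|x| -> F x = 0) -> (forall x, L < `|x| -> g x = 0) ->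
  (\int[leb]_x (g x)%:E = 0)%E.
Proof.
move=> L0 dF cg F0 g0.
have -> : (\int[leb]_x (g x)%:E = \int[leb]_(x in `[(- (L + 1))%R, (L + 1)%R]) (g x)%:E)%E.
  rewrite [RHS]integral_mkcond; apply: eq_integral => x _; rewrite /patch; case: ifPn => //.
  rewrite notin_setE /= in_itv /= -ler_norml => /negP; rewrite -ltNge => xL; rewrite g0 //.
  by apply: lt_trans xL; rewrite ltrDl.
have cF x : {for x, continuous F}.
  by apply: differentiable_continuous; apply/derivable1_diffP; case: (dF x).
rewrite (continuous_FTC2 (F := F)).
- by rewrite !F0 ?subee // ?normrN ger0_norm ?ltrDl // addr_ge0 // ltW.
- lra.
- exact: continuous_subspaceT.
- split => [x _||]; first by case: (dF x).
  + exact: cvg_at_right_filter (cF _).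
  + exact: cvg_at_left_filter (cF _).
- by move=> x _; rewrite derive1E; case: (dF x).
Qed.

End space3.

Lemma cvg_to_pair (T : Type) (F : set_system T) {FF : Filter F}
    (U V : topologicalType) (f : T -> U) (g : T -> V) (a : U) (b : V) :
  f @ F --> a -> g @ F --> b -> (fun x => (f x, g x)) @ F --> (a, b).
Proof. by move=> fa gb; exact: cvg_pair. Qed.

Section product_sigma_finite.
Context d1 d2 (T1 : measurableType d1) (T2 : measurableType d2) (R : realType).
Context (m1 : {sigma_finite_measure set T1 -> \bar R})
  (m2 : {sigma_finite_measure set T2 -> \bar R}).

Lemma product_measure1_sigma_finite : sigma_finite setT (m1 \x m2)%E.
Proof.
have /sigma_finiteP[F [TF ndF Foo]] := sigma_finiteT m1.
have /sigma_finiteP[G [TG ndG Goo]] := sigma_finiteT m2.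
exists (fun n => F n `*` G n).
  rewrite -setXTT TF TG predeqE => -[x y]; split.
    move=> [/= [n _ Fnx] [k _ Gky]]; exists (maxn n k) => //; split.
      by move: x Fnx; exact/subsetPset/ndF/leq_maxl.
    by move: y Gky; exact/subsetPset/ndG/leq_maxr.
  by move=> [n _ [/= Fnx Gny]]; split; exists n.
move=> k; have [mF ?] := Foo k; have [mG ?] := Goo k; split; first exact: measurableX.
by rewrite product_measure1E// lte_mul_pinfty// ge0_fin_numE.
Qed.

(** Fubini's theorem for (m1 x m2) x m3 requires m1 x m2 to be
    sigma-finite; the alias carries that structure. *)
Definition product_alias : set (T1 * T2) -> \bar R := (m1 \x m2)%E.

HB.instance Definition _ := Measure.copy product_alias (m1 \x m2)%E.

HB.instance Definition _ := Measure_isSigmaFinite.Build _ _ R product_alias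
  product_measure1_sigma_finite.

End product_sigma_finite.

Section triple_fubini.
Context d1 d2 d3 (T1 : measurableType d1) (T2 : measurableType d2)
  (T3 : measurableType d3) (R : realType).
Context (m1 : {sigma_finite_measure set T1 -> \bar R})
  (m2 : {sigma_finite_measure set T2 -> \bar R})
  (m3 : {sigma_finite_measure set T3 -> \bar R}).
Variable f : T1 * T2 * T3 -> \bar R.
Hypothesis intf : ((m1 \x m2) \x m3)%E.-integrable setT f.

Lemma triple_fubini21 :
  (\int[(m1 \x m2) \x m3]_z f z = \int[m3]_z \int[m1 \x m2]_xy f (xy, z))%E.
Proof. exact: esym (@integral21_prod_meas1 _ _ _ _ R (product_alias m1 m2) m3 f intf). Qed.

Lemma triple_fubini12 :
  (\int[(m1 \x m2) \x m3]_z f z = \int[m1 \x m2]_xy \int[m3]_z f (xy, z))%E.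
Proof. exact: esym (@integral12_prod_meas1 _ _ _ _ R (product_alias m1 m2) m3 f intf). Qed.

End triple_fubini.

Section space3.
Context {R : realType}.
Local Notation leb := (@lebesgue_measure R).
Local Notation leb3 := ((leb \x leb) \x leb)%E.

Lemma not_cube1 (L : R) (x y z : R) : L < `|x| -> ~ cube L (x, y, z).
Proof. by move=> xL [[/= + _] _]; rewrite in_itv /= -ler_norml leNgt xL. Qed.

Lemma not_cube2 (L : R) (x y z : R) : L < `|y| -> ~ cube L (x, y, z).
Proof. by move=> xL [[/= _ +] _]; rewrite in_itv /= -ler_norml leNgt xL. Qed.

Lemma not_cube3 (L : R) (x y z : R) : L < `|z| -> ~ cube L (x, y, z).
Proof. by move=> xL [_ /=]; rewrite in_itv /= -ler_norml leNgt xL. Qed.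

Section axes.
Variables (L : R) (f g : R * R * R -> R).
Hypotheses (L0 : 0 < L) (cg : continuous g).
Hypothesis f0 : forall z, ~ cube L z -> f z = 0.
Hypothesis g0 : forall z, ~ cube L z -> g z = 0.

Let cg1 y z : continuous (fun x => g (x, y, z)).
Proof.
move=> x; apply: (@continuous_comp _ _ _ (fun x => (x, y, z)) g); last exact: cg.
by apply: cvg_to_pair; [apply: cvg_to_pair; [exact: cvg_id|exact: cvg_cst]|exact: cvg_cst].
Qed.

Let cg2 x z : continuous (fun y => g (x, y, z)).
Proof.
move=> y; apply: (@continuous_comp _ _ _ (fun y => (x, y, z)) g); last exact: cg.
by apply: cvg_to_pair; [apply: cvg_to_pair; [exact: cvg_cst|exact: cvg_id]|exact: cvg_cst].
Qed.

Let cg3 x y : continuous (fun z => g (x, y, z)).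
Proof.
move=> z; apply: (@continuous_comp _ _ _ (fun z => (x, y, z)) g); last exact: cg.
by apply: cvg_to_pair; [exact: cvg_cst|exact: cvg_id].
Qed.

Let int12 z : (leb \x leb)%E.-integrable setT (EFin \o (fun xy => g (xy, z))).
Proof.
apply: (@continuous_integrable2 _ L).
  move=> xy; apply: (@continuous_comp _ _ _ (fun xy => (xy, z)) g); last exact: cg.
  by apply: cvg_to_pair; [exact: cvg_id|exact: cvg_cst].
by move=> xy nxy; apply: g0 => -[/= + _]; exact: nxy.
Qed.

Let int3 : leb3.-integrable setT (EFin \o g).
Proof. exact: continuous_integrable3 g0. Qed.

(** Fubini's theorem lets the variable of differentiation be integrated first,
    and the integral of a derivative with compact support vanishes. *)
Lemma integral3_derivative1 :
  (forall x y z : R, is_derive x (1 : R) (fun x => f (x, y, z)) (g (x, y, z))) ->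
  (\int[leb3]_z g z = 0)%R.
Proof.
move=> df; rewrite /Rintegral (_ : integral _ _ _ = 0%E) //.
rewrite triple_fubini21 ?integral0_eq // => z _.
apply: etrans (esym (integral21_prod_meas1 (int12 z))) _.
rewrite /fubini_G integral0_eq // => y _ /=.
apply: (@integral_derivative_eq0 _ L (fun x => f (x, y, z))) => // x xL.
- by apply: f0; exact: not_cube1.
- by apply: g0; exact: not_cube1.
Qed.

Lemma integral3_derivative2 :
  (forall x y z : R, is_derive y (1 : R) (fun y => f (x, y, z)) (g (x, y, z))) ->
  (\int[leb3]_z g z = 0)%R.
Proof.
move=> df; rewrite /Rintegral (_ : integral _ _ _ = 0%E) //.
rewrite triple_fubini21 ?integral0_eq // => z _.
apply: etrans (esym (integral12_prod_meas1 (int12 z))) _.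
rewrite /fubini_F integral0_eq // => x _ /=.
apply: (@integral_derivative_eq0 _ L (fun y => f (x, y, z))) => // y yL.
- by apply: f0; exact: not_cube2.
- by apply: g0; exact: not_cube2.
Qed.

Lemma integral3_derivative3 :
  (forall x y z : R, is_derive z (1 : R) (fun z => f (x, y, z)) (g (x, y, z))) ->
  (\int[leb3]_z g z = 0)%R.
Proof.
move=> df; rewrite /Rintegral (_ : integral _ _ _ = 0%E) //.
rewrite triple_fubini12 ?integral0_eq // => -[x y] _ /=.
apply: (@integral_derivative_eq0 _ L (fun z => f (x, y, z))) => // z zL.
- by apply: f0; exact: not_cube3.
- by apply: g0; exact: not_cube3.
Qed.

End axes.

Lemma nonneg_integral3_eq0 (L : R) (f : R * R * R -> R) : continuous f ->
  (forall z, ~ cube L z -> f z = 0) -> (forall z, 0 <= f z) ->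
  (\int[leb3]_z f z <= 0)%R -> forall z, f z = 0.
Proof.
move=> cf f0 fge0 If; have intf := continuous_integrable3 cf f0.
move=> z0; apply/eqP; rewrite eq_le fge0 andbT leNgt; apply/negP => fz0.
set c := f z0 / 2; have c0 : 0 < c by rewrite divr_gt0.
have : \forall z \near z0, c < f z.
  apply: (cvgr_gt _ (cf z0)).
  by rewrite ltr_pdivrMr // mulr_natr mulr2n ltrDl.
move=> -[[P Q] /= [[[P1 P2] /= [nP1 nP2] P12] nQ] PQ].
have seg (x : R) (A : set R) : nbhs x A -> exists2 e : R, 0 < e & `[x - e, x + e] `<=` A.
  move=> /nbhs_ballP[e /= e0 xA]; exists (e / 2); first by rewrite divr_gt0.
  move=> y /=; rewrite in_itv /= => /andP[y1 y2]; apply: xA; rewrite /ball /= ltr_distl.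
  by apply/andP; split; lra.
have [e1 e10 s1] := seg _ _ nP1; have [e2 e20 s2] := seg _ _ nP2.
have [e3 e30 s3] := seg _ _ nQ.
pose B : set (R * R * R) := `[z0.1.1 - e1, z0.1.1 + e1]%classic `*` `[z0.1.2 - e2, z0.1.2 + e2]%classic
  `*` `[z0.2 - e3, z0.2 + e3]%classic.
have mB : measurable B by apply: measurableX => //; exact: measurableX.
have Bf z : B z -> c <= f z.
  move=> [[B1 B2] B3]; apply/ltW; apply: PQ; split => /=; last exact: s3.
  by apply: P12; split; [exact: s1|exact: s2].
have muB : leb3 B = (2 * e1 * (2 * e2) * (2 * e3))%:E.
  rewrite product_measure1E //=; last exact: measurableX.
  rewrite product_measure1E //= !lebesgue_measure_itv /= !lte_fin.
  rewrite !ifT; [|lra..]; rewrite -!EFinD -!EFinM; congr (_%:E); ring.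
have : (0 < \int[leb3]_z (f z)%:E)%E.
  apply: (@lt_le_trans _ _ (\int[leb3]_(z in B) (c%:E))%E).
    have -> : (\int[leb3]_(z in B) (c%:E) = (c * (2 * e1 * (2 * e2) * (2 * e3)))%:E)%E.
      by rewrite (EFinM c) -muB; exact: integral_cst.
    by rewrite lte_fin !mulr_gt0.
  have mf : measurable_fun setT (fun z : R * R * R => (f z)%:E).
    by apply/measurable_EFinP; exact: continuous_measurable3.
  have le1 : (\int[leb3]_(z in B) (c%:E) <= \int[leb3]_(z in B) (f z)%:E)%E.
    apply: ge0_le_integral => //.
    - by move=> z _; rewrite lee_fin ltW.
    - exact: measurable_funS mf.
  by apply: (le_trans le1); apply: ge0_subset_integral => // z _; rewrite lee_fin fge0.
rewrite ltNge => /negP; apply; move: If; rewrite /Rintegral -lee_fin fineK //.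
exact: integrable_fin_num.
Qed.

End space3.

(** * The volume of a ball *)

Section ball_volume.
Context {R : realType}.
Local Notation leb := (@lebesgue_measure R).
Local Notation leb3 := ((leb \x leb) \x leb)%E.

Lemma lebesgue_sqr_le (c : R) : leb [set y : R | y ^+ 2 <= c] = (2 * Num.sqrt c)%:E.
Proof.
have [c0|c0] := leP 0 c.
  have -> : [set y : R | y ^+ 2 <= c] = `[- Num.sqrt c, Num.sqrt c]%classic.
    by apply/seteqP; split => y /=; rewrite in_itv /= -ler_norml -sqrtr_sqr ler_sqrt.
  rewrite lebesgue_measure_itv /= lte_fin; have := sqrtr_ge0 c; case: ltP => h h'.
    by rewrite -EFinD; congr (_%:E); ring.
  by congr (_%:E); lra.
rewrite ltr0_sqrtr // mulr0 (_ : [set _ | _] = set0) ?measure0 //.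
by apply/seteqP; split => // y /=; rewrite leNgt (lt_le_trans c0) // sqr_ge0.
Qed.

Lemma sqr_lt_of_norm (a y : R) : `|y| < a -> y ^+ 2 < a ^+ 2.
Proof.
move=> ya; rewrite -[y ^+ 2]real_normK ?num_real //; have := normr_ge0 y; nra.
Qed.

Lemma sqrt_derive (a y : R) : `|y| < a ->
  is_derive y (1 : R) (fun y => Num.sqrt (a ^+ 2 - y ^+ 2)) (- y / Num.sqrt (a ^+ 2 - y ^+ 2)).
Proof.
move=> ya. have c0 : 0 < a ^+ 2 - y ^+ 2.
  by rewrite subr_gt0; exact: sqr_lt_of_norm.
have d2 : is_derive y (1 : R) (fun y => a ^+ 2 - y ^+ 2) (0 - 2 * y).
  exact: (isd_sub (isd_cst _ _ _) (isd_sqr _)).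
apply: (isd_eq (isd_comp (g := fun y : R => a ^+ 2 - y ^+ 2) (is_derive1_sqrt c0) d2)); field; rewrite sqrtr_eq0 -ltNge c0 //.
Qed.

(** An antiderivative of 2 sqrt(a^2 - y^2). The angle arcsin(y / a) is written
    2 atan(y / (a + s)) by the half-angle formula, which keeps the primitive
    continuous at the endpoints y = a and y = - a. *)
Definition half_disk (a y : R) : R :=
  let s := Num.sqrt (a ^+ 2 - y ^+ 2) in
  y * s + 2 * a ^+ 2 * atan (y / (a + s)).

Lemma half_disk_derive (a y : R) : `|y| < a ->
  is_derive y (1 : R) (half_disk a) (2 * Num.sqrt (a ^+ 2 - y ^+ 2)).
Proof.
move=> ya; have c0 : 0 < a ^+ 2 - y ^+ 2.
  by rewrite subr_gt0; exact: sqr_lt_of_norm.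
have a0 : 0 < a by exact: le_lt_trans ya.
have ds := sqrt_derive ya; set s := fun y => Num.sqrt _ in ds.
have s0 : 0 < s y by rewrite sqrtr_gt0.
have s2 : s y ^+ 2 = a ^+ 2 - y ^+ 2 by rewrite sqr_sqrtr // ltW.
have dy := isd_id y.
have as0 : a + s y != 0 by rewrite gt_eqF // addr_gt0.
have di := isd_inv (f := fun y : R => a + s y) as0 (isd_add (isd_cst a y 1) ds).
have dq := isd_mul dy di.
have dt := isd_comp (g := fun y : R => y * (a + s y)^-1) (is_derive1_atan _) dq.
have := isd_add (isd_mul dy ds)
  (isd_mul (isd_cst (2 * a ^+ 2) y 1) dt).
move=> h; apply: (isd_eq h); rewrite -/(s y).
have h1 : (a + s y) ^+ 2 + y ^+ 2 = 2 * a * (a + s y).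
  by rewrite -[y ^+ 2](subKr (a ^+ 2)) -s2; ring.
have e1 : (1 + (y * (a + s y)^-1) ^+ 2)^-1 = (a + s y) / (2 * a).
  have -> : 1 + (y * (a + s y)^-1) ^+ 2 = ((a + s y) ^+ 2 + y ^+ 2) / (a + s y) ^+ 2.
    by field.
  rewrite h1; field.
  by rewrite as0 gt_eqF.
rewrite e1 mulr0 addr0.
have y2 : y ^+ 2 = a ^+ 2 - s y ^+ 2 by rewrite s2; ring.
have -> : y * (- (0 + - y / s y) / (a + s y) ^+ 2) + (a + s y)^-1 * 1 =
   (y ^+ 2 / s y + (a + s y)) / (a + s y) ^+ 2.
  by field; rewrite as0 gt_eqF.
have -> : y * (- y / s y) + s y * 1 = s y - y ^+ 2 / s y by field; rewrite gt_eqF.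
rewrite y2; field.
by rewrite as0 !gt_eqF.
Qed.

Lemma half_disk_continuous (a : R) : 0 < a -> continuous (half_disk a).
Proof.
move=> a0 y; rewrite /half_disk.
have cs : {for y, continuous (fun y : R => Num.sqrt (a ^+ 2 - y ^+ 2))}.
  apply: (@continuous_comp _ _ _ (fun y : R => a ^+ 2 - y ^+ 2) (@Num.sqrt R)); last exact: sqrt_continuous.
  by apply: cvgB; [exact: cvg_cst|exact: exprn_continuous].
apply: cvgD; first by apply: cvgM; [exact: cvg_id|exact: cs].
apply: cvgM; first exact: cvg_cst.
apply: (@continuous_comp _ _ _ (fun y : R => y / (a + Num.sqrt (a ^+ 2 - y ^+ 2))) (@atan R)); last exact: continuous_atan.
apply: cvgM; first exact: cvg_id.
apply: cvgV; first by rewrite gt_eqF // ltr_wpDr ?sqrtr_ge0.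
by apply: cvgD; [exact: cvg_cst|exact: cs].
Qed.

Lemma integral_half_disk (a : R) : 0 <= a ->
  (\int[leb]_y (2 * Num.sqrt (a ^+ 2 - y ^+ 2))%:E = (pi * a ^+ 2)%:E)%E.
Proof.
move=> a0.
have out y : ~ `[- a, a]%classic y -> Num.sqrt (a ^+ 2 - y ^+ 2) = 0.
  rewrite /= in_itv /= -ler_norml => /negP; rewrite -ltNge => ay.
  apply/eqP; rewrite sqrtr_eq0 subr_le0 -[X in _ <= X]real_normK ?num_real //.
  nra.
have -> : (\int[leb]_y (2 * Num.sqrt (a ^+ 2 - y ^+ 2))%:E =
    \int[leb]_(y in `[(- a)%R, a]) (2 * Num.sqrt (a ^+ 2 - y ^+ 2))%:E)%E.
  rewrite [RHS]integral_mkcond; apply: eq_integral => y _; rewrite /patch; case: ifPn => //.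
  by rewrite notin_setE => /out ->; rewrite mulr0.
move: a0; rewrite le_eqVlt => /predU1P[<-|a0].
  by rewrite oppr0 set_itv1 integral_set1 expr0n mulr0.
have ch := half_disk_continuous a0.
rewrite (continuous_FTC2 (F := half_disk a)).
- rewrite /half_disk sqrrN subrr sqrtr0 !mulr0 !add0r addr0 mulNr divff ?gt_eqF //.
  by rewrite atanN atan1 -EFinB; congr (_%:E); field.
- by rewrite gtrN.
- apply: continuous_subspaceT => y; apply: cvgM; first exact: cvg_cst.
  apply: (@continuous_comp _ _ _ (fun y : R => a ^+ 2 - y ^+ 2) (@Num.sqrt R)); last exact: sqrt_continuous.
  by apply: cvgB; [exact: cvg_cst|exact: exprn_continuous].
- split => [y||].
  + by rewrite in_itv /= -ltr_norml => /half_disk_derive[].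
  + exact: cvg_at_right_filter (ch _).
  + exact: cvg_at_left_filter (ch _).
- by move=> y; rewrite in_itv /= -ltr_norml derive1E => /half_disk_derive[].
Qed.

Definition ball3 (r : R) : set (R * R * R) :=
  [set z | z.1.1 ^+ 2 + z.1.2 ^+ 2 + z.2 ^+ 2 <= r ^+ 2].

Lemma measurable_ball3 r : measurable (ball3 r).
Proof.
have cf : continuous (fun z : R * R * R => z.1.1 ^+ 2 + z.1.2 ^+ 2 + z.2 ^+ 2).
  move=> z.
  have c1 : (fun z : R * R * R => z.1.1) @ z --> z.1.1.
    by apply: (@continuous_comp _ _ _ fst fst); exact: cvg_fst.
  have c2 : (fun z : R * R * R => z.1.2) @ z --> z.1.2.
    by apply: (@continuous_comp _ _ _ fst snd); [exact: cvg_fst|exact: cvg_snd].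
  have c3 : (fun z : R * R * R => z.2) @ z --> z.2 by exact: cvg_snd.
  by apply: cvgD; [apply: cvgD|]; apply: cvgM.
have := continuous_measurable3 cf measurableT (measurable_itv `]-oo, r ^+ 2]).
rewrite setTI; congr (measurable _); apply/seteqP; split => z /=; by rewrite in_itv.
Qed.

Lemma ball3_cube r : 0 <= r -> ball3 r `<=` cube r.
Proof.
move=> r0 [[x y] z]; rewrite /ball3 /= => h.
have aux (a : R) : a ^+ 2 <= r ^+ 2 -> a \in `[- r, r].
  by rewrite in_itv /= -ler_norml -[a ^+ 2]real_normK ?num_real // => ?; have := normr_ge0 a; nra.
have := sqr_ge0 x; have := sqr_ge0 y; have := sqr_ge0 z => *.
by split; [split|]; apply: aux => /=; lra.
Qed.

Lemma integrable_ball3 r : 0 <= r -> leb3.-integrable setT (EFin \o (\1_(ball3 r) : _ -> R)).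
Proof.
move=> r0; apply: (@bounded_support_integrable _ _ _ leb3 (cube r) 1) => //.
- exact: measurable_cube.
- exact: cube_lty.
- apply: measurable_indic; exact: measurable_ball3.
- by move=> z; rewrite indicE; case: (_ \in _); rewrite ?normr1 ?normr0.
- move=> z zc; rewrite indicE memNset // => /(ball3_cube r0); exact: zc.
Qed.

Lemma disk_measure (c : R) :
  (leb \x leb)%E [set z : R * R | z.1 ^+ 2 + z.2 ^+ 2 <= c] = (pi * Num.max 0 c)%:E.
Proof.
rewrite /product_measure1.
under eq_integral => x _.
  rewrite /= (_ : xsection _ _ = [set y : R | y ^+ 2 <= c - x ^+ 2]); last first.
    apply/seteqP; split => y /=; rewrite /xsection /= inE /=; lra.
  rewrite lebesgue_sqr_le; over.
have [c0|c0] := leP 0 c.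
  by rewrite -{2}(sqr_sqrtr c0) -(integral_half_disk (sqrtr_ge0 c)) sqr_sqrtr.
rewrite mulr0; apply: integral0_eq => x _; rewrite ltr0_sqrtr ?mulr0 //.
have := sqr_ge0 x; lra.
Qed.

Lemma integral_ball3_section (r : R) : 0 <= r ->
  (\int[leb]_z (pi * Num.max 0 (r ^+ 2 - z ^+ 2))%:E = (4 * pi / 3 * r ^+ 3)%:E)%E.
Proof.
move=> r0.
have out y : ~ `[- r, r]%classic y -> Num.max 0 (r ^+ 2 - y ^+ 2) = 0.
  rewrite /= in_itv /= -ler_norml => /negP; rewrite -ltNge => ay.
  apply/max_idPl; rewrite subr_le0 -[X in _ <= X]real_normK ?num_real //; nra.
have -> : (\int[leb]_y (pi * Num.max 0 (r ^+ 2 - y ^+ 2))%:E =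
    \int[leb]_(y in `[(- r)%R, r]) (pi * (r ^+ 2 - y ^+ 2))%:E)%E.
  rewrite [RHS]integral_mkcond; apply: eq_integral => y _; rewrite /patch; case: ifPn.
    rewrite inE /= in_itv /= -ler_norml => yr; congr (_%:E); congr (_ * _).
    apply/max_idPr; rewrite subr_ge0 -[X in X <= _]real_normK ?num_real //.
    by have := normr_ge0 y; nra.
  by rewrite notin_setE => /out ->; rewrite mulr0.
move: r0; rewrite le_eqVlt => /predU1P[<-|r0].
  by rewrite oppr0 set_itv1 integral_set1 expr0n mulr0.
pose F := fun y : R => pi * (r ^+ 2 * y - y * y ^+ 2 / 3).
have dF (y : R) : is_derive y (1 : R) F (pi * (r ^+ 2 - y ^+ 2)).
  have d1 := isd_mul (isd_cst (r ^+ 2) y 1) (isd_id y).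
  have d2 := isd_mul (isd_mul (isd_id y) (isd_sqr y)) (isd_cst (3^-1) y 1).
  by apply: (isd_eq (isd_mul (isd_cst pi y 1) (isd_sub d1 d2))); field.
rewrite (continuous_FTC2 (F := F)).
- by rewrite -EFinB; congr (_%:E); rewrite /F; field.
- by rewrite gtrN.
- apply: continuous_subspaceT => y; apply: cvgM; first exact: cvg_cst.
  by apply: cvgB; [exact: cvg_cst|exact: exprn_continuous].
- split => [y _||].
  + by case: (dF y).
  + exact: cvg_at_right_filter (isd_continuous (dF _)).
  + exact: cvg_at_left_filter (isd_continuous (dF _)).
- by move=> y _; rewrite derive1E; case: (dF y).
Qed.

(** Cavalieri: the section of the ball at height z is a disk of area
    pi (r^2 - z^2), and the area of a disk is itself the integral of its chords. *)
Lemma volume_ball3 (r : R) : 0 <= r ->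
  (\int[leb3]_z (\1_(ball3 r) z : R) = 4 * pi / 3 * r ^+ 3)%R.
Proof.
move=> r0; rewrite /Rintegral (triple_fubini21 (integrable_ball3 r0)).
rewrite (_ : integral _ _ _ = (4 * pi / 3 * r ^+ 3)%:E) //.
rewrite -(integral_ball3_section r0); apply: eq_integral => z _.
rewrite -disk_measure.
pose D := [set w : R * R | w.1 ^+ 2 + w.2 ^+ 2 <= r ^+ 2 - z ^+ 2].
have DE w : ball3 r (w, z) <-> D w by rewrite /ball3 /D /=; split; lra.
transitivity (\int[(leb \x leb)%E]_w (\1_D w)%:E)%E.
  apply: eq_integral => w _; rewrite /= !indicE; congr ((nat_of_bool _)%:R%:E).
  by apply/idP/idP; rewrite !inE => /DE.
rewrite integral_indic ?setIT //.
have := measurable_ysection z (measurable_ball3 r).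
congr (measurable _); apply/seteqP; split => w; rewrite /ysection /= inE => /DE //.
Qed.

End ball_volume.

(** * Functions of class C^1 on the future half-space *)

Section spacetime_calculus.
Context {R : realType}.
Local Notation X := 'rV[R]_4.
Implicit Types (f g : X -> R) (x : X) (mu nu : 'I_4).

Definition axis mu : X := delta_mx 0 mu.

Lemma axisE mu nu : axis mu 0 nu = (mu == nu)%:R.
Proof. by rewrite mxE eqxx eq_sym. Qed.

Lemma cvg_rV (T : Type) n (F : set_system T) {FF : Filter F} (f : T -> 'rV[R]_n) (M : 'rV[R]_n) :
  (forall i, (fun t => f t 0 i) @ F --> M 0 i) -> f @ F --> M.
Proof.
move=> fM A [P nP PA]; rewrite /nbhs /=.
have : \forall t \near F, forall i : 'I_n, P 0 i (f t 0 i).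
  by apply: filter_forall => i; exact: fM (nP 0 i).
by apply: filterS => t Pt; apply: PA => i j; rewrite ord1.
Qed.

Lemma cvg_coord n (i : 'I_n) (x : 'rV[R]_n) : (fun y : 'rV[R]_n => y 0 i) @ x --> x 0 i.
Proof. exact: (@coord_continuous R 1 n 0 i x). Qed.

Lemma near_time_pos x : 0 < x 0 0 -> \forall y \near x, 0 < (y : X) 0 0.
Proof. by move=> x0; exact: (cvgr_gt _ (@cvg_coord 4 0 x)). Qed.

Lemma interior_future x : 0 < x 0 0 -> interior future x.
Proof. by move=> /near_time_pos; apply: filterS => y /ltW. Qed.

Lemma within_future x : 0 < x 0 0 -> within future (nbhs x) = nbhs x.
Proof.
move=> x0; apply/seteqP; split => A; rewrite /within /=; last by apply: filterS.
move=> h; have := interior_future x0; rewrite /interior /=.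
by move: h; apply: filterS2 => y h /h.
Qed.

(** Continuity is required up to the initial hyperplane, but derivatives only at
    positive times, where they are two-sided. This suffices: the integrals over
    slices are then continuous on a closed time interval and differentiable in
    its interior. *)
Record C1 f : Prop := MkC1 {
  C1_continuous : forall x, future x -> f @ within future (nbhs x) --> f x ;
  C1_derivable : forall mu x, 0 < x 0 0 -> derivable f x (axis mu) ;
  C1_dcontinuous : forall mu x, 0 < x 0 0 -> 'D_(axis mu) f @ x --> 'D_(axis mu) f x }.

Lemma C1_is_derive f mu x : C1 f -> 0 < x 0 0 -> is_derive x (axis mu) f ('D_(axis mu) f x).
Proof. by move=> cf x0; apply: derivableP; exact: C1_derivable. Qed.

Lemma C1_continuous_at f x : C1 f -> 0 < x 0 0 -> f @ x --> f x.
Proof. by move=> cf x0; have := C1_continuous cf (ltW x0); rewrite within_future. Qed.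

Lemma C1_intro f (df : 'I_4 -> X -> R) :
  (forall x, future x -> f @ within future (nbhs x) --> f x) ->
  (forall mu x, 0 < x 0 0 -> is_derive x (axis mu) f (df mu x)) ->
  (forall mu x, 0 < x 0 0 -> df mu @ x --> df mu x) -> C1 f.
Proof.
move=> cf dfP cdf; split => // mu x x0; first by case: (dfP mu x x0).
have E : \forall y \near x, df mu y = 'D_(axis mu) f y.
  by have := near_time_pos x0; apply: filterS => y /(dfP mu)[_ ->].
rewrite -(nbhs_singleton E).
exact: (near_eq_cvg_to (F := nbhs x) E (cdf mu x x0)).
Qed.

Lemma Ck_C1 f : Ck 1 (@coord_axes R 4) future f -> C1 f.
Proof.
move=> [/subspace_continuousP cf df]; split => //.
  move=> mu x x0; have [|+ _] := df (axis mu); first by exists mu.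
  by move=> /(_ x (ltW x0)); rewrite derivable_inE //; exact: interior_future.
move=> mu x x0; have [|_ [/subspace_continuousP/(_ x (ltW x0)) + _]] := df (axis mu).
  by exists mu.
rewrite within_future // /from_subspace derive_inE; last exact: interior_future.
apply: (near_eq_cvg_to (F := nbhs x)); have := near_time_pos x0.
by apply: filterS => y y0; rewrite derive_inE //; exact: interior_future.
Qed.

Lemma C1_cst c : C1 (fun=> c).
Proof.
apply: (@C1_intro _ (fun _ _ => 0)) => [x _|mu x _].
  exact: cvg_cst.
exact: (@cvg_cst R 0 _ (nbhs x) _).
Qed.

Lemma C1_add f g : C1 f -> C1 g -> C1 (fun x => f x + g x).
Proof.
move=> cf cg; apply: (@C1_intro _ (fun mu x => 'D_(axis mu) f x + 'D_(axis mu) g x)) => [x x0|mu x x0|mu x x0].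
- by apply: cvgD; exact: C1_continuous.
- by apply: isd_add; exact: C1_is_derive.
- exact: (cvgD (C1_dcontinuous cf x0) (C1_dcontinuous cg x0)).
Qed.

Lemma C1_mul f g : C1 f -> C1 g -> C1 (fun x => f x * g x).
Proof.
move=> cf cg; apply: (@C1_intro _ (fun mu x => f x * 'D_(axis mu) g x + g x * 'D_(axis mu) f x)) => [x x0|mu x x0|mu x x0].
- by apply: cvgM; exact: C1_continuous.
- by apply: isd_mul; exact: C1_is_derive.
- have cf0 := C1_continuous_at cf x0; have cg0 := C1_continuous_at cg x0.
  have dcf := C1_dcontinuous cf (mu := mu) x0; have dcg := C1_dcontinuous cg (mu := mu) x0.
  exact: (cvgD (cvgM cf0 dcg) (cvgM cg0 dcf)).
Qed.

Lemma C1_opp f : C1 f -> C1 (fun x => - f x).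
Proof.
move=> cf; rewrite (_ : (fun _ => _) = (fun x => -1 * f x)); last by apply/funext => x; rewrite mulN1r.
by apply: C1_mul => //; exact: C1_cst.
Qed.

Lemma C1_sub f g : C1 f -> C1 g -> C1 (fun x => f x - g x).
Proof. by move=> cf cg; apply: C1_add => //; exact: C1_opp. Qed.

Lemma C1_sum (I : Type) (r : seq I) (P : pred I) (F : I -> X -> R) : (forall i, C1 (F i)) ->
  C1 (fun x => \sum_(i <- r | P i) F i x).
Proof.
move=> cF; elim: r => [|i r IH].
  rewrite (_ : (fun _ => _) = fun=> 0); first exact: C1_cst.
  by apply/funext => x; rewrite big_nil.
have [Pi|Pi] := boolP (P i).
  rewrite (_ : (fun _ => _) = fun x => F i x + \sum_(i <- r | P i) F i x); first exact: C1_add.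
  by apply/funext => x; rewrite big_cons Pi.
rewrite (_ : (fun _ => _) = fun x => \sum_(i <- r | P i) F i x) //.
by apply/funext => x; rewrite big_cons (negbTE Pi).
Qed.

Lemma isd_coord mu nu x : is_derive x (axis mu) (fun y : X => y 0 nu) (mu == nu)%:R.
Proof.
apply/is_derive_lineP.
rewrite (_ : (fun _ => _) = (fun h : R => h * (mu == nu)%:R + x 0 nu)).
  have H := isd_add (isd_mul (isd_id (0 : R)) (isd_cst ((mu == nu)%:R : R) (0 : R) 1))
    (isd_cst (x 0 nu) (0 : R) 1).
  by apply: (isd_eq H); ring.
by apply/funext => h; rewrite !mxE eqxx eq_sym.
Qed.

Lemma C1_coord nu : C1 (fun x => x 0 nu).
Proof.
apply: (@C1_intro _ (fun mu x => (mu == nu)%:R)) => [x _|mu x _|mu x _].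
- by apply: cvg_within_filter; exact: cvg_coord.
- exact: isd_coord.
- exact: (@cvg_cst R _ _ (nbhs x) _).
Qed.

Lemma C1_comp (F F' : R -> R) f : C1 f ->
  (forall x, future x -> is_derive (f x) (1 : R) F (F' (f x))) ->
  (forall x, future x -> F' @ f x --> F' (f x)) -> C1 (fun x => F (f x)).
Proof.
move=> cf dF cF; apply: (@C1_intro _ (fun mu x => F' (f x) * 'D_(axis mu) f x)) => [x x0|mu x x0|mu x x0].
- by apply: (cvg_comp _ _ (C1_continuous cf x0)); exact: isd_continuous (dF _ x0).
- by apply: isd_comp; [exact: dF (ltW x0)|exact: C1_is_derive].
- have cF' := cvg_comp _ _ (C1_continuous_at cf x0) (cF x (ltW x0)).
  exact: (cvgM cF' (C1_dcontinuous cf x0)).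
Qed.

End spacetime_calculus.

(** * Time slices of spacetime *)

Section slices.
Context {R : realType}.
Local Notation X := 'rV[R]_4.
Local Notation S := (R * R * R)%type.
Implicit Types (f : X -> R) (x : X) (t : R) (z : S).

Definition space_index (i : 'I_3) : 'I_4 := rshift 1 i.

Definition pt t z : X := vec4 t (vec3 z).

Lemma pt_time t z : pt t z 0 0 = t.
Proof.
transitivity (row_mx (t%:M : 'M[R]_1) (vec3 z) 0 (lshift 3 (0 : 'I_1))); last by rewrite row_mxEl mxE.
by rewrite /pt /vec4; congr (row_mx _ _ _ _); exact: val_inj.
Qed.

Lemma pt_space t z i : pt t z 0 (space_index i) = vec3 z 0 i.
Proof. exact: (row_mxEr (t%:M : 'M[R]_1) (vec3 z) 0 i). Qed.

Lemma I4_split (i : 'I_4) : i = 0 \/ exists j, i = space_index j.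
Proof.
case: (unliftP ord0 i) => [j ->|->]; [right; exists j|by left].
by apply: val_inj.
Qed.

Lemma space_index_eq (i j : 'I_3) : (space_index i == space_index j) = (i == j).
Proof. exact: (inj_eq (@rshift_inj 1 3)). Qed.

Lemma sum4_split (V : nmodType) (F : 'I_4 -> V) : \sum_i F i = F 0 + \sum_(i < 3) F (space_index i).
Proof.
rewrite big_ord_recl; congr (_ + _); apply: eq_bigr => i _; congr (F _).
exact: val_inj.
Qed.

Lemma vec3E z : [/\ vec3 z 0 0 = z.1.1, vec3 z 0 1 = z.1.2 & vec3 z 0 2%:R = z.2].
Proof. by rewrite !mxE. Qed.

Lemma I3_cases (i : 'I_3) : [\/ i = 0, i = 1 | i = 2%:R].
Proof.
case: i => -[|[|[|//]]] h; [constructor 1|constructor 2|constructor 3]; exact: val_inj.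
Qed.

Lemma sum3_split (V : nmodType) (F : 'I_3 -> V) : \sum_i F i = F 0 + (F 1 + F 2%:R).
Proof.
rewrite !big_ord_recl big_ord0 addr0.
have -> : lift ord0 (ord0 : 'I_2) = 1 :> 'I_3 by exact: val_inj.
by have -> : lift ord0 (lift ord0 (ord0 : 'I_1)) = 2%:R :> 'I_3 by exact: val_inj.
Qed.

Lemma not_cube_coord (L : R) z : ~ cube L z -> exists i, L < `|vec3 z 0 i|.
Proof.
move=> zL; apply: contrapT => /forallNP H; apply: zL.
have {}H i : `|vec3 z 0 i| <= L by rewrite leNgt; apply/negP; exact: H.
have [e0 e1 e2] := vec3E z.
by split; [split|]; rewrite /= in_itv /= -ler_norml -?e0 -?e1 -?e2 H.
Qed.

Definition space_part (x : X) : S := (x 0 (space_index 0), x 0 (space_index 1), x 0 (space_index 2%:R)).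

Lemma pt_space_part (x : X) : x = pt (x 0 0) (space_part x).
Proof.
apply/rowP => i; have [->|[j ->]] := I4_split i; first by rewrite pt_time.
rewrite pt_space; have [e0 e1 e2] := vec3E (space_part x).
by have [->|->|->] := I3_cases j; rewrite ?e0 ?e1 ?e2.
Qed.

Lemma space_part_pt t z : space_part (pt t z) = z.
Proof. by rewrite /space_part !pt_space !mxE; case: z => -[]. Qed.

Lemma pt_shift_time h t z : pt (h + t) z = h *: axis 0 + pt t z.
Proof.
apply/rowP => i; rewrite [RHS]mxE [X in _ = X + _]mxE axisE.
have [->|[j ->]] := I4_split i; first by rewrite !pt_time mulr1.
by rewrite !pt_space mulr0 add0r.
Qed.

Lemma pt_shift1 h t a b c : pt t (h + a, b, c) = h *: axis (space_index 0) + pt t (a, b, c).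
Proof.
apply/rowP => i; rewrite [RHS]mxE [X in _ = X + _]mxE axisE.
have [->|[j ->]] := I4_split i; first by rewrite !pt_time mulr0 add0r.
rewrite !pt_space; have [->|->|->] := I3_cases j; rewrite !mxE /= ?mulr1 ?mulr0 ?add0r //.
Qed.

Lemma pt_shift2 h t a b c : pt t (a, h + b, c) = h *: axis (space_index 1) + pt t (a, b, c).
Proof.
apply/rowP => i; rewrite [RHS]mxE [X in _ = X + _]mxE axisE.
have [->|[j ->]] := I4_split i; first by rewrite !pt_time mulr0 add0r.
rewrite !pt_space; have [->|->|->] := I3_cases j; rewrite !mxE /= ?mulr1 ?mulr0 ?add0r //.
Qed.

Lemma pt_shift3 h t a b c : pt t (a, b, h + c) = h *: axis (space_index 2%:R) + pt t (a, b, c).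
Proof.
apply/rowP => i; rewrite [RHS]mxE [X in _ = X + _]mxE axisE.
have [->|[j ->]] := I4_split i; first by rewrite !pt_time mulr0 add0r.
rewrite !pt_space; have [->|->|->] := I3_cases j; rewrite !mxE /= ?mulr1 ?mulr0 ?add0r //.
Qed.

(** Partial derivatives on spacetime become ordinary derivatives along the
    coordinate lines, which are the lines p below. *)
Lemma isd_slice (p : R -> X) f mu (r a : R) :
  (forall h, p (h + r) = h *: axis mu + p r) ->
  is_derive (p r) (axis mu) f a -> is_derive r (1 : R) (fun s => f (p s)) a.
Proof.
move=> pE /is_derive_lineP H; apply/is_derive_lineP.
rewrite (_ : (fun _ => _) = (fun h : R => f (h *: axis mu + p r))) //.
by apply/funext => h; rewrite -pE [h *: (1 : R)]mulr1.
Qed.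

Lemma cvg_pt (T : Type) (F : set_system T) {FF : Filter F} (a : T -> R) (b : T -> S) t z :
  a @ F --> t -> b @ F --> z -> (fun y => pt (a y) (b y)) @ F --> pt t z.
Proof.
move=> ct cz; apply: cvg_rV => i; have [->|[j ->]] := I4_split i.
  by rewrite pt_time; under eq_fun do rewrite pt_time.
rewrite pt_space; under eq_fun do rewrite pt_space.
have c1 : (fun y => (b y).1) @ F --> z.1.
  by apply: (cvg_comp _ _ cz); exact: cvg_fst.
have [->|->|->] := I3_cases j; rewrite /vec3 mxE /=; under eq_fun do rewrite mxE /=.
- by apply: (cvg_comp _ _ c1); exact: cvg_fst.
- by apply: (cvg_comp _ _ c1); exact: cvg_snd.
- by apply: (cvg_comp _ _ cz); exact: cvg_snd.
Qed.

Lemma cvg_to_within (T : Type) (Y : topologicalType) (F : set_system T) {FF : Filter F}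
  (h : T -> Y) (A : set Y) (x : Y) : h @ F --> x -> (forall s, A (h s)) ->
  h @ F --> within A (nbhs x).
Proof.
move=> hx hA P; rewrite /within /= => /hx; rewrite /nbhs /=.
by apply: filterS => s; apply; exact: hA.
Qed.

End slices.

(** * Integrals over time slices and the divergence theorem *)

Section real_integrals.
Context d (T : measurableType d) (R : realType) (mu : {measure set T -> \bar R}).
Implicit Types f g : T -> R.

Lemma integrable_addr f g : mu.-integrable setT (EFin \o f) -> mu.-integrable setT (EFin \o g) ->
  mu.-integrable setT (EFin \o (fun x => f x + g x)).
Proof. by move=> fi gi; exact: (integrableD measurableT fi gi). Qed.

Lemma integrable_scaler (c : R) f : mu.-integrable setT (EFin \o f) ->
  mu.-integrable setT (EFin \o (fun x => c * f x)).
Proof. by move=> fi; exact: (integrableZl measurableT c fi). Qed.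

Lemma Rintegral_eq0 f : (forall x, f x = 0) -> (\int[mu]_x f x = 0)%R.
Proof. by move=> f0; rewrite /Rintegral integral0_eq // => x _; rewrite f0. Qed.

Lemma Rintegral_le0 f : (forall x, f x <= 0) -> (\int[mu]_x f x <= 0)%R.
Proof.
move=> f0; rewrite /Rintegral.
have -> : (\int[mu]_x (f x)%:E = - \int[mu]_x (- f x)%:E)%E.
  rewrite -integral_ge0N => [|x _]; last by rewrite lee_fin oppr_ge0.
  by apply: eq_integral => x _; rewrite -EFinN opprK.
rewrite fineN oppr_le0; apply: fine_ge0; apply: integral_ge0 => x _.
by rewrite lee_fin oppr_ge0.
Qed.

End real_integrals.

Section flux.
Context {R : realType}.
Local Notation X := 'rV[R]_4.
Local Notation S := (R * R * R)%type.
Local Notation leb := (@lebesgue_measure R).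
Local Notation leb3 := ((leb \x leb) \x leb)%E.
Implicit Types (f : X -> R) (t : R) (z : S).

Lemma pt_future t z : 0 <= t -> future (pt t z).
Proof. by rewrite /future /= pt_time. Qed.

Lemma cvg_slice f t z : f @ pt t z --> f (pt t z) ->
  (fun tz : R * S => f (pt tz.1 tz.2)) @ (t, z) --> f (pt t z).
Proof.
move=> cf; apply: (cvg_comp _ _ _ cf).
by apply: (@cvg_pt _ _ (nbhs (t, z))); [exact: cvg_fst|exact: cvg_snd].
Qed.

Lemma continuous_slice f t : (forall z, f @ pt t z --> f (pt t z)) ->
  continuous (fun z => f (pt t z)).
Proof.
move=> cf z; apply: (cvg_comp _ _ _ (cf z)).
by apply: (@cvg_pt _ _ (nbhs z)); [exact: cvg_cst|exact: cvg_id].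
Qed.

Lemma open_not_cube (L : R) : open (~` (cube L : set S)).
Proof.
rewrite openC; apply: compact_closed; first exact: norm_hausdorff.
by apply: compact_setX; [apply: compact_setX|]; exact: segment_compact.
Qed.

Section one_current.
Variables (g : X -> R) (T L : R).
Hypotheses (C1g : C1 g) (T0 : 0 < T) (L0 : 0 < L).
Hypothesis supp : forall t z, 0 <= t -> t <= T -> ~ cube L z -> g (pt t z) = 0.

(** Composing the time with this retraction onto [0, T] extends g continuously
    to all times, so that the dependence of an integral on a parameter in an
    open interval can be used at the endpoints 0 and T too. *)
Definition clamp t : R := Num.min T (Num.max 0 t).

Lemma clamp_ge0 t : 0 <= clamp t.
Proof. by rewrite /clamp le_min (ltW T0) le_max lexx. Qed.

Lemma clamp_le t : clamp t <= T.
Proof. by rewrite /clamp ge_min lexx. Qed.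

Lemma clamp_id t : 0 <= t -> t <= T -> clamp t = t.
Proof. by move=> t0 tT; rewrite /clamp max_r // min_r. Qed.

Lemma continuous_clamp : continuous clamp.
Proof.
move=> t; apply: continuous_min; first exact: cvg_cst.
by apply: continuous_max; [exact: cvg_cst|exact: cvg_id].
Qed.

Lemma clamped_continuous : continuous (fun tz : R * S => g (pt (clamp tz.1) tz.2)).
Proof.
move=> [t z]; have := C1_continuous C1g (pt_future z (clamp_ge0 t)).
have c1 : (fun tz : R * S => clamp tz.1) @ (t, z) --> clamp t.
  exact: (cvg_comp fst clamp cvg_fst (@continuous_clamp t)).
have c2 : (fun tz : R * S => tz.2) @ (t, z) --> z by exact: cvg_snd.
have c3 := cvg_to_within (cvg_pt c1 c2) (fun tz => pt_future tz.2 (clamp_ge0 tz.1)).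
move=> h; exact: (cvg_comp _ _ (c3 _ _) h).
Qed.

Lemma slice_continuous t : 0 <= t -> t <= T -> continuous (fun z => g (pt t z)).
Proof.
move=> t0 tT z; rewrite -(clamp_id t0 tT).
apply: (@continuous_comp _ _ _ (fun z => (t, z)) (fun tz : R * S => g (pt (clamp tz.1) tz.2))).
  by apply: cvg_to_pair; [exact: cvg_cst|exact: cvg_id].
exact: clamped_continuous.
Qed.

Lemma slice_integrable t : 0 <= t -> t <= T -> leb3.-integrable setT (EFin \o (fun z => g (pt t z))).
Proof.
move=> t0 tT; apply: (@continuous_integrable3 _ L); first exact: slice_continuous.
by move=> z; exact: supp.
Qed.

Lemma flux_continuous :
  {within `[0, T], continuous (fun t => \int[leb3]_z g (pt t z))}.
Proof.
pose F t := \int[leb3]_z g (pt (clamp t) z).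
have cpt : compact (`[-1, T + 1]%classic `*` cube L : set (R * S)).
  apply: compact_setX; first exact: segment_compact.
  by apply: compact_setX; [apply: compact_setX|]; exact: segment_compact.
have [M hM] := compact_bound cpt (continuous_subspaceT clamped_continuous).
have bnd t : `[-1, T + 1]%classic t -> forall z, `|g (pt (clamp t) z)| <= M * \1_(cube L) z.
  move=> tI z; have [zc|zc] := pselect (cube L z).
    by rewrite indicE mem_set // mulr1; apply: (hM (t, z)).
  by rewrite indicE memNset // mulr0 supp ?normr0 ?clamp_ge0 ?clamp_le.
have cF : {in `]-1, (T + 1)[%classic, continuous F}.
  apply: (@continuity_under_integral _ _ _ leb3 (fun t z => g (pt (clamp t) z)) setT
    measurableT (-1) (T + 1) _ _ (fun z => M * \1_(cube L) z)).
  - by move=> t _; apply: slice_integrable; rewrite ?clamp_ge0 ?clamp_le.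
  - apply: aeW => z _ t _.
    apply: (@continuous_comp _ _ _ (fun t => (t, z)) (fun tz : R * S => g (pt (clamp tz.1) tz.2))).
      by apply: cvg_to_pair; [exact: cvg_id|exact: cvg_cst].
    exact: clamped_continuous.
  - apply: (@bounded_support_integrable _ _ _ leb3 (cube L) `|M|).
    + exact: measurable_cube.
    + exact: cube_lty.
    + apply: measurable_funM; first exact: measurable_cst.
      by apply: measurable_indic; exact: measurable_cube.
    + move=> z; rewrite indicE normrM ler_piMr //.
      by case: (_ \in _); rewrite ?normr1 ?normr0.
    + by move=> z zc; rewrite indicE memNset // mulr0.
  - move=> t tI; apply: aeW => z _; apply: bnd.
    by apply: subset_itv_oo_cc; exact: tI.
apply/subspace_continuousP => t /=; rewrite in_itv /= => /andP[t0 tT].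
have tI : t \in `]-1, (T + 1)[%classic by rewrite inE /= in_itv /=; apply/andP; split; lra.
have := cF t tI => /cvg_within_filter cFt.
rewrite -{2}(clamp_id t0 tT); apply: (near_eq_cvg_to _ (cFt `[0, T]%classic)).
rewrite /prop_near1 /within /=; apply: nearW => s.
by rewrite in_itv /= => /andP[s0 sT]; rewrite /F clamp_id.
Qed.

(** The exterior of the cube is open, so g vanishes in a spacetime neighbourhood
    of the point. *)
Lemma derivative_supp mu t z : 0 < t -> t < T -> ~ cube L z -> 'D_(axis mu) g (pt t z) = 0.
Proof.
move=> t0 tT zc.
have Dz : \forall y \near pt t z, g y = 0.
  have n1 := near_time_pos (x := pt t z); rewrite pt_time in n1; have {}n1 := n1 t0.
  have n2 : \forall y \near pt t z, (y : X) 0 0 < T.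
    by apply: (cvgr_lt _ (@cvg_coord R 4 0 (pt t z))); rewrite pt_time.
  have n3 : \forall y \near pt t z, ~ cube L (space_part y).
    have cs : space_part @ pt t z --> space_part (pt t z).
      exact: (cvg_to_pair (cvg_to_pair (@cvg_coord R 4 _ _) (@cvg_coord R 4 _ _)) (@cvg_coord R 4 _ _)).
    rewrite space_part_pt in cs.
    have nz : nbhs z (~` cube L) by apply: open_nbhs_nbhs; split; first exact: open_not_cube.
    exact: (cs _ nz).
  move: n1; apply: filterS2 (filterI n2 n3) => y [yT ny] y0.
  by rewrite (pt_space_part y) supp // ltW.
have [_ <-] : is_derive (pt t z) (axis mu) g 0; last by [].
apply: (isd_near _ (isd_cst (0 : R) (pt t z) (axis mu))).
by apply: filterS Dz => y ->.
Qed.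

Lemma dslice_continuous mu t : 0 < t -> continuous (fun z => 'D_(axis mu) g (pt t z)).
Proof.
move=> t0; apply: (@continuous_slice ('D_(axis mu) g)) => z.
by apply: C1_dcontinuous => //; rewrite pt_time.
Qed.

Lemma dslice_integrable mu t : 0 < t -> t < T ->
  leb3.-integrable setT (EFin \o (fun z => 'D_(axis mu) g (pt t z))).
Proof.
move=> t0 tT; apply: (@continuous_integrable3 _ L); first exact: dslice_continuous.
by move=> z; exact: derivative_supp.
Qed.

Lemma isd_slice_time t z : 0 < t ->
  is_derive t (1 : R) (fun s => g (pt s z)) ('D_(axis 0) g (pt t z)).
Proof.
move=> t0; apply: (isd_slice (p := fun s => pt s z) (mu := 0)).
  by move=> h; exact: pt_shift_time.
by apply: C1_is_derive => //; rewrite pt_time.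
Qed.

(** Differentiation under the integral sign, dominated on a time interval
    [u, v] inside ]0, T[ by a multiple of the indicator of the cube. *)
Lemma time_derivative t : 0 < t -> t < T ->
  is_derive t (1 : R) (fun t => \int[leb3]_z g (pt t z))
    (\int[leb3]_z 'D_(axis 0) g (pt t z)).
Proof.
move=> t0 tT.
pose u := t / 2; pose v := (t + T) / 2.
have ut : u < t by rewrite /u; lra.
have tv : t < v by rewrite /v; lra.
have u0 : 0 < u by rewrite /u; lra.
have vT : v < T by rewrite /v; lra.
have cpt : compact (`[u, v]%classic `*` cube L : set (R * S)).
  apply: compact_setX; first exact: segment_compact.
  by apply: compact_setX; [apply: compact_setX|]; exact: segment_compact.
have cD : {within (`[u, v]%classic `*` cube L : set (R * S)),
    continuous (fun tz : R * S => 'D_(axis 0) g (pt tz.1 tz.2))}.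
  apply: continuous_in_subspaceT => -[s z]; rewrite inE => -[/= + _].
  rewrite in_itv /= => /andP[us _]; apply: (@cvg_slice ('D_(axis 0) g)).
  by apply: C1_dcontinuous => //; rewrite pt_time; exact: lt_le_trans us.
have [M hM] := compact_bound cpt cD.
have := @cvg_differentiation_under_integral R _ _ leb3 (fun s z => g (pt s z)) setT
  measurableT t u v _ _ _ (fun z => `|M| * \1_(cube L) z) _ _ _.
have dE s z : 0 < s -> partial1of2 (fun s z => g (pt s z)) s z = 'D_(axis 0) g (pt s z).
  by move=> s0; rewrite partial1of2E; case: (isd_slice_time z s0).
move=> H; have {}H := H _ _ _ _ _ _.
have cvgF : h^-1 *: ((fun t => \int[leb3]_z g (pt t z)) (h + t) -
   (fun t => \int[leb3]_z g (pt t z)) t) @[h --> 0^'] --> \int[leb3]_z 'D_(axis 0) g (pt t z).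
  rewrite (_ : (\int[leb3]_z 'D_(axis 0) g (pt t z)) =
    \int[leb3]_z partial1of2 (fun s z => g (pt s z)) t z); last first.
    by apply: eq_Rintegral => z _; rewrite dE.
  apply: H.
  - by rewrite /= in_itv /= ut tv.
  - move=> s /=; rewrite in_itv /= => /andP[us sv].
    by apply: slice_integrable; lra.
  - move=> s z; rewrite /= in_itv /= => /andP[us sv] _.
    by have [] := @isd_slice_time s z ltac:(lra).
  - by move=> z; rewrite mulr_ge0 // indicE.
  - apply: (@bounded_support_integrable _ _ _ leb3 (cube L) `|M|).
    + exact: measurable_cube.
    + exact: cube_lty.
    + apply: measurable_funM; first exact: measurable_cst.
      by apply: measurable_indic; exact: measurable_cube.
    + move=> z; rewrite indicE normrM normr_id ler_piMr //.
      by case: (_ \in _); rewrite ?normr1 ?normr0.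
    + by move=> z zc; rewrite indicE memNset // mulr0.
  - move=> s z; rewrite /= in_itv /= => /andP[us sv] _; rewrite dE; last lra.
    have [zc|zc] := pselect (cube L z).
      rewrite indicE mem_set // mulr1; apply: le_trans (ler_norm M); apply: (hM (s, z)).
      by split => //=; rewrite in_itv /= !ltW.
    by rewrite derivative_supp ?normr0 ?indicE ?memNset ?mulr0 //; lra.
have cvgF' : h^-1 *: (((fun t => \int[leb3]_z g (pt t z)) \o shift t) (h *: 1) -
   (fun t => \int[leb3]_z g (pt t z)) t) @[h --> 0^'] --> \int[leb3]_z 'D_(axis 0) g (pt t z).
  move: cvgF; apply: near_eq_cvg_to; apply: nearW => h /=.
  by rewrite [h *: (1 : R)]mulr1.
by split; [apply/cvg_ex; eexists; exact: cvgF'|exact: cvg_lim cvgF'].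
Qed.

End one_current.

Section divergence.
Variables (G : 'I_4 -> X -> R) (T L : R).
Hypotheses (C1G : forall mu, C1 (G mu)) (T0 : 0 < T) (L0 : 0 < L).
Hypothesis supp : forall mu t z, 0 <= t -> t <= T -> ~ cube L z -> G mu (pt t z) = 0.

Lemma space_derivative t i : 0 < t -> t < T ->
  \int[leb3]_z 'D_(axis (space_index i)) (G (space_index i)) (pt t z) = 0.
Proof.
move=> t0 tT.
have c1 : continuous (fun z => 'D_(axis (space_index i)) (G (space_index i)) (pt t z)).
  by apply: dslice_continuous.
have s1 z : ~ cube L z -> G (space_index i) (pt t z) = 0 by apply: supp; exact: ltW.
have s2 z : ~ cube L z -> 'D_(axis (space_index i)) (G (space_index i)) (pt t z) = 0.
  by apply: (derivative_supp (T := T)) => //; exact: supp.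
have dG z : is_derive (pt t z) (axis (space_index i)) (G (space_index i)) ('D_(axis (space_index i)) (G (space_index i)) (pt t z)).
  by apply: C1_is_derive => //; rewrite pt_time.
move: c1 s1 s2 dG; have [->|->|->] := I3_cases i => c1 s1 s2 dG.
- apply: (@integral3_derivative1 _ L (fun z => G (space_index 0) (pt t z))) => // x y z.
  by apply: (@isd_slice _ (fun x => pt t (x, y, z)) (G (space_index 0)) (space_index 0)) => h; exact: pt_shift1.
- apply: (@integral3_derivative2 _ L (fun z => G (space_index 1) (pt t z))) => // x y z.
  by apply: (@isd_slice _ (fun y => pt t (x, y, z)) (G (space_index 1)) (space_index 1)) => h; exact: pt_shift2.
- apply: (@integral3_derivative3 _ L (fun z => G (space_index 2%:R) (pt t z))) => // x y z.
  by apply: (@isd_slice _ (fun c => pt t (x, y, c)) (G (space_index 2%:R)) (space_index 2%:R)) => h; exact: pt_shift3.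
Qed.

(** Adding the spatial divergence changes nothing, because the integral of a
    spatial derivative with compact support is zero. *)
Lemma flux_derivative t : 0 < t -> t < T ->
  is_derive t (1 : R) (fun t => \int[leb3]_z G 0 (pt t z))
    (\int[leb3]_z \sum_mu 'D_(axis mu) (G mu) (pt t z)).
Proof.
move=> t0 tT; have H := time_derivative (C1G 0) T0 (@supp 0) t0 tT. apply: (isd_eq H).
have int mu : leb3.-integrable setT (EFin \o (fun z => 'D_(axis mu) (G mu) (pt t z))).
  by apply: (@dslice_integrable _ T L) => //; exact: supp.
rewrite [RHS](_ : _ = \int[leb3]_z ('D_(axis 0) (G 0) (pt t z) +
   ('D_(axis (space_index 0)) (G (space_index 0)) (pt t z) + ('D_(axis (space_index 1)) (G (space_index 1)) (pt t z) +
     'D_(axis (space_index 2%:R)) (G (space_index 2%:R)) (pt t z))))); last first.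
  apply: eq_Rintegral => z _; by rewrite sum4_split sum3_split.
rewrite RintegralD //; last by do 2! (apply: integrable_addr => //).
rewrite RintegralD //; last by apply: integrable_addr.
by rewrite RintegralD // !space_derivative // !addr0.
Qed.

End divergence.
End flux.

(** * Conserved currents in a backward cone *)

Section cone.
Context {R : realType}.
Local Notation X := 'rV[R]_4.
Local Notation S := (R * R * R)%type.
Local Notation leb := (@lebesgue_measure R).
Local Notation leb3 := ((leb \x leb) \x leb)%E.

Record conserved (J : 'I_4 -> X -> R) : Prop := MkConserved {
  conserved_C1 : forall mu, C1 (J mu) ;
  conserved_div : forall x : X, 0 < x 0 0 -> \sum_mu 'D_(axis mu) (J mu) x = 0 }.

Lemma weighted_divergence (phi : X -> R) (J : 'I_4 -> X -> R) (x : X) :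
  C1 phi -> conserved J -> 0 < x 0 0 ->
  \sum_mu 'D_(axis mu) (fun y => phi y * J mu y) x = \sum_mu J mu x * 'D_(axis mu) phi x.
Proof.
move=> cphi [cJ dJ] x0.
under eq_bigr => mu _ do
  have -> : 'D_(axis mu) (fun y => phi y * J mu y) x =
    phi x * 'D_(axis mu) (J mu) x + J mu x * 'D_(axis mu) phi x
    by have [_] := isd_mul (C1_is_derive mu cphi x0) (C1_is_derive mu (cJ mu) x0).
by rewrite big_split /= -mulr_sumr dJ // mulr0 add0r.
Qed.

Lemma cauchy_schwarz3 (a b : 'I_3 -> R) :
  (\sum_i a i * b i) ^+ 2 <= (\sum_i a i ^+ 2) * (\sum_i b i ^+ 2).
Proof.
rewrite !big_ord_recl !big_ord0 !addr0.
set a0 := a _; set a1 := a _; set a2 := a _; set b0 := b _; set b1 := b _; set b2 := b _.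
rewrite -subr_ge0.
rewrite (_ : _ - _ = (a0 * b1 - a1 * b0) ^+ 2 + (a0 * b2 - a2 * b0) ^+ 2 + (a1 * b2 - a2 * b1) ^+ 2).
  by rewrite !addr_ge0 // sqr_ge0.
ring.
Qed.

(** The square makes the positive part continuously differentiable. It serves
    as a cutoff in cone_vanish and as an entropy penalty in entropy_minimum. *)
Definition pos_sqr (r : R) : R := (Num.max 0 r) ^+ 2.

Lemma isd_pos_sqr (r : R) : is_derive r (1 : R) pos_sqr (2 * Num.max 0 r).
Proof.
have [r0|r0|<-] := ltgtP 0 r.
- apply: (isd_near _ (isd_sqr r)).
  by apply: filterS (lt_nbhsr r0) => s s0; rewrite /pos_sqr max_r // ltW.
- rewrite mulr0.
  apply: (isd_near _ (isd_cst (0 : R) r (1 : R))).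
  by apply: filterS (lt_nbhsl r0) => s s0; rewrite /pos_sqr max_l ?expr0n // ltW.
rewrite mulr0.
have H : h^-1 *: ((pos_sqr \o shift (0 : R)) (h *: (1 : R)) - pos_sqr 0) @[h --> (0 : R)^'] --> (0 : R).
  have n0 : (fun h : R => `|h|) @ (0 : R)^' --> (0 : R).
    by rewrite -{2}(normr0 R); apply: cvg_within_filter; exact: norm_continuous.
  apply: (@squeeze_cvgr _ _ _ _ (fun h : R => - `|h|) (fun h : R => `|h|)).
  - near=> h; rewrite /pos_sqr /= maxxx expr0n subr0 addr0 [h *: (1 : R)]mulr1.
    have h0 : h != 0 by near: h; exact: nbhs_dnbhs_neq.
    rewrite -ler_norml [_ *: _]mulrC normrM normfV.
    have [hp|hn] := leP 0 h.
      by rewrite normrX expr2 mulfK // normr_eq0.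
    by rewrite expr0n normr0 mul0r.
  - by rewrite -[X in _ --> X]oppr0; apply: cvgN.
  - exact: n0.
by split; [apply/cvg_ex; eexists; exact: H|exact: cvg_lim H].
Unshelve. all: by end_near. Qed.

Lemma pos_part_continuous : continuous (fun r : R => 2 * Num.max 0 r).
Proof.
move=> r; apply: cvgM; first exact: cvg_cst.
by apply: continuous_max; [exact: cvg_cst|exact: cvg_id].
Qed.

Lemma weighted_flux_derivative (phi : X -> R) (J : 'I_4 -> X -> R) (T L t : R) :
  C1 phi -> conserved J -> 0 < T -> 0 < L ->
  (forall t z, 0 <= t -> t <= T -> ~ cube L z -> forall mu, phi (pt t z) * J mu (pt t z) = 0) ->
  0 < t -> t < T ->
  is_derive t (1 : R) (fun t => \int[leb3]_z (phi (pt t z) * J 0 (pt t z)))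
    (\int[leb3]_z \sum_mu J mu (pt t z) * 'D_(axis mu) phi (pt t z)).
Proof.
move=> cphi cJ T0 L0 supp t0 tT.
have H := @flux_derivative R (fun mu x => phi x * J mu x) T L
  (fun mu => C1_mul cphi (conserved_C1 cJ mu)) T0 L0 (fun mu t z h1 h2 h3 => supp t z h1 h2 h3 mu) t t0 tT.
apply: (isd_eq H); apply: eq_Rintegral => z _.
by apply: weighted_divergence => //; rewrite pt_time.
Qed.

Variables (sigma t2 : R) (c : 'I_3 -> R).
Hypotheses (sigma0 : 0 <= sigma) (t20 : 0 < t2).

Definition dist2 (x : X) : R := \sum_i (x 0 (space_index i) - c i) ^+ 2.

Definition in_cone (x : X) : Prop := dist2 x < (sigma * (t2 - x 0 0)) ^+ 2.

Let depth (x : X) : R := (sigma * (t2 - x 0 0)) ^+ 2 - dist2 x.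

(** A weight that is positive exactly inside the cone. It replaces the
    integration over a domain with moving boundary: the flux through the lateral
    boundary of the cone becomes the contraction of J with the gradient of the
    weight. *)
Let weight (x : X) : R := pos_sqr (depth x).

Let isd_depth mu x : is_derive x (axis mu) depth
  (- (2 * sigma ^+ 2 * (t2 - x 0 0)) * (mu == 0)%:R -
   2 * \sum_i (x 0 (space_index i) - c i) * (mu == space_index i)%:R).
Proof.
have d0 := isd_sub (isd_cst t2 x (axis mu)) (isd_coord mu 0 x).
have d1 := isd_mul (isd_cst sigma x (axis mu)) d0.
have d2 := isd_comp (g := fun y : X => sigma * (t2 - y 0 0)) (isd_sqr _) d1.
have ds : is_derive x (axis mu) dist2 (2 * \sum_i (x 0 (space_index i) - c i) * (mu == space_index i)%:R).
  have e (i : 'I_3) := isd_comp (g := fun y : X => y 0 (space_index i) - c i) (isd_sqr _)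
    (isd_sub (isd_coord mu (space_index i) x) (isd_cst (c i) x (axis mu))).
  rewrite /dist2 (_ : (fun _ => _) = fun y : X =>
    (y 0 (space_index 0) - c 0) ^+ 2 + ((y 0 (space_index 1) - c 1) ^+ 2 + (y 0 (space_index 2%:R) - c 2%:R) ^+ 2)).
    apply: (isd_eq (isd_add (e 0) (isd_add (e 1) (e 2%:R)))).
    by rewrite sum3_split; ring.
  by apply/funext => y; rewrite sum3_split.
apply: (isd_eq (isd_sub d2 ds)); rewrite eq_sym; ring.
Qed.

Let C1_depth : C1 depth.
Proof.
apply: C1_sub.
  apply: (@C1_comp _ (fun r => r ^+ 2) (fun r => 2 * r) (fun x : X => sigma * (t2 - x 0 0))).
  - by apply: C1_mul; [exact: C1_cst|apply: C1_sub; [exact: C1_cst|exact: C1_coord]].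
  - by move=> x _; exact: isd_sqr.
  - by move=> x _; apply: cvgM; [exact: cvg_cst|exact: cvg_id].
apply: C1_sum => i.
apply: (@C1_comp _ (fun r => r ^+ 2) (fun r => 2 * r) (fun x : X => x 0 (space_index i) - c i)).
- by apply: C1_sub; [exact: C1_coord|exact: C1_cst].
- by move=> x _; exact: isd_sqr.
- by move=> x _; apply: cvgM; [exact: cvg_cst|exact: cvg_id].
Qed.

Let C1_weight : C1 weight.
Proof.
apply: (@C1_comp _ pos_sqr (fun r => 2 * Num.max 0 r)) => // x _.
  exact: isd_pos_sqr.
exact: pos_part_continuous.
Qed.

Let weight_derivative mu x : 'D_(axis mu) weight x = 2 * Num.max 0 (depth x) *
  (- (2 * sigma ^+ 2 * (t2 - x 0 0)) * (mu == 0)%:R -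
   2 * \sum_i (x 0 (space_index i) - c i) * (mu == space_index i)%:R).
Proof. by have [_] := isd_comp (isd_pos_sqr (depth x)) (isd_depth mu x). Qed.

Let weight_flux (J : 'I_4 -> X -> R) x : \sum_mu J mu x * 'D_(axis mu) weight x =
  - (4 * Num.max 0 (depth x)) *
  (sigma ^+ 2 * (t2 - x 0 0) * J 0 x + \sum_i (x 0 (space_index i) - c i) * J (space_index i) x).
Proof.
under eq_bigr => mu _ do rewrite weight_derivative.
rewrite sum4_split eqxx mulr1 big1 => [|i _]; last by rewrite mulr0.
rewrite mulr0 subr0.
have E (i : 'I_3) : \sum_j (x 0 (space_index j) - c j) * (space_index i == space_index j)%:R = x 0 (space_index i) - c i.
  rewrite (bigD1 i) //= eqxx mulr1 big1 ?addr0 // => j ji.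
  by rewrite space_index_eq eq_sym (negbTE ji) mulr0.
under eq_bigr => i _ do rewrite E mulr0 add0r.
rewrite [RHS]mulrDr mulr_sumr; congr (_ + _); first by ring.
by apply: eq_bigr => i _; ring.
Qed.

Let radius : R := 1 + sigma * t2 + \sum_i `|c i|.

Let radius_gt0 : 0 < radius.
Proof. by rewrite /radius -addrA ltr_pwDl // addr_ge0 ?sumr_ge0 // mulr_ge0 // ltW. Qed.

Let weight_supp t z : 0 <= t -> t <= t2 -> ~ cube radius z -> weight (pt t z) = 0.
Proof.
move=> t0 tt2 zr; rewrite /weight /pos_sqr max_l ?expr0n //.
rewrite /depth pt_time subr_le0.
have [i ri] := not_cube_coord zr.
apply: (@le_trans _ _ ((vec3 z 0 i - c i) ^+ 2)); last first.
  rewrite /dist2 (bigD1 i) //= pt_space lerDl sumr_ge0 // => j _; exact: sqr_ge0.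
have ci : `|c i| <= \sum_i `|c i| by rewrite (bigD1 i) //= lerDl sumr_ge0.
have h1 : sigma * t2 <= `|vec3 z 0 i - c i|.
  apply: le_trans (lerB_dist _ _).
  by move: ri; rewrite /radius; lra.
rewrite -[X in _ <= X]real_normK ?num_real // ler_pXn2r ?nnegrE ?mulr_ge0 ?subr_ge0 //.
by apply: le_trans h1; rewrite ler_wpM2l // gerBl.
Qed.

(** Let phi be the weight. The time derivative of the integral of phi J^0 is the
    integral of J^mu d_mu phi, which is nonpositive: up to a positive factor,
    the gradient of phi is - (sigma^2 (t2 - t), x - c), and inside the cone
    |x - c| <= sigma (t2 - t) while the spatial part of J is at most
    sigma J^0. Starting from 0, the integral of the nonnegative function
    phi J^0 remains 0. *)
Lemma cone_vanish (J : 'I_4 -> X -> R) (a b : R) : conserved J -> 0 <= a -> b <= t2 ->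
  (forall x : X, a <= x 0 0 -> x 0 0 <= b -> in_cone x ->
     0 <= J 0 x /\ \sum_i J (space_index i) x ^+ 2 <= sigma ^+ 2 * J 0 x ^+ 2) ->
  (forall x : X, x 0 0 = a -> in_cone x -> J 0 x = 0) ->
  forall x : X, a <= x 0 0 -> x 0 0 <= b -> in_cone x -> J 0 x = 0.
Proof.
move=> cJ a0 bt2 dom init.
pose I t := \int[leb3]_z (weight (pt t z) * J 0 (pt t z)).
have Jw_ge0 (x : X) : a <= x 0 0 -> x 0 0 <= b -> 0 <= weight x * J 0 x.
  move=> ax xb; have [xc|xc] := pselect (in_cone x).
    by rewrite mulr_ge0 ?sqr_ge0 //; have [] := dom x ax xb xc.
  rewrite /weight /pos_sqr max_l ?expr0n ?mul0r //.
  by rewrite /depth subr_le0 leNgt; apply/negP.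
have supp t z : 0 <= t -> t <= t2 -> ~ cube radius z -> forall mu, weight (pt t z) * J mu (pt t z) = 0.
  by move=> h1 h2 h3 mu; rewrite weight_supp // mul0r.
have cI : {within `[0, t2], continuous I}.
  apply: (@flux_continuous R (fun x => weight x * J 0 x) t2 radius) => //.
    by apply: C1_mul => //; exact: conserved_C1.
  by move=> t z h1 h2 h3; exact: supp.
have dI t : 0 < t -> t < t2 -> is_derive t (1 : R) I
   (\int[leb3]_z \sum_mu J mu (pt t z) * 'D_(axis mu) weight (pt t z)).
  by move=> h1 h2; apply: (weighted_flux_derivative C1_weight cJ t20 radius_gt0).
have Ia t : a <= t -> t <= b -> I t <= 0.
  move=> a_t tb.
  have -> : 0 = I a.
    rewrite /I Rintegral_eq0 // => z; have [zc|zc] := pselect (in_cone (pt a z)).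
      by rewrite init ?mulr0 // pt_time.
    rewrite /weight /pos_sqr max_l ?expr0n ?mul0r //.
    by rewrite /depth subr_le0 leNgt; apply/negP.
  apply: (@ler0_derive1_nincr _ I a b) => //.
  - move=> s; rewrite in_itv /= => /andP[a_s sb].
    by have [] := dI s (le_lt_trans a0 a_s) (lt_le_trans sb bt2).
  - move=> s; rewrite in_itv /= => /andP[a_s sb]; rewrite derive1E.
    have [_ ->] := dI s (le_lt_trans a0 a_s) (lt_le_trans sb bt2).
    apply: Rintegral_le0 => z; rewrite weight_flux.
    have [zc|zc] := pselect (in_cone (pt s z)); last first.
      rewrite max_l ?mulr0 ?oppr0 ?mul0r //.
      by rewrite /depth subr_le0 leNgt; apply/negP.
    have [J0 JJ] : 0 <= J 0 (pt s z) /\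
        \sum_i J (space_index i) (pt s z) ^+ 2 <= sigma ^+ 2 * J 0 (pt s z) ^+ 2.
      by apply: dom; rewrite ?pt_time ?ltW.
    rewrite pt_time.
    rewrite -oppr_ge0 -mulNr opprK; apply: mulr_ge0; first by rewrite mulr_ge0 // le_max lexx.
    set w := \sum_i _.
    have ts : 0 <= t2 - s by lra.
    have w2 : w ^+ 2 <= (sigma ^+ 2 * (t2 - s) * J 0 (pt s z)) ^+ 2.
      apply: le_trans (cauchy_schwarz3 _ _) _.
      rewrite (_ : _ ^+ 2 = (sigma * (t2 - s)) ^+ 2 * (sigma ^+ 2 * J 0 (pt s z) ^+ 2)); last by ring.
      apply: ler_pM => //; rewrite ?sumr_ge0 //; try by move=> i _; exact: sqr_ge0.
      by move: zc; rewrite /in_cone pt_time => /ltW.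
    have k0 : 0 <= sigma ^+ 2 * (t2 - s) * J 0 (pt s z).
      by rewrite !mulr_ge0 // sqr_ge0.
    nra.
  - by apply: continuous_subspaceW cI => s /=; rewrite !in_itv /= => /andP[s1 s2]; apply/andP; split; lra.
move=> x ax xb xc.
have t0 : 0 <= x 0 0 by exact: le_trans ax.
have wJ : weight x * J 0 x = 0.
  rewrite (pt_space_part x).
  apply: (@nonneg_integral3_eq0 R radius (fun z => weight (pt (x 0 0) z) * J 0 (pt (x 0 0) z))).
  - apply: (@slice_continuous _ (fun x => weight x * J 0 x) t2) => //; last exact: le_trans bt2.
    by apply: C1_mul => //; exact: conserved_C1.
  - by move=> z zr; apply: supp => //; exact: le_trans bt2.
  - by move=> z; apply: Jw_ge0; rewrite pt_time.
  - exact: Ia.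
move: wJ => /eqP; rewrite mulf_eq0 => /orP[|/eqP//].
rewrite /weight /pos_sqr sqrf_eq0 max_r; last by rewrite subr_ge0 ltW.
by rewrite /depth subr_eq0 gt_eqF.
Qed.

End cone.

(** * The chain rule for functions of the thermodynamic state *)

Lemma cvg_through (T : Type) (U : topologicalType) (W : Type) (F : set_system T) {FF : Filter F}
    (h : T -> U) (B : set U) (x : U) (G : U -> W) (l : set_system W) :
  h @ F --> x -> (\forall t \near F, B (h t)) -> G @ within B (nbhs x) --> l ->
  (fun t => G (h t)) @ F --> l.
Proof.
move=> hx nB Gl P lP; have h1 : F (h @^-1` (fun u => B u -> P (G u))) by exact: hx (Gl _ lP).
have : F (fun t => P (G (h t))) by apply: filterS2 nB h1 => t Bt; apply.
by [].
Qed.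

Lemma near_withinW (T : Type) (F : set_system T) {FF : Filter F} (A P : set T) :
  (forall t, A t -> P t) -> \forall t \near within A F, P t.
Proof. by move=> AP; have : F (fun t => A t -> P t) by exact: filterE. Qed.

Section state_functions.
Context {R : realType}.
Local Notation X := 'rV[R]_4.
Variable F : R * R -> R.
Hypothesis CF : Ck 1 state_axes states F.

Lemma state_continuous q : states q -> F @ within states (nbhs q) --> F q.
Proof. by case: CF => /subspace_continuousP cF _; exact: cF. Qed.

Lemma d_n_continuous q : states q -> d_n F @ within states (nbhs q) --> d_n F q.
Proof.
case: CF => _ /(_ (1, 0))[|_ [/subspace_continuousP cF _]]; first by left.
exact: cF.
Qed.

Lemma d_s_continuous q : states q -> d_s F @ within states (nbhs q) --> d_s F q.
Proof.
case: CF => _ /(_ (0, 1))[|_ [/subspace_continuousP cF _]]; first by right.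
exact: cF.
Qed.

(** Away from the boundary of the quadrant of states in the direction v, the
    one-sided derivative is the two-sided one. *)
Lemma quotient_filter_near (v q : R * R) : (\forall h \near (0 : R), states (h *: v + q)) ->
  quotient_filter states v q = (0 : R)^'.
Proof.
move=> near_st; apply/seteqP; split => A; rewrite /quotient_filter /within /=.
  have H : \forall h \near (0 : R)^', states (h *: v + q).
    by rewrite /dnbhs /within /=; apply: filterS near_st => h sh _.
  by apply: filterS2 H => h sh; apply.
by apply: filterS => h Ah _.
Qed.

Lemma isd_state_n (n s : R) : 0 < n -> 0 <= s ->
  is_derive n (1 : R) (fun m => F (m, s)) (d_n F (n, s)).
Proof.
move=> n0 s0.
have qE : quotient_filter states (1, 0) (n, s) = (0 : R)^'.
  apply: quotient_filter_near.
  have : \forall h \near (0 : R), - n < h by apply: lt_nbhsr; rewrite oppr_lt0.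
  apply: filterS => h hn; split => /=.
    by rewrite [h *: 1]mulr1; lra.
  by rewrite scaler0 add0r.
case: CF => _ /(_ (1, 0))[|dF _]; first by left.
have {dF} : derivable_in states (1, 0) F (n, s) by apply: dF; split => //=; exact: ltW.
rewrite /d_n /derivable_in /derive_in qE.
set f := (fun h => _); set g := (fun m => F (m, s)).
have fg : f = (fun h : R => h^-1 *: ((g \o shift n) (h *: (1 : R)) - g n)).
  apply/funext => h; rewrite /f /g /=; congr (_ *: (F _ - _)).
  by congr pair => /=; rewrite scaler0 add0r.
by rewrite fg => df; split.
Qed.

Lemma isd_state_s (n s : R) : 0 <= n -> 0 < s ->
  is_derive s (1 : R) (fun r => F (n, r)) (d_s F (n, s)).
Proof.
move=> n0 s0.
have qE : quotient_filter states (0, 1) (n, s) = (0 : R)^'.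
  apply: quotient_filter_near.
  have : \forall h \near (0 : R), - s < h by apply: lt_nbhsr; rewrite oppr_lt0.
  apply: filterS => h hn; split => /=.
    by rewrite scaler0 add0r.
  by rewrite [h *: 1]mulr1; lra.
case: CF => _ /(_ (0, 1))[|dF _]; first by right.
have {dF} : derivable_in states (0, 1) F (n, s) by apply: dF; split => //=; exact: ltW.
rewrite /d_s /derivable_in /derive_in qE.
set f := (fun h => _); set g := (fun m => F (n, m)).
have fg : f = (fun h : R => h^-1 *: ((g \o shift s) (h *: (1 : R)) - g s)).
  apply/funext => h; rewrite /f /g /=; congr (_ *: (F _ - _)).
  by congr pair => /=; rewrite scaler0 add0r.
by rewrite fg => df; split.
Qed.

Lemma state_n_continuous (a b s : R) : 0 <= a -> 0 <= s ->
  {within `[a, b], continuous (fun m => F (m, s))}.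
Proof.
move=> a0 s0; apply/subspace_continuousP => m /=; rewrite in_itv /= => /andP[am mb].
have st : states (m, s) by split => //=; exact: le_trans am.
apply: (cvg_through (h := fun k : R => (k, s)) _ _ (state_continuous st)).
  by apply: cvg_within_filter; apply: cvg_to_pair; [exact: cvg_id|exact: cvg_cst].
apply: near_withinW => k /=; rewrite in_itv /= => /andP[ak _].
by split => //=; exact: le_trans ak.
Qed.

Lemma state_s_continuous (a b n : R) : 0 <= a -> 0 <= n ->
  {within `[a, b], continuous (fun r => F (n, r))}.
Proof.
move=> a0 n0; apply/subspace_continuousP => m /=; rewrite in_itv /= => /andP[am mb].
have st : states (n, m) by split => //=; exact: le_trans am.
apply: (cvg_through (h := fun k : R => (n, k)) _ _ (state_continuous st)).
  by apply: cvg_within_filter; apply: cvg_to_pair; [exact: cvg_cst|exact: cvg_id].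
apply: near_withinW => k /=; rewrite in_itv /= => /andP[ak _].
by split => //=; exact: le_trans ak.
Qed.

Lemma state_mvt_n (n m s : R) : 0 <= n -> 0 <= m -> 0 <= s ->
  exists xi, [/\ 0 <= xi, `|xi - n| <= `|m - n| &
    F (m, s) - F (n, s) = d_n F (xi, s) * (m - n)].
Proof.
move=> n0 m0 s0; have [nm|mn|<-] := ltgtP n m.
- have [x||xi] := @MVT R (fun k => F (k, s)) (fun k => d_n F (k, s)) n m nm.
  + rewrite in_itv /= => /andP[nx _]; apply: isd_state_n => //; exact: le_lt_trans nx.
  + exact: state_n_continuous.
  rewrite in_itv /= => /andP[nx xm] E; exists xi; split => //; first by lra.
  by rewrite !gtr0_norm ?subr_gt0 // lerD2r ltW.
- have [x||xi] := @MVT R (fun k => F (k, s)) (fun k => d_n F (k, s)) m n mn.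
  + rewrite in_itv /= => /andP[nx _]; apply: isd_state_n => //; exact: le_lt_trans nx.
  + exact: state_n_continuous.
  rewrite in_itv /= => /andP[nx xm] E; exists xi; split => //; first by lra.
    by rewrite !ltr0_norm ?subr_lt0 // lerN2 lerD2r ltW.
  by rewrite -opprB E; ring.
- by exists n; rewrite !subrr mulr0.
Qed.

Lemma state_mvt_s (n s r : R) : 0 <= n -> 0 <= s -> 0 <= r ->
  exists xi, [/\ 0 <= xi, `|xi - s| <= `|r - s| &
    F (n, r) - F (n, s) = d_s F (n, xi) * (r - s)].
Proof.
move=> n0 s0 r0; have [sr|rs|<-] := ltgtP s r.
- have [x||xi] := @MVT R (fun k => F (n, k)) (fun k => d_s F (n, k)) s r sr.
  + rewrite in_itv /= => /andP[nx _]; apply: isd_state_s => //; exact: le_lt_trans nx.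
  + exact: state_s_continuous.
  rewrite in_itv /= => /andP[nx xm] E; exists xi; split => //; first by lra.
  by rewrite !gtr0_norm ?subr_gt0 // lerD2r ltW.
- have [x||xi] := @MVT R (fun k => F (n, k)) (fun k => d_s F (n, k)) r s rs.
  + rewrite in_itv /= => /andP[nx _]; apply: isd_state_s => //; exact: le_lt_trans nx.
  + exact: state_s_continuous.
  rewrite in_itv /= => /andP[nx xm] E; exists xi; split => //; first by lra.
    by rewrite !ltr0_norm ?subr_lt0 // lerN2 lerD2r ltW.
  by rewrite -opprB E; ring.
- by exists s; rewrite !subrr mulr0.
Qed.

(** At boundary points of the quadrant F has no differential, only one-sided
    partial derivatives. The increment is therefore split along the broken line
    from (a 0, b 0) to (a 0, b h) to (a h, b h), which stays in the quadrant, and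
    the mean value theorem is applied to each segment. *)
Lemma state_chain_rule (a b : R -> R) (da db : R) :
  is_derive (0 : R) (1 : R) a da -> is_derive (0 : R) (1 : R) b db ->
  (\forall h \near (0 : R), states (a h, b h)) ->
  is_derive (0 : R) (1 : R) (fun h => F (a h, b h))
    (d_n F (a 0, b 0) * da + d_s F (a 0, b 0) * db).
Proof.
move=> dera derb st.
have st0 : states (a 0, b 0) by exact: nbhs_singleton st.
have ca := isd_continuous dera; have cb := isd_continuous derb.
have /choice[xi xiP] h : exists x, states (a h, b h) ->
    [/\ 0 <= x, `|x - a 0| <= `|a h - a 0| &
    F (a h, b h) - F (a 0, b h) = d_n F (x, b h) * (a h - a 0)].
  have [sth|sth] := pselect (states (a h, b h)); last by exists 0.
  have [x xP] := @state_mvt_n (a 0) (a h) (b h) st0.1 sth.1 sth.2.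
  by exists x.
have /choice[ze zeP] h : exists x, states (a h, b h) ->
    [/\ 0 <= x, `|x - b 0| <= `|b h - b 0| &
    F (a 0, b h) - F (a 0, b 0) = d_s F (a 0, x) * (b h - b 0)].
  have [sth|sth] := pselect (states (a h, b h)); last by exists 0.
  have [x xP] := @state_mvt_s (a 0) (b 0) (b h) st0.1 st0.2 sth.2.
  by exists x.
have squeeze (u w : R -> R) : {for 0, continuous w} ->
    (\forall h \near (0 : R), `|u h - w 0| <= `|w h - w 0|) -> u @ (0 : R) --> w 0.
  move=> cw uw; apply/cvgrPdist_le => e e0.
  have /cvgrPdist_le/(_ e e0) := cw; apply: filterS2 uw => h uh wh.
  by rewrite distrC (le_trans uh) // distrC.
have cxi : xi @ (0 : R) --> a 0.
  by apply: squeeze ca _; apply: filterS st => h /xiP[].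
have cze : ze @ (0 : R) --> b 0.
  by apply: squeeze cb _; apply: filterS st => h /zeP[].
have c1 : (fun h => d_n F (xi h, b h)) @ (0 : R) --> d_n F (a 0, b 0).
  apply: (cvg_through (h := fun h => (xi h, b h)) (cvg_to_pair cxi cb) _ (d_n_continuous st0)).
  by apply: filterS st => h sth; split => /=; [case: (xiP h sth)|exact: sth.2].
have c2 : (fun h => d_s F (a 0, ze h)) @ (0 : R) --> d_s F (a 0, b 0).
  apply: (cvg_through (h := fun h => (a 0, ze h)) (cvg_to_pair (cvg_cst _) cze) _ (d_s_continuous st0)).
  by apply: filterS st => h sth; split => /=; [exact: st0.1|case: (zeP h sth)].
have quo (f : R -> R) (df : R) : is_derive (0 : R) (1 : R) f df ->
    h^-1 *: (f h - f 0) @[h --> (0 : R)^'] --> df.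
  move=> [/cvg_ex[l fl] <-].
  have -> : 'D_1 f 0 = l by exact: cvg_lim fl.
  move: fl; apply: near_eq_cvg_to; apply: nearW => h /=.
  by rewrite [h *: (1 : R)]mulr1 addr0.
have wi (f : R -> R) (l : R) : f @ (0 : R) --> l -> f @ (0 : R)^' --> l.
  by move=> fl; exact: cvg_within_filter fl.
have lim : (fun h => d_n F (xi h, b h) * (h^-1 *: (a h - a 0)) +
      d_s F (a 0, ze h) * (h^-1 *: (b h - b 0))) @ (0 : R)^' -->
    d_n F (a 0, b 0) * da + d_s F (a 0, b 0) * db.
  exact: (cvgD (cvgM (wi _ _ c1) (quo _ _ dera)) (cvgM (wi _ _ c2) (quo _ _ derb))).
have H : h^-1 *: (((fun h => F (a h, b h)) \o shift (0 : R)) (h *: (1 : R)) - F (a 0, b 0)) @[h --> (0 : R)^']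
    --> d_n F (a 0, b 0) * da + d_s F (a 0, b 0) * db.
  apply: (near_eq_cvg_to _ lim).
  have : \forall h \near (0 : R)^', states (a h, b h).
    by rewrite /dnbhs /within /=; apply: filterS st => h sth _.
  apply: filterS => h sth; rewrite /= [h *: (1 : R)]mulr1 addr0.
  have [_ _ e1] := xiP h sth; have [_ _ e2] := zeP h sth.
  have -> : F (a h, b h) - F (a 0, b 0) =
    (F (a h, b h) - F (a 0, b h)) + (F (a 0, b h) - F (a 0, b 0)) by ring.
  rewrite e1 e2 /GRing.scale /=; ring.
by split; [apply/cvg_ex; eexists; exact: H|exact: cvg_lim H].
Qed.

Lemma C1_state (n s : X -> R) : C1 n -> C1 s ->
  (forall x, future x -> states (n x, s x)) ->
  C1 (fun x => F (n x, s x)) /\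
  forall mu (x : X), 0 < x 0 0 -> 'D_(axis mu) (fun x => F (n x, s x)) x =
    d_n F (n x, s x) * 'D_(axis mu) n x + d_s F (n x, s x) * 'D_(axis mu) s x.
Proof.
move=> cn cs st.
have D mu (x : X) : 0 < x 0 0 -> is_derive x (axis mu) (fun x => F (n x, s x))
    (d_n F (n x, s x) * 'D_(axis mu) n x + d_s F (n x, s x) * 'D_(axis mu) s x).
  move=> x0; apply: (is_derive_lineP _ x (axis mu) _).2.
  have := @state_chain_rule (fun h => n (h *: axis mu + x)) (fun h => s (h *: axis mu + x))
    ('D_(axis mu) n x) ('D_(axis mu) s x).
  rewrite scale0r add0r; apply.
  - exact: ((is_derive_lineP n x (axis mu) _).1 (C1_is_derive mu cn x0)).
  - exact: ((is_derive_lineP s x (axis mu) _).1 (C1_is_derive mu cs x0)).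
  - have cl : (fun h : R => h *: axis mu + x) @ (0 : R) --> (0 : R) *: axis mu + x.
      by apply: cvgD; [apply: cvgZr_tmp; exact: cvg_id | exact: cvg_cst].
    rewrite scale0r add0r in cl.
    have n1 : \forall h \near (0 : R), 0 < (h *: axis mu + x) 0 0 by exact: cl _ (near_time_pos x0).
    by apply: filterS n1 => h h0; apply: st; exact: ltW.
split; last by move=> mu x x0; case: (D mu x x0).
have cc (G : R * R -> R) (x : X) : future x -> G @ within states (nbhs (n x, s x)) --> G (n x, s x) ->
    (fun x => G (n x, s x)) @ within future (nbhs x) --> G (n x, s x).
  move=> x0 cG.
  apply: (cvg_through (h := fun x => (n x, s x)) _ _ cG).
    by apply: cvg_to_pair; exact: C1_continuous.
  by apply: near_withinW => y; exact: st.
apply: (C1_intro _ D) => [x x0|mu x x0].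
  by apply: cc => //; apply: state_continuous; exact: st.
have sx := st x (ltW x0).
have h1 := cc _ x (ltW x0) (d_n_continuous sx).
have h2 := cc _ x (ltW x0) (d_s_continuous sx).
rewrite within_future // in h1 h2.
exact: (cvgD (cvgM h1 (C1_dcontinuous cn x0)) (cvgM h2 (C1_dcontinuous cs x0))).
Qed.

End state_functions.

(** * Consequences of the equation of state *)

Section eos.
Context {R : realType}.
Variable rho : R * R -> R.
Hypothesis eos : equation_of_state rho.
Local Notation p := (pressure rho).
Local Notation eta := (sound_speed rho).

Let Crho := eos_C1_rho eos.
Let Cp := eos_C1_pressure eos.

(** At n = 0 the pressure is - rho, and both are nonnegative. *)
Lemma vacuum (s : R) : 0 <= s -> rho (0, s) = 0 /\ p (0, s) = 0.
Proof.
move=> s0; have st : states (0 : R, s) by split.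
have h1 := eos_rho_ge0 eos st; have h2 := eos_pressure_ge0 eos st.
by move: h2; rewrite /pressure /= mul0r sub0r => h2; split; lra.
Qed.

Lemma enthalpy (q : R * R) : rho q + p q = q.1 * d_n rho q.
Proof. by rewrite /pressure; ring. Qed.

(** The function rho is only of class C^1; that d_n rho is differentiable in n
    comes from d_n rho = (rho + p) / n, where p is of class C^1 too. *)
Lemma isd_enthalpy_n (n s : R) : 0 < n -> 0 <= s ->
  is_derive n (1 : R) (fun m => d_n rho (m, s)) (d_n p (n, s) / n).
Proof.
move=> n0 s0.
have nn : n != 0 by rewrite gt_eqF.
have d1 := isd_add (isd_state_n Crho n0 s0) (isd_state_n Cp n0 s0).
have d2 := isd_mul d1 (isd_inv (f := fun m : R => m) nn (isd_id n)).
have e : (rho (n, s) + p (n, s)) = n * d_n rho (n, s) by rewrite enthalpy.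
have E : d_n p (n, s) / n = (rho (n, s) + p (n, s)) * (- 1 / n ^+ 2) +
    n^-1 * (d_n rho (n, s) + d_n p (n, s)).
  by rewrite e; field.
rewrite E; apply: (isd_near _ d2).
apply: filterS (lt_nbhsr n0) => m m0; rewrite enthalpy /= mulrAC mulfV ?mul1r //.
by rewrite gt_eqF.
Qed.

Lemma sound_speed_sqr (q : R * R) : states q -> 0 < q.1 ->
  eta q ^+ 2 = d_n p q / d_n rho q.
Proof.
move=> st q0; rewrite /sound_speed sqr_sqrtr // divr_ge0 // ltW //.
  exact: eos_d_n_pressure_gt0.
exact: eos_d_n_rho_gt0.
Qed.

Lemma sound_speed_gt0 (q : R * R) : states q -> 0 < q.1 -> 0 < eta q.
Proof.
move=> st q0; rewrite sqrtr_gt0 divr_gt0 //.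
  exact: eos_d_n_pressure_gt0.
exact: eos_d_n_rho_gt0.
Qed.

Lemma d_n_pressureE (q : R * R) : states q -> 0 < q.1 ->
  d_n p q = eta q ^+ 2 * d_n rho q.
Proof.
move=> st q0; rewrite sound_speed_sqr // divfK // gt_eqF //.
exact: eos_d_n_rho_gt0.
Qed.

Lemma mvt_combination (a b c : R) (n m s : R) : 0 <= n -> n < m -> 0 <= s ->
  exists xi, [/\ n < xi, xi < m &
    (a * p (m, s) + b * rho (m, s) + c * m) - (a * p (n, s) + b * rho (n, s) + c * n) =
    (a * d_n p (xi, s) + b * d_n rho (xi, s) + c) * (m - n)].
Proof.
move=> n0 nm s0.
have [x||xi] := @MVT R (fun k => a * p (k, s) + b * rho (k, s) + c * k)
   (fun k => a * d_n p (k, s) + b * d_n rho (k, s) + c) n m nm.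
- rewrite in_itv /= => /andP[nx xm]; have x0 : 0 < x by exact: le_lt_trans nx.
  have d1 := isd_mul (isd_cst a x 1) (isd_state_n Cp x0 s0).
  have d2 := isd_mul (isd_cst b x 1) (isd_state_n Crho x0 s0).
  have d3 := isd_mul (isd_cst c x 1) (isd_id x).
  by apply: (isd_eq (isd_add (isd_add d1 d2) d3)); ring.
- have c1 := state_n_continuous Cp (b := m) n0 s0.
  have c2 := state_n_continuous Crho (b := m) n0 s0.
  move=> x; apply: cvgD.
    by apply: cvgD; apply: cvgM; [exact: cvg_cst|exact: c1|exact: cvg_cst|exact: c2].
  apply: cvgM; first exact: cvg_cst.
  exact: (continuous_subspaceT (fun y : R => @cvg_id _ (nbhs y))).
rewrite in_itv /= => /andP[nx xm] E; exists xi; split => //.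
Qed.

Lemma pressure_increasing (n m s : R) : 0 <= n -> n < m -> 0 <= s -> p (n, s) < p (m, s).
Proof.
move=> n0 nm s0; have [xi [nx xm]] := mvt_combination 1 0 0 n0 nm s0.
rewrite !mul1r !mul0r !addr0 => E; rewrite -subr_gt0 E mulr_gt0 ?subr_gt0 //.
by apply: eos_d_n_pressure_gt0 => //=; [split => //=; lra|lra].
Qed.

Lemma pressure_inj (n m s : R) : 0 <= n -> 0 <= m -> 0 <= s -> p (n, s) = p (m, s) -> n = m.
Proof.
move=> n0 m0 s0 E; have [nm|mn|//] := ltgtP n m.
  by have := pressure_increasing n0 nm s0; rewrite E ltxx.
by have := pressure_increasing m0 mn s0; rewrite E ltxx.
Qed.

Lemma density_of_pressure (n s : R) : 0 < n -> 0 <= s -> density_of rho (p (n, s)) s = n.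
Proof.
move=> n0 s0; rewrite /density_of.
have ex : exists m, [set m : R | 0 < m /\ p (m, s) = p (n, s)] m by exists n.
have [m0 pm] := getPex ex.
by apply: pressure_inj pm => //; exact: ltW.
Qed.

Section convexity.
Hypothesis A2 : sound_speed_nondecreasing_in_pressure rho.

Lemma sound_speed_monotone (n m s : R) : 0 < n -> n <= m -> 0 <= s -> eta (n, s) <= eta (m, s).
Proof.
move=> n0 nm s0; have m0 := lt_le_trans n0 nm.
have := A2 (s := s) (p1 := p (n, s)) (p2 := p (m, s)) s0.
rewrite /sound_speed_ps !density_of_pressure //; apply.
- move: nm; rewrite le_eqVlt => /predU1P[->//|nm]; apply/ltW/pressure_increasing => //; exact: ltW.
- by exists n.
- by exists m.
Qed.

(** At fixed entropy dp / drho = eta^2 is nondecreasing, so p is a convex function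
    of rho and lies above its tangent. The mean value theorem applied to
    p - eta^2 rho avoids the change of variables. *)
Lemma pressure_tangent (nb n s : R) : 0 < nb -> 0 <= n -> 0 <= s ->
  eta (nb, s) ^+ 2 * (rho (n, s) - rho (nb, s)) <= p (n, s) - p (nb, s).
Proof.
move=> nb0 n0 s0; set e2 := eta _ ^+ 2.
have mono xi : 0 < xi -> 0 < d_n rho (xi, s).
  by move=> x0; apply: eos_d_n_rho_gt0 => //; split => //=; exact: ltW.
have eP xi : 0 < xi -> d_n p (xi, s) = eta (xi, s) ^+ 2 * d_n rho (xi, s).
  by move=> x0; apply: d_n_pressureE => //; split => //=; exact: ltW.
have e_ge0 xi : 0 < xi -> 0 <= eta (xi, s).
  by move=> x0; rewrite /sound_speed sqrtr_ge0.
have [nn|nn|<-] := ltgtP n nb; last by rewrite !subrr mulr0.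
- have [xi [nx xm E]] := mvt_combination 1 (- e2) 0 n0 nn s0.
  have x0 : 0 < xi by exact: le_lt_trans nx.
  have h : eta (xi, s) ^+ 2 <= e2.
    by rewrite ler_pXn2r ?nnegrE ?e_ge0 //; apply: sound_speed_monotone => //; exact: ltW.
  have : (1 * d_n p (xi, s) + - e2 * d_n rho (xi, s) + 0) * (nb - n) <= 0.
    apply: mulr_le0_ge0; last by rewrite subr_ge0 ltW.
    rewrite eP // mul1r addr0 -mulrDl.
    by apply: mulr_le0_ge0; [rewrite subr_le0|apply/ltW/mono].
  by rewrite -E; lra.
- have [xi [nx xm E]] := mvt_combination 1 (- e2) 0 (ltW nb0) nn s0.
  have x0 : 0 < xi by exact: lt_trans nx.
  have h : e2 <= eta (xi, s) ^+ 2.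
    by rewrite ler_pXn2r ?nnegrE ?e_ge0 //; apply: sound_speed_monotone => //; exact: ltW.
  have : 0 <= (1 * d_n p (xi, s) + - e2 * d_n rho (xi, s) + 0) * (n - nb).
    apply: mulr_ge0; last by rewrite subr_ge0 ltW.
    rewrite eP // mul1r addr0 -mulrDl.
    by apply: mulr_ge0; [rewrite subr_ge0|apply/ltW/mono].
  by rewrite -E; lra.
Qed.

Lemma d_n_rho_increasing (n m s : R) : 0 < n -> n <= m -> 0 <= s ->
  d_n rho (n, s) <= d_n rho (m, s).
Proof.
move=> n0; rewrite le_eqVlt => /predU1P[->//|nm] s0.
have [x||xi] := @MVT R (fun k => d_n rho (k, s)) (fun k => d_n p (k, s) / k) n m nm.
- rewrite in_itv /= => /andP[nx xm]; apply: isd_enthalpy_n => //; exact: lt_trans nx.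
- apply: continuous_in_subspaceT => x; rewrite inE /= in_itv /= => /andP[nx xm].
  exact: isd_continuous (isd_enthalpy_n (lt_le_trans n0 nx) s0).
rewrite in_itv /= => /andP[nx xm] E; rewrite -subr_ge0 E.
have x0 : 0 < xi by exact: lt_trans nx.
rewrite mulr_ge0 ?divr_ge0 ?subr_ge0 ?ltW //.
by apply: eos_d_n_pressure_gt0 => //; split => //=; exact: ltW.
Qed.

(** The monotonicity of rho in the entropy is about states of equal pressure, so
    it can be used only if every positive pressure is attained at every entropy.
    By convexity p grows at least as fast as a multiple of rho, and rho, being
    convex in n, at least linearly. *)
Lemma pressure_surj (P s : R) : 0 < P -> 0 <= s -> exists2 n, 0 < n & p (n, s) = P.
Proof.
move=> P0 s0.
pose k := eta (1, s) ^+ 2 * d_n rho (1, s).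
have k0 : 0 < k.
  rewrite mulr_gt0 ?exprn_gt0 //; first by apply: sound_speed_gt0 => //; split => //=.
  by apply: eos_d_n_rho_gt0 => //; split.
have big n : 1 < n -> k * (n - 1) <= p (n, s).
  move=> n1; have n0 : 0 <= n by lra.
  have h1 := pressure_tangent ltr01 n0 s0.
  have [xi [nx xm]] := mvt_combination 0 1 0 ler01 n1 s0.
  rewrite !mul0r !mul1r !add0r !addr0 => E.
  have h2 := d_n_rho_increasing ltr01 (ltW nx) s0.
  have p1 : 0 <= p (1, s) by apply: (eos_pressure_ge0 eos); split.
  have h3 : d_n rho (1, s) * (n - 1) <= rho (n, s) - rho (1, s).
    by rewrite E ler_wpM2r // subr_ge0 ltW.
  have h4 := sqr_ge0 (eta (1, s)); rewrite /k; nra.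
pose N := 1 + P / k + 1.
have N1 : 1 < N by rewrite /N; have := divr_ge0 (ltW P0) (ltW k0); lra.
have pN : P <= p (N, s).
  apply: le_trans (big N N1); rewrite /N (_ : _ * _ = P + k); last by field; rewrite gt_eqF.
  by rewrite lerDl ltW.
have N0 : 0 <= N by lra.
have [_ pz] := vacuum s0.
have hP : Num.min (p (0, s)) (p (N, s)) <= P <= Num.max (p (0, s)) (p (N, s)).
  by rewrite pz ge_min le_max pN orbT (ltW P0).
have [n] := @IVT R (fun m => p (m, s)) 0 N P N0 (state_n_continuous Cp (lexx 0) s0) hP.
rewrite in_itv /= => /andP[n0 nN] pn; exists n => //.
rewrite lt_neqAle n0 andbT; apply/eqP => n00.
by move: pn; rewrite -n00 pz => PE; move: P0; rewrite -PE ltxx.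
Qed.

Hypothesis A1 : rho_nonincreasing_in_entropy rho.

(** Let m be the density at which the entropy sb gives the pressure p (n, s).
    Then rho (n, s) <= rho (m, sb), as rho decreases with the entropy at fixed
    pressure, and pressure_tangent applies to m.
    In vacuum the entropy is unconstrained, but there rho = p = 0. *)
Lemma pressure_tangent_entropy (nb sb n s : R) : 0 < nb -> 0 <= sb -> 0 <= n ->
  (0 < n -> sb <= s) -> 0 <= s ->
  eta (nb, sb) ^+ 2 * (rho (n, s) - rho (nb, sb)) <= p (n, s) - p (nb, sb).
Proof.
move=> nb0 sb0; rewrite le_eqVlt => /predU1P[<- _|n0 /(_ n0) ss] s0.
  have [-> ->] := vacuum s0; have [r0 p0] := vacuum sb0.
  by have := pressure_tangent nb0 (lexx 0) sb0; rewrite r0 p0.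
have [_ pz] := vacuum s0.
have P0 : 0 < p (n, s) by rewrite -pz; apply: pressure_increasing.
have [m m0 pm] := pressure_surj P0 sb0.
have h : rho (n, s) <= rho (m, sb).
  have := A1 (p := p (n, s)) sb0 ss.
  have dm : density_of rho (p (n, s)) sb = m by rewrite -pm density_of_pressure.
  rewrite /rho_ps density_of_pressure // dm; apply.
  - by exists m.
  - by exists n.
have := pressure_tangent nb0 (ltW m0) sb0; rewrite pm.
have := sqr_ge0 (eta (nb, sb)); nra.
Qed.

End convexity.

End eos.

(** * Relative energy near a constant state *)

Section near_background.
Context {R : realType}.
Variable rho : R * R -> R.
Hypothesis eos : equation_of_state rho.
Local Notation p := (pressure rho).
Local Notation eta := (sound_speed rho).
Variables (nb s : R).
Hypotheses (nb0 : 0 < nb) (s0 : 0 <= s).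

Local Notation hb := (d_n rho (nb, s)).

Lemma quadratic_domination (al be N x y : R) : 0 < al -> 0 <= N -> N ^+ 2 <= 4 * al * be ->
  N * (x * y) <= al * x ^+ 2 + be * y ^+ 2.
Proof.
move=> al0 N0 h; have h2 : 0 <= (al * x - N * y / 2) ^+ 2 + (al * be - N ^+ 2 / 4) * y ^+ 2.
  by rewrite addr_ge0 ?sqr_ge0 // mulr_ge0 ?sqr_ge0 //; lra.
have E : (al * x - N * y / 2) ^+ 2 + (al * be - N ^+ 2 / 4) * y ^+ 2 =
   al * (al * x ^+ 2 + be * y ^+ 2 - N * (x * y)) by field.
by move: h2; rewrite E pmulr_rge0 // subr_ge0.
Qed.

Lemma sqrt1D_bounds (w : R) : 0 <= w ->
  let U := Num.sqrt (1 + w) in [/\ 1 <= U, U - 1 <= w / 2 & U ^+ 2 = 1 + w].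
Proof.
move=> w0 U; have U2 : U ^+ 2 = 1 + w by rewrite sqr_sqrtr // addr_ge0.
have U0 : 0 <= U by exact: sqrtr_ge0.
have U1 : 1 <= U by rewrite -(ler_pXn2r (_ : 0 < 2)%N) ?nnegrE // U2 expr1n lerDl.
split => //; nra.
Qed.

(** Each condition holds strictly at m = nb and involves continuous functions. *)
Lemma near_background_rates (tau : R) : 0 < tau -> exists2 delta, 0 < delta & forall m,
  `|m - nb| < delta ->
  [/\ 0 < m, m <= nb * (1 + tau),
      nb * hb * (1 - tau) / 2 <= m * (d_n rho (m, s) - hb / 2),
      m * d_n rho (m, s) <= 2 * (nb * hb) &
      d_n p (nb, s) / nb * (1 - tau) <= d_n p (m, s) / m <= d_n p (nb, s) / nb * (1 + tau)].
Proof.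
move=> tau0.
have st : states (nb, s) by split => //=; exact: ltW.
have hb0 : 0 < hb by exact: eos_d_n_rho_gt0.
have pb0 : 0 < d_n p (nb, s) by exact: eos_d_n_pressure_gt0.
have pos : \forall m \near nb, 0 < m by exact: lt_nbhsr.
have cs (G : R * R -> R) : G @ within states (nbhs (nb, s)) --> G (nb, s) ->
    (fun m => G (m, s)) @ nb --> G (nb, s).
  move=> cG; apply: (cvg_through (h := fun m : R => (m, s)) _ _ cG).
    by apply: cvg_to_pair; [exact: cvg_id|exact: cvg_cst].
  by apply: filterS pos => m m0; split => //=; exact: ltW.
have ch := cs _ (d_n_continuous (eos_C1_rho eos) st).
have cp := cs _ (d_n_continuous (eos_C1_pressure eos) st).
have c1 : (fun m => m * (d_n rho (m, s) - hb / 2)) @ nb --> nb * (hb - hb / 2).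
  exact: (cvgM cvg_id (cvgB ch (cvg_cst _))).
have c2 : (fun m => m * d_n rho (m, s)) @ nb --> nb * hb by exact: (cvgM cvg_id ch).
have c3 : (fun m => d_n p (m, s) / m) @ nb --> d_n p (nb, s) / nb.
  by apply: cvgM => //; apply: cvgV; [rewrite gt_eqF|exact: cvg_id].
have A0 : 0 < nb * hb by exact: mulr_gt0.
have B0 : 0 < d_n p (nb, s) / nb by exact: divr_gt0.
have n1 : \forall m \near nb, m < nb * (1 + tau) by apply: lt_nbhsl; nra.
have n2 : \forall m \near nb, nb * hb * (1 - tau) / 2 < m * (d_n rho (m, s) - hb / 2).
  by apply: (cvgr_gt _ c1); nra.
have n3 : \forall m \near nb, m * d_n rho (m, s) < 2 * (nb * hb).
  by apply: (cvgr_lt _ c2); nra.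
have n4 : \forall m \near nb, d_n p (nb, s) / nb * (1 - tau) < d_n p (m, s) / m.
  by apply: (cvgr_gt _ c3); nra.
have n5 : \forall m \near nb, d_n p (m, s) / m < d_n p (nb, s) / nb * (1 + tau).
  by apply: (cvgr_lt _ c3); nra.
have /nbhs_ballP[delta /= d0 dP] : \forall m \near nb,
  [/\ 0 < m, m <= nb * (1 + tau),
      nb * hb * (1 - tau) / 2 <= m * (d_n rho (m, s) - hb / 2),
      m * d_n rho (m, s) <= 2 * (nb * hb) &
      d_n p (nb, s) / nb * (1 - tau) <= d_n p (m, s) / m <= d_n p (nb, s) / nb * (1 + tau)].
  near=> m; split; last (apply/andP; split).
  - by near: m.
  - by apply: ltW; near: m.
  - by apply: ltW; near: m.
  - by apply: ltW; near: m.
  - by apply: ltW; near: m.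
  - by apply: ltW; near: m.
exists delta => // m mn; apply: dP; rewrite /ball /= distrC; exact: mn.
Unshelve. all: by end_near. Qed.

Section taylor.
Variables (delta B1 B2 : R).
Hypothesis rate : forall m, `|m - nb| < delta -> 0 < m /\ B1 <= d_n p (m, s) / m <= B2.

Lemma enthalpy_taylor (m : R) : `|m - nb| < delta ->
  exists xi, [/\ `|xi - nb| < delta & d_n rho (m, s) - hb = d_n p (xi, s) / xi * (m - nb)].
Proof.
move=> md; have [m0 _] := rate md.
have [nm|mn|E] := ltgtP nb m.
- have [x||xi] := @MVT R (fun k => d_n rho (k, s)) (fun k => d_n p (k, s) / k) nb m nm.
  + rewrite in_itv /= => /andP[nx xm]; apply: isd_enthalpy_n => //; exact: lt_trans nx.
  + apply: continuous_in_subspaceT => x; rewrite inE /= in_itv /= => /andP[nx xm].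
    exact: isd_continuous (isd_enthalpy_n eos (lt_le_trans nb0 nx) s0).
  rewrite in_itv /= => /andP[nx xm] E; exists xi; split => //.
  by move: md; rewrite !gtr0_norm ?subr_gt0 //; lra.
- have [x||xi] := @MVT R (fun k => d_n rho (k, s)) (fun k => d_n p (k, s) / k) m nb mn.
  + rewrite in_itv /= => /andP[nx xm]; apply: isd_enthalpy_n => //; exact: lt_trans nx.
  + apply: continuous_in_subspaceT => x; rewrite inE /= in_itv /= => /andP[nx xm].
    exact: isd_continuous (isd_enthalpy_n eos (lt_le_trans m0 nx) s0).
  rewrite in_itv /= => /andP[nx xm] E; exists xi; split => //.
    by move: md; rewrite !ltr0_norm ?subr_lt0 //; lra.
  by rewrite -opprB E; ring.
- by exists nb; split; rewrite ?E ?subrr ?mulr0 // normr0; apply: le_lt_trans md.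
Qed.

Lemma enthalpy_bound (m : R) : 0 <= B1 -> `|m - nb| < delta ->
  `|d_n rho (m, s) - hb| <= B2 * `|m - nb|.
Proof.
move=> B10 md; have [xi [xd ->]] := enthalpy_taylor md.
have [x0 /andP[h1 h2]] := rate xd.
by rewrite normrM ler_wpM2r // ger0_norm // (le_trans B10).
Qed.

Lemma rho_taylor (m : R) : `|m - nb| < delta ->
  B1 / 2 * (m - nb) ^+ 2 <= rho (m, s) - rho (nb, s) - hb * (m - nb).
Proof.
move=> md; have [m0 _] := rate md.
pose psi k := rho (k, s) - hb * (k - nb) - B1 / 2 * (k - nb) ^+ 2.
have dpsi (k : R) : 0 < k -> is_derive k (1 : R) psi (d_n rho (k, s) - hb - B1 * (k - nb)).
  move=> k0; have d0 := isd_sub (isd_id k) (isd_cst nb k 1).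
  have d1 := isd_mul (isd_cst hb k 1) d0.
  have d2 := isd_mul (isd_cst (B1 / 2) k 1) (isd_comp (g := fun y : R => y - nb) (isd_sqr _) d0).
  apply: (isd_eq (isd_sub (isd_sub (isd_state_n (eos_C1_rho eos) k0 s0) d1) d2)); by field.
have sgn k : `|k - nb| < delta -> 0 <= (d_n rho (k, s) - hb - B1 * (k - nb)) * (k - nb).
  move=> kd; have [xi [xd ->]] := enthalpy_taylor kd.
  have [x0 /andP[h1 h2]] := rate xd.
  by rewrite -mulrBl -mulrA mulr_ge0 ?subr_ge0 // -expr2 sqr_ge0.
suff : psi nb <= psi m by rewrite /psi subrr expr0n !mulr0 !subr0; lra.
have [nm|mn|->//] := ltgtP nb m.
- have [x||xi] := @MVT R psi (fun k => d_n rho (k, s) - hb - B1 * (k - nb)) nb m nm.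
  + rewrite in_itv /= => /andP[nx xm]; apply: dpsi => //; exact: lt_trans nx.
  + apply: continuous_in_subspaceT => x; rewrite inE /= in_itv /= => /andP[nx xm].
    exact: isd_continuous (dpsi _ (lt_le_trans nb0 nx)).
  rewrite in_itv /= => /andP[nx xm] E; rewrite -subr_ge0 E.
  have xd : `|xi - nb| < delta by move: md; rewrite !gtr0_norm ?subr_gt0 //; lra.
  have := sgn _ xd; rewrite pmulr_lge0 ?subr_gt0 // => h.
  by rewrite mulr_ge0 // subr_ge0 ltW.
- have [x||xi] := @MVT R psi (fun k => d_n rho (k, s) - hb - B1 * (k - nb)) m nb mn.
  + rewrite in_itv /= => /andP[nx xm]; apply: dpsi => //; exact: lt_trans nx.
  + apply: continuous_in_subspaceT => x; rewrite inE /= in_itv /= => /andP[nx xm].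
    exact: isd_continuous (dpsi _ (lt_le_trans m0 nx)).
  rewrite in_itv /= => /andP[nx xm] E; rewrite -subr_le0 E.
  have xd : `|xi - nb| < delta by move: md; rewrite !ltr0_norm ?subr_lt0 //; lra.
  have := sgn _ xd; rewrite nmulr_lge0 ?subr_lt0 // => h.
  by rewrite mulr_le0_ge0 // subr_ge0 ltW.
Qed.

End taylor.

(** The energy density T^00 less its first-order Taylor expansion at the constant
    state in terms of the particle density n sqrt(1 + w), where w = |u|^2 and hb
    is the enthalpy per particle: a quantity quadratic in the perturbation. *)
Definition rel_energy (n w : R) : R :=
  (rho (n, s) + p (n, s)) * (1 + w) - p (n, s) - rho (nb, s) - hb * (n * Num.sqrt (1 + w) - nb).

(** The factor of u^i in the i-th component of the current whose time component is
    rel_energy. *)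
Definition rel_flux (n w : R) : R :=
  (rho (n, s) + p (n, s)) * Num.sqrt (1 + w) - hb * n.

(** To second order, with d = n - nb and v = |u|, the relative energy is
    B d^2 / 2 + A v^2 / 2 and its flux is nb B d v, where A is the enthalpy
    density of the constant state and nb^2 B = A eta^2. Hence the flux is at
    most eta times the energy to leading order, and at most sigma times it in
    a neighbourhood of the constant state. *)
Lemma near_background (sigma : R) : eta (nb, s) < sigma ->
  exists2 delta, 0 < delta & forall n w, `|n - nb| < delta -> 0 <= w -> w < delta ^+ 2 ->
  [/\ 0 < n, 0 <= rel_energy n w, w * rel_flux n w ^+ 2 <= sigma ^+ 2 * rel_energy n w ^+ 2 &
    (rel_energy n w = 0 -> n = nb /\ w = 0)].
Proof.
move=> es; have st : states (nb, s) by split => //=; exact: ltW.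
set e := eta (nb, s) in es.
have e0 : 0 < e by exact: sound_speed_gt0.
have hb0 : 0 < hb by exact: eos_d_n_rho_gt0.
have pb0 : 0 < d_n p (nb, s) by exact: eos_d_n_pressure_gt0.
have pE : d_n p (nb, s) = e ^+ 2 * hb by exact: d_n_pressureE.
have sg0 : 0 < sigma by exact: lt_trans es.
(* With relative errors tau in the second-order coefficients the flux bound
   amounts to eta^2 (1 + tau)^4 <= sigma^2 (1 - tau) (1 - 2 tau). This tau solves
   eta^2 (1 + 15 tau) = sigma^2 (1 - 3 tau), which is stronger if tau <= 1. *)
pose tau := (sigma ^+ 2 - e ^+ 2) / (15 * e ^+ 2 + 3 * sigma ^+ 2).
have den0 : 0 < 15 * e ^+ 2 + 3 * sigma ^+ 2 by nra.
have tau0 : 0 < tau by rewrite divr_gt0 // subr_gt0; nra.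
have tau3 : tau <= 3^-1 by rewrite /tau ler_pdivrMr //; nra.
have tauE : tau * (15 * e ^+ 2 + 3 * sigma ^+ 2) = sigma ^+ 2 - e ^+ 2.
  by rewrite /tau divfK // gt_eqF.
have [d1 d10 dP] := near_background_rates tau0.
set A := nb * hb in dP; set B := d_n p (nb, s) / nb in dP.
have A0 : 0 < A by exact: mulr_gt0.
have B0 : 0 < B by exact: divr_gt0.
have AB : nb ^+ 2 * B = A * e ^+ 2 by rewrite /B /A pE; field; rewrite gt_eqF.
pose delta := Num.min d1 (tau * sigma / 2).
exists delta; first by rewrite lt_min d10 divr_gt0 // mulr_gt0.
move=> n w nd w0 wd.
have nd1 : `|n - nb| < d1 by apply: lt_le_trans nd _; rewrite /delta ge_min lexx.
have rate m : `|m - nb| < d1 -> 0 < m /\ B * (1 - tau) <= d_n p (m, s) / m <= B * (1 + tau).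
  by move=> /dP[].
have [n0 nle nD nD2 _] := dP n nd1.
have [U1 Uw U2] := sqrt1D_bounds w0; set U := Num.sqrt _ in U1 Uw U2.
set v := Num.sqrt w; have v0 : 0 <= v by exact: sqrtr_ge0.
have v2 : v ^+ 2 = w by rewrite sqr_sqrtr.
have vs : v <= tau * sigma / 2.
  have dl0 : 0 <= delta by rewrite le_min ltW // divr_ge0 // ltW // mulr_gt0.
  have : v <= delta by rewrite -(ler_pXn2r (_ : 0 < 2)%N) ?nnegrE // v2 ltW.
  by move=> h; apply: le_trans h _; rewrite /delta ge_min lexx orbT.
have B10 : 0 <= B * (1 - tau) by rewrite mulr_ge0 ?ltW // subr_gt0; lra.
have t1 := rho_taylor rate nd1.
have t2 := enthalpy_bound rate B10 nd1.
set D := d_n rho (n, s) in t2 nD nD2.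
have enth : rho (n, s) + p (n, s) = n * D by rewrite enthalpy.
have D0 : 0 < D by apply: eos_d_n_rho_gt0 => //; split => //=; exact: ltW.
have Ee : rel_energy n w = (rho (n, s) - rho (nb, s) - hb * (n - nb)) + n * D * w - hb * n * (U - 1).
  by rewrite /rel_energy -/U enth (_ : p (n, s) = n * D - rho (n, s)) -?enth; ring.
have Ef : rel_flux n w = n * ((D - hb) + D * (U - 1)).
  by rewrite /rel_flux -/U enth; ring.
set d := `|n - nb| in t2.
have dd : (n - nb) ^+ 2 = d ^+ 2 by rewrite /d real_normK ?num_real.
rewrite dd in t1.
have elow : B * (1 - tau) / 2 * d ^+ 2 + A * (1 - tau) / 2 * v ^+ 2 <= rel_energy n w.
  rewrite Ee v2.
  have h1 : hb * n * (U - 1) <= hb * n * (w / 2) by rewrite ler_wpM2l // mulr_ge0 // ltW.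
  have h2 : A * (1 - tau) / 2 * w <= n * (D - hb / 2) * w by rewrite ler_wpM2r.
  by lra.
have e_ge0 : 0 <= rel_energy n w.
  apply: le_trans elow; apply: addr_ge0; rewrite mulr_ge0 ?sqr_ge0 // divr_ge0 //.
  by rewrite mulr_ge0 ?ltW // subr_gt0; lra.
have d0 : 0 <= d by exact: normr_ge0.
have fup : v * `|rel_flux n w| <= sigma * rel_energy n w.
  have f1 : `|rel_flux n w| <= n * (B * (1 + tau) * d + D * (w / 2)).
    rewrite Ef normrM gtr0_norm //; apply: ler_wpM2l; first exact: ltW.
    apply: le_trans (ler_normD _ _) _; apply: lerD => //.
    rewrite normrM gtr0_norm //; apply: ler_wpM2l; first exact: ltW.
    by rewrite ger0_norm // subr_ge0.
  have f2 : n * (B * (1 + tau)) <= nb * (1 + tau) * (B * (1 + tau)).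
    by rewrite ler_wpM2r // mulr_ge0 ?ltW //; lra.
  have f3 : n * D * v / 2 <= A * (tau * sigma / 2).
    have : n * D * v <= 2 * A * (tau * sigma / 2) by apply: ler_pM => //; rewrite mulr_ge0 // ltW.
    by lra.
  have f4 : v * `|rel_flux n w| <= nb * (1 + tau) * (B * (1 + tau)) * (d * v) + A * (tau * sigma / 2) * v ^+ 2.
    apply: le_trans (ler_wpM2l v0 f1) _.
    have -> : v * (n * (B * (1 + tau) * d + D * (w / 2))) =
      n * (B * (1 + tau)) * (d * v) + n * D * v / 2 * v ^+ 2 by rewrite v2; field.
    by apply: lerD; apply: ler_wpM2r => //; rewrite ?sqr_ge0 // mulr_ge0.
  (* The quadratic part absorbs the mixed term d v; what the cubic error uses up
     has been taken off the coefficient of v^2. *)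
  have q : nb * (1 + tau) * (B * (1 + tau)) * (d * v) <=
     sigma * (B * (1 - tau) / 2) * d ^+ 2 + (sigma * (A * (1 - tau) / 2) - A * (tau * sigma / 2)) * v ^+ 2.
    apply: quadratic_domination.
    - by rewrite mulr_gt0 // divr_gt0 // mulr_gt0 // subr_gt0; lra.
    - have tt : 0 <= 1 + tau by lra.
      by apply: mulr_ge0; apply: mulr_ge0 => //; exact: ltW.
    have -> : (nb * (1 + tau) * (B * (1 + tau))) ^+ 2 = A * B * (e ^+ 2 * (1 + tau) ^+ 4).
      rewrite (_ : _ ^+ 2 = nb ^+ 2 * B * B * (1 + tau) ^+ 4); last by ring.
      by rewrite AB; ring.
    have -> : 4 * (sigma * (B * (1 - tau) / 2)) * (sigma * (A * (1 - tau) / 2) - A * (tau * sigma / 2)) =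
      A * B * (sigma ^+ 2 * ((1 - tau) * (1 - 2 * tau))) by field.
    apply: ler_wpM2l; first by rewrite mulr_ge0 // ltW.
    have g1 : (1 + tau) ^+ 4 <= 1 + 15 * tau.
      have -> : (1 + tau) ^+ 4 = 1 + tau * (4 + tau * (6 + tau * (4 + tau))) by ring.
      have : tau * (4 + tau) <= 5 by nra.
      have : tau * (6 + tau * (4 + tau)) <= 11 by nra.
      nra.
    have g2 : 1 - 3 * tau <= (1 - tau) * (1 - 2 * tau) by nra.
    apply: (@le_trans _ _ (e ^+ 2 * (1 + 15 * tau))); first by rewrite ler_wpM2l // sqr_ge0.
    apply: (@le_trans _ _ (sigma ^+ 2 * (1 - 3 * tau))); last by rewrite ler_wpM2l // sqr_ge0.
    by lra.
  have s1 : sigma * (B * (1 - tau) / 2 * d ^+ 2 + A * (1 - tau) / 2 * v ^+ 2) <= sigma * rel_energy n w.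
    by rewrite ler_wpM2l // ltW.
  by lra.
split => //.
- have h : (v * `|rel_flux n w|) ^+ 2 <= (sigma * rel_energy n w) ^+ 2.
    by rewrite ler_pXn2r // nnegrE mulr_ge0 // ltW.
  by move: h; rewrite !exprMn v2 real_normK ?num_real.
- move=> ez; rewrite ez in elow.
  have c1 : 0 < B * (1 - tau) / 2 by rewrite divr_gt0 // mulr_gt0 // subr_gt0; lra.
  have c2 : 0 < A * (1 - tau) / 2 by rewrite divr_gt0 // mulr_gt0 // subr_gt0; lra.
  have k1 : 0 <= B * (1 - tau) / 2 * d ^+ 2 by rewrite mulr_ge0 ?sqr_ge0 // ltW.
  have k2 : 0 <= A * (1 - tau) / 2 * v ^+ 2 by rewrite mulr_ge0 ?sqr_ge0 // ltW.
  have z1 : B * (1 - tau) / 2 * d ^+ 2 = 0 by lra.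
  have z2 : A * (1 - tau) / 2 * v ^+ 2 = 0 by lra.
  move/eqP: z1; rewrite mulf_eq0 gt_eqF //= sqrf_eq0 normr_eq0 subr_eq0 => /eqP nE.
  by move/eqP: z2; rewrite mulf_eq0 gt_eqF //= v2 => /eqP.
Qed.

End near_background.

(** * Conserved currents of the fluid *)

Section conserved_algebra.
Context {R : realType}.
Local Notation X := 'rV[R]_4.
Implicit Types J K : 'I_4 -> X -> R.

Lemma conserved_cst (c : 'I_4 -> R) : conserved (fun mu (_ : X) => c mu).
Proof.
split => [mu|x _]; first exact: C1_cst.
by apply: big1 => mu _; have [_] := isd_cst (c mu) x (axis mu).
Qed.

Lemma conserved_add J K : conserved J -> conserved K -> conserved (fun mu x => J mu x + K mu x).
Proof.
move=> [cJ dJ] [cK dK]; split => [mu|x x0]; first exact: C1_add.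
transitivity (\sum_mu 'D_(axis mu) (J mu) x + \sum_mu 'D_(axis mu) (K mu) x); last by rewrite dJ // dK // addr0.
rewrite -big_split /=; apply: eq_bigr => mu _.
by have [_] := isd_add (C1_is_derive mu (cJ mu) x0) (C1_is_derive mu (cK mu) x0).
Qed.

Lemma conserved_scale (c : R) J : conserved J -> conserved (fun mu x => c * J mu x).
Proof.
move=> [cJ dJ]; split => [mu|x x0]; first by apply: C1_mul => //; exact: C1_cst.
transitivity (c * \sum_mu 'D_(axis mu) (J mu) x); last by rewrite dJ // mulr0.
rewrite mulr_sumr; apply: eq_bigr => mu _.
have [_ ->] := isd_mul (isd_cst c x (axis mu)) (C1_is_derive mu (cJ mu) x0).
by rewrite mulr0 addr0.
Qed.

End conserved_algebra.

Section fluid_currents.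
Context {R : realType}.
Local Notation X := 'rV[R]_4.
Variables (rho : R * R -> R) (n0 s0 : 'rV[R]_3 -> R) (u0 : 'rV[R]_3 -> 'rV[R]_3).
Variables (n s : X -> R) (u : X -> 'rV[R]_3).
Hypotheses (eos : equation_of_state rho) (sol : fluid_solution rho n0 s0 u0 n s u).

Definition vel (mu : 'I_4) (x : X) : R := four_velocity (u x) 0 mu.
Definition energy_density (x : X) : R := rho (n x, s x).
Definition pressure_at (x : X) : R := pressure rho (n x, s x).
Definition enthalpy_at (x : X) : R := energy_density x + pressure_at x.

Lemma four_velocity_time (v : 'rV[R]_3) : four_velocity v 0 0 = Num.sqrt (1 + dot v v).
Proof.
transitivity (row_mx ((Num.sqrt (1 + dot v v))%:M : 'M[R]_1) v 0 (lshift 3 (0 : 'I_1))); last by rewrite row_mxEl mxE.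
by rewrite /four_velocity /vec4; congr (row_mx _ _ _ _); exact: val_inj.
Qed.

Lemma four_velocity_space (v : 'rV[R]_3) i : four_velocity v 0 (space_index i) = v 0 i.
Proof. exact: (row_mxEr ((Num.sqrt (1 + dot v v))%:M : 'M[R]_1) v 0 i). Qed.

Lemma dot_ge0 (v : 'rV[R]_3) : 0 <= dot v v.
Proof. by apply: sumr_ge0 => i _; rewrite -expr2 sqr_ge0. Qed.

Lemma C1_n : C1 n. Proof. exact: Ck_C1 (sol_C1_n sol). Qed.
Lemma C1_s : C1 s. Proof. exact: Ck_C1 (sol_C1_s sol). Qed.
Lemma C1_u i : C1 (fun x => u x 0 i). Proof. exact: Ck_C1 (sol_C1_u sol i). Qed.

Lemma C1_vel mu : C1 (vel mu).
Proof.
rewrite /vel; have [->|[i ->]] := I4_split mu; last first.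
  rewrite (_ : (fun _ => _) = (fun x => u x 0 i)); first exact: C1_u.
  by apply/funext => x; rewrite four_velocity_space.
rewrite (_ : (fun _ => _) = (fun x => Num.sqrt (1 + dot (u x) (u x)))); last first.
  by apply/funext => x; rewrite four_velocity_time.
have pos x : 0 < 1 + dot (u x) (u x) by rewrite ltr_pwDl // dot_ge0.
apply: (@C1_comp _ Num.sqrt (fun r => (2 * Num.sqrt r)^-1) (fun x => 1 + dot (u x) (u x))).
- apply: C1_add; first exact: C1_cst.
  by apply: C1_sum => i; apply: C1_mul; exact: C1_u.
- by move=> x _; exact: is_derive1_sqrt.
- move=> x _; apply: cvgV; first by rewrite mulf_neq0 // sqrtr_eq0 -ltNge pos.
  by apply: cvgM; [exact: cvg_cst|exact: sqrt_continuous].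
Qed.

Lemma states_at x : future x -> states (n x, s x).
Proof. by move=> x0; split; [exact: (sol_n_ge0 sol)|exact: (sol_s_ge0 sol)]. Qed.

Lemma C1_energy_density : C1 energy_density.
Proof. by have [] := C1_state (eos_C1_rho eos) C1_n C1_s states_at. Qed.

Lemma C1_pressure_at : C1 pressure_at.
Proof. by have [] := C1_state (eos_C1_pressure eos) C1_n C1_s states_at. Qed.

Lemma C1_enthalpy_at : C1 enthalpy_at.
Proof. by apply: C1_add; [exact: C1_energy_density|exact: C1_pressure_at]. Qed.

Lemma partialE nu f (x : X) : 0 < x 0 0 -> partial nu f x = 'D_(axis nu) f x.
Proof. by move=> x0; rewrite /partial derive_inE //; exact: interior_future. Qed.

Section at_point.
Variable x : X.
Hypothesis x0 : 0 < x 0 0.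
Local Notation D mu f := ('D_(axis mu) f x).

Lemma particle_equation :
  \sum_nu vel nu x * D nu n + n x * \sum_nu D nu (vel nu) = 0.
Proof.
rewrite -[RHS](sol_particles sol (ltW x0)) mulr_sumr -big_split /=; apply: eq_bigr => nu _.
rewrite partialE //.
have [_ ->] := isd_mul (C1_is_derive nu C1_n x0) (C1_is_derive nu (C1_vel nu) x0).
by rewrite addrC.
Qed.

Lemma entropy_equation : \sum_nu vel nu x * D nu s = 0.
Proof.
rewrite -[RHS](sol_entropy sol (ltW x0)); apply: eq_bigr => nu _.
by rewrite partialE.
Qed.

Lemma momentum_equation mu :
  enthalpy_at x * (\sum_nu vel nu x * D nu (vel mu)) +
  \sum_nu Defs.minkowski mu nu * D nu pressure_at + vel mu x * (\sum_nu vel nu x * D nu pressure_at) = 0.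
Proof.
rewrite -[RHS](sol_momentum sol (ltW x0) mu) -addrA; congr (_ + _).
  by congr (_ * _); apply: eq_bigr => nu _; rewrite partialE.
rewrite mulr_sumr -big_split /=; apply: eq_bigr => nu _.
by rewrite partialE // /projection mulrDl mulrA.
Qed.

(** The energy equation is not among the equations of motion; it follows from
    d rho = d_n rho dn + d_s rho ds and the transport of n and s. *)
Lemma energy_equation :
  \sum_nu vel nu x * D nu energy_density + enthalpy_at x * \sum_nu D nu (vel nu) = 0.
Proof.
have [_ Dr] := C1_state (eos_C1_rho eos) C1_n C1_s states_at.
under eq_bigr => nu _ do rewrite (Dr nu x x0) mulrDr mulrCA (mulrCA (vel nu x)).
rewrite big_split /= -!mulr_sumr entropy_equation mulr0 addr0.
rewrite /enthalpy_at /energy_density /pressure_at enthalpy /= -mulrA mulrCA -mulrDr.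
by rewrite particle_equation mulr0.
Qed.

End at_point.

(** Both n and the entropy are carried by the flow, hence so is any function of
    the entropy, weighted by n. *)
Lemma entropy_current_conserved (f f' : R -> R) :
  (forall r, is_derive r (1 : R) f (f' r)) -> continuous f' ->
  conserved (fun mu x => n x * f (s x) * vel mu x).
Proof.
move=> df cf'.
have cfs : C1 (fun x => f (s x)) by apply: (@C1_comp _ f f' s C1_s) => // x _; exact: cf'.
split => [mu|x x0].
  by apply: C1_mul; [apply: C1_mul => //; exact: C1_n|exact: C1_vel].
have E mu : 'D_(axis mu) (fun x => n x * f (s x) * vel mu x) x =
    f (s x) * (vel mu x * 'D_(axis mu) n x) + f (s x) * n x * 'D_(axis mu) (vel mu) x +
    n x * f' (s x) * (vel mu x * 'D_(axis mu) s x).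
  have d1 := isd_comp (df _) (C1_is_derive mu C1_s x0).
  have d2 := isd_mul (C1_is_derive mu C1_n x0) d1.
  have [_ ->] := isd_mul d2 (C1_is_derive mu (C1_vel mu) x0).
  by ring.
under eq_bigr => mu _ do rewrite E.
rewrite !big_split /= -!mulr_sumr entropy_equation // mulr0 addr0 -mulrA -mulrDr.
by rewrite particle_equation // mulr0.
Qed.

Definition stress (mu nu : 'I_4) (x : X) : R :=
  enthalpy_at x * vel mu x * vel nu x + pressure_at x * Defs.minkowski mu nu.

(** The component of the divergence along u is energy_equation, the rest is the
    momentum equation. *)
Lemma stress_conserved mu : conserved (stress mu).
Proof.
have cw := C1_enthalpy_at; have cp := C1_pressure_at.
split => [nu|x x0].
  apply: C1_add; last by apply: C1_mul => //; exact: C1_cst.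
  by apply: C1_mul; [apply: C1_mul => //|]; exact: C1_vel.
have E nu : 'D_(axis nu) (stress mu nu) x =
    vel mu x * (vel nu x * 'D_(axis nu) energy_density x) +
    vel mu x * (vel nu x * 'D_(axis nu) pressure_at x) +
    enthalpy_at x * (vel nu x * 'D_(axis nu) (vel mu) x) +
    vel mu x * enthalpy_at x * 'D_(axis nu) (vel nu) x +
    Defs.minkowski mu nu * 'D_(axis nu) pressure_at x.
  have dw := isd_add (C1_is_derive nu C1_energy_density x0) (C1_is_derive nu C1_pressure_at x0).
  have dp := C1_is_derive nu C1_pressure_at x0.
  have d1 := isd_mul (isd_mul dw (C1_is_derive nu (C1_vel mu) x0)) (C1_is_derive nu (C1_vel nu) x0).
  have d2 := isd_mul dp (isd_cst (Defs.minkowski mu nu) x (axis nu)).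
  have [_ ->] := isd_add d1 d2.
  by rewrite /enthalpy_at; ring.
under eq_bigr => nu _ do rewrite E.
rewrite !big_split /= -!mulr_sumr.
have e1 := energy_equation x0; have e2 := momentum_equation x0 mu.
set a := \sum_nu _ in e1 *; set b := \sum_nu _ in e1 *.
set c := \sum_nu vel nu x * _ in e2 *; set d := \sum_nu Defs.minkowski _ _ * _ in e2 *.
set e := \sum_nu vel nu x * 'D_(axis nu) pressure_at x in e2 *.
have -> : vel mu x * a + vel mu x * e + enthalpy_at x * c + vel mu x * enthalpy_at x * b + d =
   vel mu x * (a + enthalpy_at x * b) + (enthalpy_at x * c + d + vel mu x * e) by ring.
by rewrite e1 e2 mulr0 addr0.
Qed.

End fluid_currents.

(** * Finite speed of propagation *)

Section euclid.
Context {R : realType}.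
Implicit Types a b : 'I_3 -> R.

Definition norm3 a : R := Num.sqrt (\sum_i a i ^+ 2).

Lemma sumsqr_ge0 a : 0 <= \sum_i a i ^+ 2.
Proof. by apply: sumr_ge0 => i _; exact: sqr_ge0. Qed.

Lemma norm3_sqr a : norm3 a ^+ 2 = \sum_i a i ^+ 2.
Proof. by rewrite sqr_sqrtr // sumsqr_ge0. Qed.

Lemma norm3_ge0 a : 0 <= norm3 a. Proof. exact: sqrtr_ge0. Qed.

Lemma norm3_triangle a b : norm3 (fun i => a i + b i) <= norm3 a + norm3 b.
Proof.
rewrite -(ler_pXn2r (_ : 0 < 2)%N) ?nnegrE ?addr_ge0 ?norm3_ge0 //.
rewrite sqrrD !norm3_sqr.
have -> : \sum_i (a i + b i) ^+ 2 = \sum_i a i ^+ 2 + (\sum_i a i * b i) *+ 2 + \sum_i b i ^+ 2.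
  by rewrite -sumrMnl -!big_split /=; apply: eq_bigr => i _; rewrite sqrrD.
rewrite lerD2r lerD2l lerMn2r /=.
apply: le_trans (ler_norm _) _.
rewrite -(ler_pXn2r (_ : 0 < 2)%N) ?nnegrE ?mulr_ge0 ?norm3_ge0 //.
by rewrite real_normK ?num_real // exprMn !norm3_sqr cauchy_schwarz3.
Qed.

Lemma norm3_lt a (r : R) : 0 <= r -> (norm3 a < r) = (\sum_i a i ^+ 2 < r ^+ 2).
Proof.
by move=> r0; rewrite -norm3_sqr ltr_pXn2r // nnegrE norm3_ge0.
Qed.

End euclid.

Section uniform_in_time.
Context {R : realType}.
Local Notation X := 'rV[R]_4.
Local Notation S := (R * R * R)%type.

(** A C^1 function is uniformly continuous in time on the compact cylinder
    [0, T] x cube; this fixes the thickness of the slabs in cone_background. *)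
Lemma uniform_in_time (f : X -> R) (T L e : R) : C1 f -> 0 < T -> 0 < e ->
  exists2 d, 0 < d & forall t t' z, 0 <= t -> t <= T -> 0 <= t' -> t' <= T -> cube L z ->
    `|t - t'| < d -> `|f (pt t z) - f (pt t' z)| < e.
Proof.
move=> C1f T0 e0.
have cF := clamped_continuous C1f T0.
pose F (tz : R * S) := f (pt (clamp T tz.1) tz.2).
have cpt : compact (`[0, T]%classic `*` cube L : set (R * S)).
  apply: compact_setX; first exact: segment_compact.
  by apply: compact_setX; [apply: compact_setX|]; exact: segment_compact.
pose P (d : R) (tz : R * S) := forall t', `|tz.1 - t'| < d -> `|F tz - F (t', tz.2)| < e.
have : \forall d \near (0 : R)^'+, forall tz, (`[0, T]%classic `*` cube L : set (R * S)) tz -> P d tz.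
  have /compact_near_coveringP := cpt; apply => -[t z] _.
  have : \forall w \near (t, z), `|F (t, z) - F w| < e / 2.
    by have /cvgrPdist_lt := cF (t, z); apply; rewrite divr_gt0.
  move=> -[[A B] /= [/nbhs_ballP[r /= r0 rA] Bz] AB].
  exists ((ball t (r / 2) `*` B), [set d : R | d < r / 2]) => /=.
    split; first by exists (ball t (r / 2), B) => //=; split => //; apply: nbhsx_ballx; rewrite divr_gt0.
    by apply: nbhs_right_lt; rewrite divr_gt0.
  move=> [[t1 z1] d] /= [[t1b z1B] dr] t' tt'.
  have h1 : `|F (t, z) - F (t1, z1)| < e / 2.
    by apply: AB; split => //=; apply: rA; apply: le_ball t1b; lra.
  have h2 : `|F (t, z) - F (t', z1)| < e / 2.
    apply: AB; split => //=; apply: rA; move: t1b; rewrite /ball /= => t1b.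
    have -> : t - t' = (t - t1) + (t1 - t') by ring.
    apply: le_lt_trans (ler_normD _ _) _; lra.
  have -> : F (t1, z1) - F (t', z1) = - (F (t, z) - F (t1, z1)) + (F (t, z) - F (t', z1)) by ring.
  apply: le_lt_trans (ler_normD _ _) _; rewrite normrN; lra.
move=> near_d.
have [d [d0 dP]] : exists d : R, 0 < d /\
    forall tz, (`[0, T]%classic `*` cube L : set (R * S)) tz -> P d tz.
  near (0 : R)^'+ => d; exists d; split; first by near: d; exact: nbhs_right_gt.
  by near: d.
exists d => // t t' z t0 tT t'0 t'T zL tt'.
have := dP (t, z) _ t' tt'; rewrite /F /= !clamp_id //; apply.
by split => //=; rewrite in_itv /= t0.
Unshelve. all: by end_near. Qed.

End uniform_in_time.

Section propagation.
Context {R : realType}.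
Local Notation X := 'rV[R]_4.
Variables (rho : R * R -> R) (n0 s0 : 'rV[R]_3 -> R) (u0 : 'rV[R]_3 -> 'rV[R]_3).
Variables (n s : X -> R) (u : X -> 'rV[R]_3).
Hypotheses (eos : equation_of_state rho) (sol : fluid_solution rho n0 s0 u0 n s u).
Local Notation U := (vel u).
Local Notation w x := (dot (u x) (u x)).

Lemma vel_time (x : X) : U 0 x = Num.sqrt (1 + w x).
Proof. exact: four_velocity_time. Qed.

Lemma vel_space i (x : X) : U (space_index i) x = u x 0 i.
Proof. exact: four_velocity_space. Qed.

Lemma vel_time_ge1 (x : X) : 1 <= U 0 x.
Proof. by rewrite vel_time; have [] := sqrt1D_bounds (dot_ge0 (u x)). Qed.

Lemma vel_time_sqr (x : X) : U 0 x ^+ 2 = 1 + w x.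
Proof. by rewrite vel_time; have [] := sqrt1D_bounds (dot_ge0 (u x)). Qed.

Lemma sum_vel_space_sqr (x : X) : \sum_i U (space_index i) x ^+ 2 = w x.
Proof. by apply: eq_bigr => i _; rewrite vel_space expr2. Qed.

Lemma initial_point (x : X) : x 0 0 = 0 -> exists2 y : 'rV[R]_3, x = vec4 0 y & forall i, y 0 i = x 0 (space_index i).
Proof.
move=> x0; exists (vec3 (space_part x)); first by rewrite {1}(pt_space_part x) x0.
by move=> i; rewrite {2}(pt_space_part x) pt_space.
Qed.

(** The current n ((sb - s)^+)^2 u is conserved, its spatial part is bounded by
    its time component, and it vanishes initially; cone_vanish applies with
    slope 1. *)
Lemma entropy_minimum (sb : R) : (forall y, sb <= s0 y) ->
  forall x, future x -> 0 < n x -> sb <= s x.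
Proof.
move=> sb0 x x0 nx; pose f (r : R) := pos_sqr (sb - r).
pose J mu (x : X) := n x * f (s x) * U mu x.
have cJ : conserved J.
  apply: (entropy_current_conserved sol (f := f) (f' := fun r => 2 * Num.max 0 (sb - r) * (0 - 1))).
    move=> r; apply: (isd_comp (g := fun r : R => sb - r) (isd_pos_sqr _)).
  move=> r; apply: cvgM; last exact: cvg_cst.
  apply: (cvg_comp (fun r : R => sb - r) (fun q : R => 2 * Num.max 0 q)); last exact: pos_part_continuous.
  by apply: cvgB; [exact: cvg_cst|exact: cvg_id].
have J00 : J 0 x = 0.
  apply: (@cone_vanish _ 1 (x 0 0 + 1) (fun i => x 0 (space_index i)) ler01 _ J 0 (x 0 0) cJ) => //.
  - by rewrite ltr_wpDl.
  - by rewrite lerDl.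
  - move=> y y0 _ _; have ny := sol_n_ge0 sol y0.
    have nf : 0 <= n y * f (s y) by rewrite mulr_ge0 ?sqr_ge0.
    have U1 := vel_time_ge1 y.
    split; first by rewrite mulr_ge0 // (le_trans ler01).
    rewrite expr1n mul1r /J; under eq_bigr => i _ do rewrite exprMn.
    rewrite -mulr_sumr sum_vel_space_sqr [X in _ <= X]exprMn vel_time_sqr.
    by rewrite ler_wpM2l ?sqr_ge0 // lerDr.
  - move=> y y0 _; have [z -> _] := initial_point y0.
    rewrite /J (sol_initial_s sol) /f /pos_sqr max_l ?subr_le0 //.
    by rewrite expr0n mulr0 mul0r.
  - rewrite /in_cone /dist2 big1 => [|i _]; last by rewrite subrr expr0n.
    by rewrite mul1r addrAC subrr add0r expr1n.
move: J00 => /eqP; rewrite /J !mulf_eq0 (gt_eqF nx) /= (gt_eqF (lt_le_trans ltr01 (vel_time_ge1 x))) orbF.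
rewrite orbb => /eqP h; rewrite -subr_le0.
by rewrite -h le_max lexx orbT.
Qed.

Variables (nb sb : R).
Hypotheses (nb0 : 0 < nb) (sb0 : 0 < sb).
Local Notation eta := (sound_speed rho (nb, sb)).
Local Notation hb := (d_n rho (nb, sb)).

Definition background (x : X) : Prop := [/\ n x = nb, s x = sb & u x = 0].

(** The energy current minus hb times the particle current, and a constant which
    makes it vanish in the constant state. *)
Definition relative_current (mu : 'I_4) (x : X) : R :=
  stress rho n s u 0 mu x + (- hb * (n x * 1 * U mu x) +
    (if mu == 0 then hb * nb - rho (nb, sb) else 0)).

Lemma relative_current_conserved : conserved relative_current.
Proof.
have c1 : conserved (fun mu x => n x * 1 * U mu x).
  apply: (entropy_current_conserved sol (f := fun=> 1) (f' := fun=> 0)).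
  by move=> r; exact: cvg_cst.
have c2 := conserved_cst (fun mu => if mu == 0 then hb * nb - rho (nb, sb) else 0).
exact: (conserved_add (stress_conserved eos sol 0) (conserved_add (conserved_scale (- hb) c1) c2)).
Qed.

Lemma relative_current_time (x : X) : s x = sb -> relative_current 0 x = rel_energy rho nb sb (n x) (w x).
Proof.
move=> sx; rewrite /relative_current /stress /Defs.minkowski !eqxx.
rewrite /enthalpy_at /energy_density /pressure_at sx -[X in X + _ * -1]mulrA -expr2 vel_time_sqr vel_time.
by rewrite /rel_energy; ring.
Qed.

Lemma relative_current_space i (x : X) : s x = sb ->
  relative_current (space_index i) x = u x 0 i * rel_flux rho nb sb (n x) (w x).
Proof.
move=> sx; rewrite /relative_current /stress /Defs.minkowski.
have -> : (0 == space_index i) = false by [].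
have -> : (space_index i == 0) = false by [].
rewrite /enthalpy_at /energy_density /pressure_at sx vel_space vel_time /rel_flux; ring.
Qed.

Section slab.
Variables (sigma t2 : R) (c : 'I_3 -> R) (a b delta : R).
Hypotheses (sigma0 : 0 < sigma) (t20 : 0 < t2) (a0 : 0 <= a) (bt2 : b <= t2).
Local Notation cone := (in_cone sigma t2 c).
Hypotheses (delta0 : 0 < delta) (delta_sigma : delta <= sigma).
Hypothesis deltaP : forall n w, `|n - nb| < delta -> 0 <= w -> w < delta ^+ 2 ->
  [/\ 0 < n, 0 <= rel_energy rho nb sb n w,
    w * rel_flux rho nb sb n w ^+ 2 <= sigma ^+ 2 * rel_energy rho nb sb n w ^+ 2 &
    (rel_energy rho nb sb n w = 0 -> n = nb /\ w = 0)].
Hypothesis base : forall x : X, x 0 0 = a -> cone x -> background x.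
Hypothesis near_bg : forall x : X, a <= x 0 0 -> x 0 0 <= b -> cone x ->
  `|n x - nb| < delta /\ w x < delta ^+ 2.

(** cone_vanish is applied twice: to n (s - sb)^2 u, which shows that the entropy
    is constant, and then to the relative current, whose structure near the
    constant state is known at entropy sb only. *)
Lemma slab_background (x : X) : a <= x 0 0 -> x 0 0 <= b -> cone x -> background x.
Proof.
move=> ax xb xc.
have sE (y : X) : a <= y 0 0 -> y 0 0 <= b -> cone y -> s y = sb.
  move=> ay yb yc.
  pose J mu (x : X) := n x * (s x - sb) ^+ 2 * U mu x.
  have cJ : conserved J.
    apply: (entropy_current_conserved sol (f := fun r => (r - sb) ^+ 2) (f' := fun r => 2 * (r - sb) * (1 - 0))).
      move=> r; apply: (isd_comp (g := fun r : R => r - sb) (isd_sqr _)).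
    move=> r; apply: cvgM; last exact: cvg_cst.
    by apply: cvgM; [exact: cvg_cst|apply: cvgB; [exact: cvg_id|exact: cvg_cst]].
  have J00 : J 0 y = 0.
    apply: (@cone_vanish _ sigma t2 c (ltW sigma0) t20 J a b cJ) => //.
    - move=> z az zb zc; have [zn zw] := near_bg az zb zc.
      have [nz _ _ _] := deltaP zn (dot_ge0 (u z)) zw.
      have nf : 0 <= n z * (s z - sb) ^+ 2 by rewrite mulr_ge0 ?sqr_ge0 // ltW.
      have U1 := vel_time_ge1 z.
      split; first by rewrite mulr_ge0 // (le_trans ler01).
      rewrite /J; under eq_bigr => i _ do rewrite exprMn.
      rewrite -mulr_sumr sum_vel_space_sqr [X in _ <= _ * X]exprMn vel_time_sqr [X in _ <= X]mulrCA.
      apply: ler_wpM2l; first exact: sqr_ge0.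
      have ds : delta ^+ 2 <= sigma ^+ 2 by rewrite ler_pXn2r ?nnegrE // ltW.
      have := dot_ge0 (u z); have := sqr_ge0 sigma; nra.
    - by move=> z za zc; have [_ sz _] := base za zc; rewrite /J sz subrr expr0n mulr0 mul0r.
  have [yn yw] := near_bg ay yb yc; have [ny _ _ _] := deltaP yn (dot_ge0 (u y)) yw.
  move: J00 => /eqP; rewrite /J !mulf_eq0 (gt_eqF ny) /= (gt_eqF (lt_le_trans ltr01 (vel_time_ge1 y))) orbF.
  by rewrite orbb subr_eq0 => /eqP.
have K0 : relative_current 0 x = 0.
  apply: (@cone_vanish _ sigma t2 c (ltW sigma0) t20 relative_current a b relative_current_conserved) => //.
  - move=> z az zb zc; have [zn zw] := near_bg az zb zc.
    have [nz ez fz _] := deltaP zn (dot_ge0 (u z)) zw.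
    rewrite relative_current_time ?sE //; split => //.
    under eq_bigr => i _ do rewrite relative_current_space ?sE // exprMn.
    by rewrite -mulr_suml (_ : \sum_i _ = w z) //; apply: eq_bigr => i _; rewrite expr2.
  - move=> z za zc; have [nz sz uz] := base za zc; rewrite relative_current_time // nz uz.
    rewrite (_ : dot 0 0 = 0); last by apply: big1 => i _; rewrite mxE mul0r.
    by rewrite /rel_energy addr0 sqrtr1; ring.
have [xn xw] := near_bg ax xb xc; have [_ _ _ h] := deltaP xn (dot_ge0 (u x)) xw.
have sx := sE x ax xb xc.
rewrite relative_current_time // in K0; have [nx wx] := h K0.
split => //; apply/rowP => i; rewrite mxE.
have : (u x 0 i) ^+ 2 <= w x.
  by rewrite /dot (bigD1 i) //= -expr2 lerDl sumr_ge0 // => j _; rewrite -expr2 sqr_ge0.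
by rewrite wx => h2; apply/eqP; rewrite -sqrf_eq0 eq_le h2 sqr_ge0.
Qed.

End slab.

End propagation.

Section finite_speed.
Context {R : realType}.
Local Notation X := 'rV[R]_4.
Variables (rho : R * R -> R) (n0 s0 : 'rV[R]_3 -> R) (u0 : 'rV[R]_3 -> 'rV[R]_3).
Variables (n s : X -> R) (u : X -> 'rV[R]_3).
Hypotheses (eos : equation_of_state rho) (sol : fluid_solution rho n0 s0 u0 n s u).
Variables (nb sb : R).
Hypotheses (nb0 : 0 < nb) (sb0 : 0 < sb).
Hypothesis data : forall y, ~ unit_ball3 y -> [/\ n0 y = nb, s0 y = sb & u0 y = 0].
Local Notation eta := (sound_speed rho (nb, sb)).
Local Notation bg := (background n s u nb sb).

Definition spatial (x : X) : 'I_3 -> R := fun i => x 0 (space_index i).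

Lemma initial_background (x : X) : x 0 0 = 0 -> 1 < norm3 (spatial x) -> bg x.
Proof.
move=> x0 x1; have [y xy yE] := initial_point x0.
have [|h1 h2 h3] := data (y := y).
  rewrite /unit_ball3 /= /enorm; apply/negP; rewrite -ltNge.
  rewrite (_ : dot y y = \sum_i spatial x i ^+ 2) //.
  by apply: eq_bigr => i _; rewrite yE expr2.
rewrite /background xy; split.
- by rewrite (sol_initial_n sol).
- by rewrite (sol_initial_s sol).
- by rewrite (sol_initial_u sol).
Qed.

(** Induction over slabs: if the solution is in the constant state at the base
    of a thin slab, it is close to it inside, and slab_background applies. *)
Lemma cone_background (sigma t1 t2 : R) (c : 'I_3 -> R) : eta < sigma -> 0 < t1 -> t1 <= t2 ->
  1 + sigma * t2 < norm3 c ->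
  forall x : X, 0 <= x 0 0 -> x 0 0 <= t1 -> in_cone sigma t2 c x -> bg x.
Proof.
move=> es t10 t12 cfar.
have st : states (nb, sb) by split; exact: ltW.
have sg0 : 0 < sigma by apply: lt_trans es; exact: sound_speed_gt0.
have t20 : 0 < t2 by exact: lt_le_trans t12.
have [d1 d10 d1P] := near_background eos nb0 (ltW sb0) es.
pose delta := Num.min d1 sigma.
have delta0 : 0 < delta by rewrite lt_min d10.
have dsig : delta <= sigma by rewrite ge_min lexx orbT.
have dP m w : `|m - nb| < delta -> 0 <= w -> w < delta ^+ 2 ->
  [/\ 0 < m, 0 <= rel_energy rho nb sb m w,
    w * rel_flux rho nb sb m w ^+ 2 <= sigma ^+ 2 * rel_energy rho nb sb m w ^+ 2 &
    (rel_energy rho nb sb m w = 0 -> m = nb /\ w = 0)].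
  move=> h1 h2 h3; have dd : delta <= d1 by rewrite ge_min lexx.
  apply: d1P => //; first exact: lt_le_trans dd.
  by apply: lt_le_trans h3 _; rewrite ler_pXn2r ?nnegrE // ltW.
have cone_at0 (x : X) : x 0 0 = 0 -> in_cone sigma t2 c x -> bg x.
  move=> x0 xc; apply: initial_background => //.
  have h : norm3 (fun i => c i - spatial x i) < sigma * t2.
    rewrite norm3_lt; last by rewrite mulr_ge0 // ltW.
    move: xc; rewrite /in_cone x0 subr0 /dist2; congr (_ < _).
    by apply: eq_bigr => i _; rewrite -sqrrN opprB.
  have := norm3_triangle (fun i => c i - spatial x i) (spatial x).
  rewrite (_ : (fun i => _) = c); first by lra.
  by apply/funext => i; rewrite subrK.
pose L := 1 + sigma * t2 + \sum_i `|c i|.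
have coneL (x : X) : 0 <= x 0 0 -> x 0 0 <= t1 -> in_cone sigma t2 c x -> cube L (space_part x).
  move=> x0 xt xc.
  have aux i : x 0 (space_index i) \in `[- L, L].
    rewrite in_itv /= -ler_norml.
    have ci : `|c i| <= \sum_i `|c i| by rewrite (bigD1 i) //= lerDl sumr_ge0.
    have h : `|x 0 (space_index i) - c i| <= sigma * t2.
      rewrite -(ler_pXn2r (_ : 0 < 2)%N) ?nnegrE ?mulr_ge0 ?(ltW sg0) ?(ltW t20) //.
      rewrite real_normK ?num_real //; apply: (@le_trans _ _ (dist2 c x)).
        by rewrite /dist2 (bigD1 i) //= lerDl sumr_ge0 // => j _; exact: sqr_ge0.
      apply: (le_trans (ltW xc)).
      rewrite ler_pXn2r ?nnegrE ?mulr_ge0 ?(ltW sg0) ?(ltW t20) ?subr_ge0 ?(le_trans xt) //.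
      by rewrite ler_wpM2l ?(ltW sg0) // gerBl.
    have -> : x 0 (space_index i) = (x 0 (space_index i) - c i) + c i by rewrite subrK.
    by apply: le_trans (ler_normD _ _) _; rewrite /L; lra.
  by split; [split|]; rewrite /space_part /=; exact: aux.
have [en en0 enP] := uniform_in_time L (C1_n sol) t10 delta0.
have dh0 : 0 < delta / 2 by rewrite divr_gt0.
have [e0 e00 e0P] := uniform_in_time L (C1_u sol 0) t10 dh0.
have [e1 e10 e1P] := uniform_in_time L (C1_u sol 1) t10 dh0.
have [e2 e20 e2P] := uniform_in_time L (C1_u sol 2%:R) t10 dh0.
pose e := Num.min (Num.min en e0) (Num.min e1 e2) / 2.
have m0 : 0 < Num.min (Num.min en e0) (Num.min e1 e2) by rewrite !lt_min en0 e00 e10 e20.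
have e_gt0 : 0 < e by rewrite divr_gt0.
have [een [ee0 [ee1 ee2]]] : e < en /\ e < e0 /\ e < e1 /\ e < e2.
  have em : e < Num.min (Num.min en e0) (Num.min e1 e2) by rewrite /e; lra.
  by move: em; rewrite !lt_min => /andP[/andP[-> ->] /andP[-> ->]].
have near_step (x y : X) : 0 <= x 0 0 -> x 0 0 <= t1 -> 0 <= y 0 0 -> y 0 0 <= t1 ->
    cube L (space_part x) -> space_part y = space_part x -> `|x 0 0 - y 0 0| <= e -> bg y ->
    `|n x - nb| < delta /\ dot (u x) (u x) < delta ^+ 2.
  move=> x0 xt y0 yt xL sxy xye [ny _ uy].
  have E (f : X -> R) : f x - f y = f (pt (x 0 0) (space_part x)) - f (pt (y 0 0) (space_part x)).
    by rewrite -pt_space_part -sxy -pt_space_part.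
  split; first by rewrite -ny E; apply: enP => //; exact: le_lt_trans een.
  have ui i : `|u x 0 i| < delta / 2.
    have -> : u x 0 i = u x 0 i - u y 0 i by rewrite uy mxE subr0.
    rewrite (E (fun x => u x 0 i)).
    have [->|->|->] := I3_cases i.
    - by apply: e0P => //; exact: le_lt_trans ee0.
    - by apply: e1P => //; exact: le_lt_trans ee1.
    - by apply: e2P => //; exact: le_lt_trans ee2.
  have ui2 i : u x 0 i * u x 0 i < (delta / 2) ^+ 2.
    by rewrite -expr2 -real_normK ?num_real // ltr_pXn2r ?nnegrE // ltW.
  rewrite /dot !big_ord_recl big_ord0 addr0.
  have := ui2 ord0; have := ui2 (lift ord0 ord0); have := ui2 (lift ord0 (lift ord0 ord0)).
  by have := sqr_ge0 delta; lra.
have steps (k : nat) (x : X) : 0 <= x 0 0 -> x 0 0 <= Num.min (k%:R * e) t1 -> in_cone sigma t2 c x -> bg x.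
  elim: k x => [|k IH] x x0.
    rewrite mul0r le_min => /andP[xle _] xc; apply: cone_at0 => //.
    by apply/eqP; rewrite eq_le xle.
  move=> xk xc; pose a := Num.min (k%:R * e) t1.
  have a0 : 0 <= a by rewrite le_min (ltW t10) andbT mulr_ge0 // ltW.
  have at1 : a <= t1 by rewrite ge_min lexx orbT.
  have [xa|ax] := leP (x 0 0) a; first exact: IH.
  pose b := Num.min (k.+1%:R * e) t1.
  have bt1 : b <= t1 by rewrite ge_min lexx orbT.
  have bae : b - a <= e.
    rewrite /a /b -natr1 mulrDl mul1r; set q := k%:R * e.
    by rewrite /Num.min; case: ifP; case: ifP => /=; rewrite ?ltNge => h1 h2; try lra; move: h1 h2 => /negbT; rewrite ?negbK; lra.
  apply: (slab_background eos sol (sigma := sigma) (t2 := t2) (c := c) (a := a) (b := b) sg0 t20 a0 _ delta0 dsig dP) => //.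
  - exact: le_trans t12.
  - by move=> y ya yc; apply: IH => //; rewrite ya // lexx.
  - move=> y ay yb yc; have y0 : 0 <= y 0 0 by exact: le_trans ay.
    have yt : y 0 0 <= t1 by exact: le_trans bt1.
    have zc : in_cone sigma t2 c (pt a (space_part y)).
      rewrite /in_cone /dist2 pt_time.
      apply: (@le_lt_trans _ _ (dist2 c y)).
        by rewrite {2}(pt_space_part y) /dist2; under eq_bigr => i _ do rewrite pt_space;
           under [leRHS]eq_bigr => i _ do rewrite pt_space.
      have k1 : 0 <= sigma * (t2 - y 0 0).
        by apply: mulr_ge0; [exact: ltW|rewrite subr_ge0; exact: (le_trans yt t12)].
      have k2 : sigma * (t2 - y 0 0) <= sigma * (t2 - a).
        by apply: ler_wpM2l; [exact: ltW|rewrite lerD2l lerN2].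
      by apply: (lt_le_trans yc); rewrite ler_pXn2r ?nnegrE // (le_trans k1).
    apply: (near_step y (pt a (space_part y))); rewrite ?pt_time ?space_part_pt //.
    + exact: coneL.
    + by rewrite ger0_norm ?subr_ge0 //; lra.
    + by apply: IH => //; rewrite pt_time.
  - exact: ltW.
move=> x x0 xt xc.
have [k kP] : exists k : nat, t1 <= k%:R * e.
  exists (Num.trunc (t1 / e)).+1; rewrite -ler_pdivrMr //.
  by apply/ltW; rewrite truncnS_gt.
by apply: (steps k) => //; rewrite le_min xt (le_trans xt kP).
Qed.

(** The cone estimate needs a slope sigma > eta and a vertex strictly above the
    point. Since the point lies strictly outside the sound cone of the unit
    ball, there is room for both. *)
Lemma finite_speed (x : X) : future x -> 1 + eta * x 0 0 < norm3 (spatial x) -> bg x.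
Proof.
rewrite /future /= le_eqVlt => /predU1P[x0|x0] xfar.
  by apply: initial_background => //; rewrite -x0 mulr0 addr0 in xfar.
have eta0 : 0 < eta by apply: sound_speed_gt0 => //; split; exact: ltW.
set g := norm3 (spatial x) - (1 + eta * x 0 0).
have g0 : 0 < g by rewrite subr_gt0.
set q := eta + x 0 0 + 1.
have q0 : 0 < q by rewrite /q; lra.
(* Small enough for 1 + (eta + k) (t + k) to stay below the distance of the point
   to the origin. *)
pose k := Num.min 1 (g / (2 * q)).
have k0 : 0 < k by rewrite lt_min ltr01 divr_gt0 // mulr_gt0.
have k1 : k <= 1 by rewrite ge_min lexx.
have kg : k * (2 * q) <= g by rewrite -ler_pdivlMr ?mulr_gt0 // ge_min lexx orbT.
apply: (@cone_background (eta + k) (x 0 0) (x 0 0 + k) (spatial x)) => //; try lra.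
- have -> : 1 + (eta + k) * (x 0 0 + k) = 1 + eta * x 0 0 + k * (eta + x 0 0 + k) by ring.
  have : k * (eta + x 0 0 + k) <= k * q by rewrite ler_wpM2l ?(ltW k0) // /q lerD2l.
  by rewrite /g in kg; lra.
- rewrite /in_cone /dist2 big1 => [|i _]; last by rewrite /spatial subrr expr0n.
  by rewrite addrAC subrr add0r exprn_gt0 // mulr_gt0 // addr_gt0.
Qed.

End finite_speed.

(** * The radial momentum and its virial identity *)

Section virial.
Context {R : realType}.
Local Notation X := 'rV[R]_4.
Local Notation S := (R * R * R)%type.
Local Notation leb := (@lebesgue_measure R).
Local Notation leb3 := ((leb \x leb) \x leb)%E.
Variables (rho : R * R -> R) (n0 s0 : 'rV[R]_3 -> R) (u0 : 'rV[R]_3 -> 'rV[R]_3).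
Variables (n s : X -> R) (u : X -> 'rV[R]_3).
Hypotheses (eos : equation_of_state rho) (sol : fluid_solution rho n0 s0 u0 n s u).
Variables (nb sb : R).
Hypotheses (nb0 : 0 < nb) (sb0 : 0 < sb).
Hypothesis data : forall y, ~ unit_ball3 y -> [/\ n0 y = nb, s0 y = sb & u0 y = 0].
Hypothesis A1 : rho_nonincreasing_in_entropy rho.
Hypothesis A2 : sound_speed_nondecreasing_in_pressure rho.
Hypothesis sb_le : forall y, sb <= s0 y.

Local Notation eta := (sound_speed rho (nb, sb)).
Local Notation rhob := (rho (nb, sb)).
Local Notation pb := (pressure rho (nb, sb)).
Local Notation w x := (dot (u x) (u x)).
Local Notation enth := (enthalpy_at rho n s).
Local Notation Tmn := (stress rho n s u).

Definition energy_current (mu : 'I_4) (x : X) : R :=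
  Tmn 0 mu x + (if mu == 0 then - rhob else 0).

Definition momentum_current (i : 'I_3) (mu : 'I_4) (x : X) : R :=
  Tmn (space_index i) mu x + - pb * Defs.minkowski (space_index i) mu.

(** The flux of radial momentum, x . T^mu with the constant pressure subtracted
    so that it has compact support on each slice. Its divergence is the trace
    of the spatial stress, because momentum is conserved. *)
Definition radial_current (mu : 'I_4) (x : X) : R :=
  \sum_i x 0 (space_index i) * momentum_current i mu x.

Definition kinetic (x : X) : R := enth x * w x.

Lemma energy_current_conserved : conserved energy_current.
Proof.
exact: (conserved_add (stress_conserved eos sol 0)
  (conserved_cst (fun mu => if mu == 0 then - rhob else 0))).
Qed.

Lemma momentum_current_conserved i : conserved (momentum_current i).
Proof.
exact: (conserved_add (stress_conserved eos sol (space_index i))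
  (conserved_cst (fun mu => - pb * Defs.minkowski (space_index i) mu))).
Qed.

Lemma C1_radial_current mu : C1 (radial_current mu).
Proof.
apply: C1_sum => i; apply: C1_mul; first exact: C1_coord.
exact: (conserved_C1 (momentum_current_conserved i)).
Qed.

Lemma radial_current_div (x : X) : 0 < x 0 0 ->
  \sum_mu 'D_(axis mu) (radial_current mu) x = \sum_i momentum_current i (space_index i) x.
Proof.
move=> x0.
have E mu : 'D_(axis mu) (radial_current mu) x =
  \sum_i (x 0 (space_index i) * 'D_(axis mu) (momentum_current i mu) x +
     momentum_current i mu x * (mu == space_index i)%:R).
  have d i := isd_mul (isd_coord mu (space_index i) x)
     (C1_is_derive mu (conserved_C1 (momentum_current_conserved i) mu) x0).
  have H := is_derive_sum d.
  rewrite /radial_current (_ : (fun _ => _) =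
    \sum_(i < 3) (fun y : X => y 0 (space_index i) * momentum_current i mu y)).
    by have [_] := H.
  by apply/funext => y; rewrite fct_sumE.
under eq_bigr => mu _ do rewrite E.
rewrite exchange_big /=; apply: eq_bigr => i _.
rewrite big_split /= -mulr_sumr (conserved_div (momentum_current_conserved i)) // mulr0 add0r.
rewrite (bigD1 (space_index i)) //= eqxx mulr1 big1 ?addr0 // => mu /negbTE ->.
by rewrite mulr0.
Qed.

Lemma C1_kinetic : C1 kinetic.
Proof.
apply: C1_mul; first exact: C1_enthalpy_at eos sol.
by apply: C1_sum => i; apply: C1_mul; exact: C1_u sol i.
Qed.

Lemma energy_current_time x : energy_current 0 x = kinetic x + (energy_density rho n s x - rhob).
Proof.
rewrite /energy_current /stress /Defs.minkowski !eqxx /kinetic.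
rewrite -[X in X + _ * -1]mulrA -expr2 vel_time_sqr /enthalpy_at; ring.
Qed.

Lemma momentum_current_diag i x : momentum_current i (space_index i) x =
  enth x * (u x 0 i) ^+ 2 + (pressure_at rho n s x - pb).
Proof.
rewrite /momentum_current /stress /Defs.minkowski eqxx.
have -> : (space_index i == 0) = false by [].
rewrite vel_space; ring.
Qed.

Lemma radial_current_time x : radial_current 0 x =
  (\sum_i x 0 (space_index i) * u x 0 i) * Num.sqrt (1 + w x) * enth x.
Proof.
rewrite /radial_current -mulrA mulr_suml; apply: eq_bigr => i _.
rewrite /momentum_current /stress /Defs.minkowski.
have -> : (space_index i == 0) = false by [].
rewrite vel_space vel_time; ring.
Qed.

Lemma enth_ge0 x : future x -> 0 <= enth x.
Proof.
move=> x0; have st := states_at sol x0.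
by rewrite addr_ge0 //; [exact: (eos_rho_ge0 eos)|exact: (eos_pressure_ge0 eos)].
Qed.

Lemma kinetic_ge0 x : future x -> 0 <= kinetic x.
Proof. by move=> x0; rewrite mulr_ge0 ?enth_ge0 // dot_ge0. Qed.

(** The trace is kinetic + 3 (p - pb) and the energy density is
    kinetic + rho - rhob, so this is p - pb >= eta^2 (rho - rhob). *)
Lemma virial_pointwise x : future x ->
  (1 - 3 * eta ^+ 2) * kinetic x + 3 * eta ^+ 2 * energy_current 0 x <=
  \sum_i momentum_current i (space_index i) x.
Proof.
move=> x0; have st := states_at sol x0.
under [leRHS]eq_bigr => i _ do rewrite momentum_current_diag.
rewrite big_split /= -mulr_sumr (_ : \sum_i _ = w x); last by apply: eq_bigr => i _; rewrite expr2.
rewrite -/(kinetic x) sumr_const card_ord energy_current_time.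
have := pressure_tangent_entropy eos A2 A1 nb0 (ltW sb0) st.1
  (fun h => entropy_minimum sol sb_le x0 h) st.2.
rewrite -/(energy_density rho n s x) -/(pressure_at rho n s x) => h.
by rewrite -[X in _ <= _ + X]mulr_natl; lra.
Qed.

Section background_region.
Variable x : X.
Hypotheses (x0 : future x) (xfar : 1 + eta * x 0 0 < norm3 (spatial x)).

Lemma bg_values : [/\ energy_current 0 x = 0, kinetic x = 0,
  (forall mu, energy_current mu x = 0) & forall i mu, momentum_current i mu x = 0].
Proof.
have [nx sx ux] := finite_speed eos sol nb0 sb0 data x0 xfar.
have wx : w x = 0 by rewrite ux; apply: big1 => i _; rewrite mxE mul0r.
have U0 : vel u 0 x = 1 by rewrite vel_time wx addr0 sqrtr1.
have Ui i : vel u (space_index i) x = 0 by rewrite vel_space ux mxE.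
have k0 : kinetic x = 0 by rewrite /kinetic wx mulr0.
have mu0 i : (space_index i == 0) = false by [].
have em mu : energy_current mu x = 0.
  have [->|[i ->]] := I4_split mu.
    by rewrite energy_current_time k0 /energy_density nx sx subrr addr0.
  rewrite /energy_current /stress /Defs.minkowski (eq_sym 0) mu0 Ui; ring.
split => // i mu; rewrite /momentum_current /stress Ui mulr0 mul0r add0r.
by rewrite /pressure_at nx sx mulNr subrr.
Qed.

End background_region.

Lemma far_of_not_cube (T t : R) z : 0 <= t -> t <= T -> ~ cube (1 + eta * T) z ->
  1 + eta * pt t z 0 0 < norm3 (spatial (pt t z)).
Proof.
move=> t0 tT zc; rewrite pt_time.
have eta0 : 0 <= eta by exact: sqrtr_ge0.
have [i ri] := not_cube_coord zc.
apply: (@le_lt_trans _ _ (1 + eta * T)); first by rewrite lerD2l ler_wpM2l.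
apply: (lt_le_trans ri).
rewrite -(ler_pXn2r (_ : 0 < 2)%N) ?nnegrE ?norm3_ge0 // norm3_sqr.
rewrite real_normK ?num_real // (bigD1 i) //= /spatial pt_space lerDl sumr_ge0 // => j _.
exact: sqr_ge0.
Qed.

Variable T : R.
Hypothesis T0 : 0 < T.
Let L := 1 + eta * T.

Let L0 : 0 < L.
Proof. by rewrite ltr_pwDl // mulr_ge0 ?sqrtr_ge0 // ltW. Qed.

Lemma energy_current_supp mu t z : 0 <= t -> t <= T -> ~ cube L z -> energy_current mu (pt t z) = 0.
Proof.
move=> t0 tT zc; have [_ _ + _] := bg_values (pt_future z t0) (far_of_not_cube t0 tT zc).
exact.
Qed.

Lemma radial_current_supp mu t z : 0 <= t -> t <= T -> ~ cube L z -> radial_current mu (pt t z) = 0.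
Proof.
move=> t0 tT zc; have [_ _ _ h] := bg_values (pt_future z t0) (far_of_not_cube t0 tT zc).
by apply: big1 => i _; rewrite h mulr0.
Qed.

Lemma kinetic_supp t z : 0 <= t -> t <= T -> ~ cube L z -> kinetic (pt t z) = 0.
Proof. by move=> t0 tT zc; have [] := bg_values (pt_future z t0) (far_of_not_cube t0 tT zc). Qed.

Definition energy_at t : R := \int[leb3]_z energy_current 0 (pt t z).
Definition radial_at t : R := \int[leb3]_z radial_current 0 (pt t z).
Definition kinetic_at t : R := \int[leb3]_z kinetic (pt t z).

Lemma energy_conserved t : 0 <= t -> t <= T -> energy_at t = energy_at 0.
Proof.
move=> t0 tT.
have cE : {within `[0, T], continuous energy_at}.
  apply: (flux_continuous (conserved_C1 energy_current_conserved 0) T0).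
  exact: energy_current_supp.
have dE r : 0 < r -> r < T -> is_derive r (1 : R) energy_at 0.
  move=> r0 rT.
  have H := flux_derivative (conserved_C1 energy_current_conserved) T0 L0 energy_current_supp r0 rT.
  apply: (isd_eq H); apply: Rintegral_eq0 => z.
  by apply: (conserved_div energy_current_conserved); rewrite pt_time.
have dr r : r \in `]0, T[ -> derivable energy_at r 1 /\ derive1 energy_at r = 0.
  by rewrite in_itv /= => /andP[r0 rT]; have [h1 h2] := dE r r0 rT; rewrite derive1E.
apply/eqP; rewrite eq_le; apply/andP; split.
  apply: (@ler0_derive1_nincr _ energy_at 0 T) => // r /dr[] // _ ->; exact: lexx.
apply: (@ger0_derive1_ndecr _ energy_at 0 T) => // r /dr[] // _ ->; exact: lexx.
Qed.

Lemma radial_continuous : {within `[0, T], continuous radial_at}.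
Proof.
apply: (flux_continuous (C1_radial_current 0) T0); exact: radial_current_supp.
Qed.

(** The virial identity, integrated: the derivative of the radial momentum is the
    integral of the trace of the spatial stress. *)
Lemma radial_derivative t : 0 < t -> t < T -> exists2 q, is_derive t (1 : R) radial_at q &
  (1 - 3 * eta ^+ 2) * kinetic_at t + 3 * eta ^+ 2 * energy_at 0 <= q.
Proof.
move=> t0 tT.
have H := flux_derivative C1_radial_current T0 L0 radial_current_supp t0 tT.
exists (\int[leb3]_z \sum_i momentum_current i (space_index i) (pt t z)).
  by apply: (isd_eq H); apply: eq_Rintegral => z _; rewrite radial_current_div // pt_time.
have iK : leb3.-integrable setT (EFin \o (fun z => kinetic (pt t z))).
  by apply: (slice_integrable C1_kinetic T0 kinetic_supp); exact: ltW.
have iE : leb3.-integrable setT (EFin \o (fun z => energy_current 0 (pt t z))).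
  by apply: (slice_integrable (conserved_C1 energy_current_conserved 0) T0 (@energy_current_supp 0)); exact: ltW.
rewrite -(energy_conserved (ltW t0) (ltW tT)) /energy_at /kinetic_at.
rewrite -RintegralZl // -RintegralZl // -RintegralD //; [|exact: integrable_scaler|exact: integrable_scaler].
apply: le_Rintegral => //.
- by apply: integrable_addr; exact: integrable_scaler.
- apply: (@continuous_integrable3 _ L).
    have c i : continuous (fun z => momentum_current i (space_index i) (pt t z)).
      apply: (continuous_slice (f := momentum_current i (space_index i))) => z.
      apply: (C1_continuous_at (conserved_C1 (momentum_current_conserved i) (space_index i))).
      by rewrite pt_time.
    move=> z; rewrite (_ : (fun _ => _) = (fun z => momentum_current 0 (space_index 0) (pt t z) +
       (momentum_current 1 (space_index 1) (pt t z) + momentum_current 2%:R (space_index 2%:R) (pt t z)))).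
      by apply: cvgD; [exact: c|apply: cvgD; exact: c].
    by apply/funext => z'; rewrite sum3_split.
  move=> z zc; have [_ _ _ h] := bg_values (pt_future z (ltW t0)) (far_of_not_cube (ltW t0) (ltW tT) zc).
  by apply: big1 => i _; rewrite h.
- by move=> z _; apply: virial_pointwise; apply: pt_future; exact: ltW.
Qed.

End virial.

(** * The radial momentum bounded by the kinetic energy *)

Section radial_bound.
Context {R : realType}.
Local Notation X := 'rV[R]_4.
Local Notation S := (R * R * R)%type.
Local Notation leb := (@lebesgue_measure R).
Local Notation leb3 := ((leb \x leb) \x leb)%E.
Variables (rho : R * R -> R) (n0 s0 : 'rV[R]_3 -> R) (u0 : 'rV[R]_3 -> 'rV[R]_3).
Variables (n s : X -> R) (u : X -> 'rV[R]_3).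
Hypotheses (eos : equation_of_state rho) (sol : fluid_solution rho n0 s0 u0 n s u).
Variables (nb sb : R).
Hypotheses (nb0 : 0 < nb) (sb0 : 0 < sb).
Hypothesis data : forall y, ~ unit_ball3 y -> [/\ n0 y = nb, s0 y = sb & u0 y = 0].

Local Notation eta := (sound_speed rho (nb, sb)).
Local Notation rhob := (rho (nb, sb)).
Local Notation w x := (dot (u x) (u x)).
Local Notation enth := (enthalpy_at rho n s).

Let rhob_ge0 : 0 <= rhob.
Proof. by apply: (eos_rho_ge0 eos); split; exact: ltW. Qed.

Lemma spatial_pt (t : R) (z : S) : \sum_i spatial (pt t z) i ^+ 2 = z.1.1 ^+ 2 + z.1.2 ^+ 2 + z.2 ^+ 2.
Proof.
have [e0 e1 e2] := vec3E z.
by rewrite sum3_split /spatial !pt_space e0 e1 e2 addrA.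
Qed.

(** Inside the ball |x| <= r, with w = |u|^2, the inequality of arithmetic and
    geometric means gives
    x . u sqrt(1 + w) <= lam / 2 w + r^2 / (2 lam) (1 + w). Multiplied by
    rho + p, the last term is controlled by the energy since rho + p <= 2 rho.
    Outside the ball the left-hand side is zero. *)
Lemma radial_pointwise (t lam : R) (z : S) : 0 <= t -> 0 < lam ->
  radial_current rho n s u nb sb 0 (pt t z) <=
    lam / 2 * kinetic rho n s u (pt t z) +
    (1 + eta * t) ^+ 2 / lam *
      (energy_current rho n s u nb sb 0 (pt t z) + rhob * \1_(ball3 (1 + eta * t)) z).
Proof.
move=> t0 lam0; set x := pt t z; set r := 1 + eta * t.
have eta0 : 0 <= eta by exact: sqrtr_ge0.
have r0 : 0 <= r by rewrite addr_ge0 // mulr_ge0.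
have fx : future x by exact: pt_future.
have coef : 0 <= r ^+ 2 / lam by rewrite divr_ge0 ?sqr_ge0 // ltW.
have [xr|rx] := leP (norm3 (spatial x)) r; last first.
  have [|e0 k0 _ m0] := bg_values eos sol nb0 sb0 data (x := x) fx.
    by rewrite pt_time.
  rewrite e0 k0 mulr0 !add0r /radial_current big1 => [|i _]; last by rewrite m0 mulr0.
  by rewrite mulr_ge0 // mulr_ge0 // indicE.
have zb : ball3 r z.
  by rewrite /ball3 /= -(spatial_pt t) -norm3_sqr ler_pXn2r ?nnegrE // norm3_ge0.
rewrite indicE mem_set // mulr1 radial_current_time energy_current_time -[X in _ + _ * X]addrA subrK.
have x2 : \sum_i x 0 (space_index i) ^+ 2 <= r ^+ 2 by rewrite (spatial_pt t z).
set xu := \sum_i _ * _; set U := Num.sqrt _.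
have U2 : U ^+ 2 = 1 + w x by have [] := sqrt1D_bounds (dot_ge0 (u x)).
have w0 : 0 <= w x by exact: dot_ge0.
have enth0 := enth_ge0 eos sol fx.
have st := states_at sol fx.
have sq : 0 <= lam ^+ 2 * w x - 2 * lam * U * xu + U ^+ 2 * \sum_i x 0 (space_index i) ^+ 2.
  have -> : lam ^+ 2 * w x - 2 * lam * U * xu + U ^+ 2 * \sum_i x 0 (space_index i) ^+ 2 =
      \sum_i (lam * u x 0 i - U * x 0 (space_index i)) ^+ 2.
    rewrite /dot /xu !mulr_sumr -sumrB -big_split /=; apply: eq_bigr => i _; ring.
  exact: sumsqr_ge0.
have h1 : xu * U <= lam / 2 * w x + r ^+ 2 / (2 * lam) * U ^+ 2.
  have h : 0 <= lam ^+ 2 * w x - 2 * lam * (xu * U) + U ^+ 2 * r ^+ 2.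
    apply: (le_trans sq); rewrite -mulrA (mulrC U xu) lerD2l.
    by rewrite ler_wpM2l // sqr_ge0.
  have -> : lam / 2 * w x + r ^+ 2 / (2 * lam) * U ^+ 2 =
    xu * U + (lam ^+ 2 * w x - 2 * lam * (xu * U) + U ^+ 2 * r ^+ 2) / (2 * lam).
    by field; rewrite gt_eqF.
  by rewrite lerDl divr_ge0 // mulr_ge0 // ltW.
apply: (le_trans (ler_wpM2r enth0 h1)).
rewrite mulrDl U2 /kinetic.
have -> : lam / 2 * w x * enth x = lam / 2 * (enth x * w x) by ring.
rewrite lerD2l.
have -> : r ^+ 2 / (2 * lam) * (1 + w x) * enth x = r ^+ 2 / lam * ((enth x + enth x * w x) / 2).
  by field; rewrite gt_eqF.
rewrite ler_wpM2l //.
have := eos_pressure_le_rho eos st; have := mulr_ge0 enth0 w0.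
by rewrite /enthalpy_at /energy_density /pressure_at; lra.
Qed.

Variable T : R.
Hypothesis T0 : 0 < T.

Lemma radial_upper (t lam : R) : 0 <= t -> t <= T -> 0 < lam ->
  radial_at rho n s u nb sb t <= lam / 2 * kinetic_at rho n s u t +
   (1 + eta * t) ^+ 2 / lam * (energy_at rho n s u nb sb 0 + rhob * (4 * pi / 3 * (1 + eta * t) ^+ 3)).
Proof.
move=> t0 tT lam0.
have eta0 : 0 <= eta by exact: sqrtr_ge0.
have r0 : 0 <= 1 + eta * t by rewrite addr_ge0 // mulr_ge0.
have iK : leb3.-integrable setT (EFin \o (fun z => kinetic rho n s u (pt t z))).
  apply: (slice_integrable (C1_kinetic eos sol) T0 _ t0 tT).
  exact: (kinetic_supp eos sol nb0 sb0 data).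
have iE : leb3.-integrable setT (EFin \o (fun z => energy_current rho n s u nb sb 0 (pt t z))).
  apply: (slice_integrable (conserved_C1 (energy_current_conserved eos sol nb sb) 0) T0 _ t0 tT).
  by apply: (energy_current_supp eos sol nb0 sb0 data).
have iR : leb3.-integrable setT (EFin \o (fun z => radial_current rho n s u nb sb 0 (pt t z))).
  apply: (slice_integrable (C1_radial_current eos sol nb sb 0) T0 _ t0 tT).
  by apply: (radial_current_supp eos sol nb0 sb0 data).
have iB := integrable_ball3 r0.
rewrite -(energy_conserved eos sol nb0 sb0 data T0 t0 tT) -(volume_ball3 r0).
rewrite /energy_at /kinetic_at /radial_at.
rewrite -RintegralZl // -[X in _ + _ * (_ + X)]RintegralZl //.
rewrite -RintegralD //; last exact: integrable_scaler.
rewrite -[X in _ + X]RintegralZl //; last by apply: integrable_addr => //; exact: integrable_scaler.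
rewrite -RintegralD //; [|exact: integrable_scaler|].
  apply: le_Rintegral => //.
    apply: integrable_addr; first exact: integrable_scaler.
    by apply: integrable_scaler; apply: integrable_addr => //; exact: integrable_scaler.
  by move=> z _; exact: radial_pointwise.
by apply: integrable_scaler; apply: integrable_addr => //; exact: integrable_scaler.
Qed.

(** A parametrized Cauchy-Schwarz inequality: radial_upper is optimized over lam. *)
Lemma radial_sqr_le (t : R) : 0 <= t -> t <= T -> 0 < radial_at rho n s u nb sb t ->
  radial_at rho n s u nb sb t ^+ 2 <=
  2 * (energy_at rho n s u nb sb 0 * (1 + eta * t) ^+ 2 + 4 * pi / 3 * rhob * (1 + eta * t) ^+ 5) *
   kinetic_at rho n s u t.
Proof.
move=> t0 tT; set Q := radial_at _ _ _ _ _ _ _ => Q0; set E := energy_at _ _ _ _ _ _ _.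
set K := kinetic_at _ _ _ _ _; set r := 1 + eta * t; set M := 2 * _.
have K0 : 0 <= K.
  by apply: Rintegral_ge0 => z _; apply: (kinetic_ge0 eos sol); exact: pt_future.
have ub (lam : R) : 0 < lam -> Q <= lam / 2 * K + M / (2 * lam).
  move=> lam0; have := radial_upper t0 tT lam0; rewrite -/Q -/K -/E -/r.
  rewrite (_ : r ^+ 2 / lam * _ = M / (2 * lam)) //.
  by rewrite /M; field; rewrite gt_eqF.
have [M0|M0] := leP M 0.
  (* A small lam makes the right-hand side less than Q. *)
  have := ub (Q / (K + 1)); rewrite divr_gt0 ?ltr_pwDr // => /(_ isT).
  have k1 : 0 < K + 1 by rewrite ltr_pwDr.
  have h1 : Q / (K + 1) / 2 * K <= Q / 2.
    have -> : Q / (K + 1) / 2 * K = Q / 2 * (K / (K + 1)) by field; rewrite gt_eqF.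
    by rewrite ler_piMr ?divr_ge0 ?ltW // ltr_pdivrMr // mul1r ltrDl.
  have h2 : M / (2 * (Q / (K + 1))) <= 0.
    by rewrite mulr_le0_ge0 // invr_ge0 mulr_ge0 // divr_ge0 // ltW.
  by move=> h; exfalso; lra.
(* The choice lam = M / Q makes the second term Q / 2. *)
have := ub (M / Q); rewrite divr_gt0 // => /(_ isT).
have -> : M / (2 * (M / Q)) = Q / 2 by field; rewrite !gt_eqF.
move=> h; have {}h : Q / 2 <= M / Q / 2 * K by lra.
have : Q * (Q / 2) <= Q * (M / Q / 2 * K) by rewrite ler_wpM2l // ltW.
have -> : Q * (M / Q / 2 * K) = M * K / 2 by field; rewrite gt_eqF.
by rewrite expr2; lra.
Qed.

End radial_bound.

(** * A Riccati inequality *)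

Section comparison.
Context {R : realType}.
Local Notation leb := (@lebesgue_measure R).
Variables (E rb : R).
Hypotheses (E0 : 0 < E) (rb0 : 0 <= rb).

Definition rate (r : R) : R := (E * r ^+ 2 + 4 * pi / 3 * rb * r ^+ 5)^-1.

Definition rate_integral (x : R) : R := \int[leb]_(r in `[1, x]) rate r.

Lemma rate_den_gt0 (r : R) : 0 < r -> 0 < E * r ^+ 2 + 4 * pi / 3 * rb * r ^+ 5.
Proof.
move=> r0; have pi0 : 0 <= pi :> R by exact: pi_ge0.
have h1 : 0 <= r ^+ 5 by exact/exprn_ge0/ltW.
have h2 : 0 <= 4 * pi / 3 * rb by apply: mulr_ge0 => //; apply: divr_ge0 => //; exact: mulr_ge0.
have h3 : 0 < r ^+ 2 by exact: exprn_gt0.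
by apply: ltr_pwDl; [exact: mulr_gt0|exact: mulr_ge0].
Qed.

Lemma rate_gt0 (r : R) : 0 < r -> 0 < rate r.
Proof. by move=> r0; rewrite invr_gt0 rate_den_gt0. Qed.

Lemma rate_continuous (r : R) : 0 < r -> {for r, continuous rate}.
Proof.
move=> r0; apply: cvgV; first by rewrite gt_eqF // rate_den_gt0.
by apply: cvgD; apply: cvgM; first [exact: cvg_cst|exact: exprn_continuous].
Qed.

Lemma rate_integrable (x : R) : leb.-integrable `[1, x] (EFin \o rate).
Proof.
apply: continuous_compact_integrable; first exact: segment_compact.
apply: continuous_in_subspaceT => r; rewrite inE /= in_itv /= => /andP[r1 _].
by apply: rate_continuous; exact: lt_le_trans r1.
Qed.

Lemma rate_integral_isd (x : R) : 1 < x -> is_derive x (1 : R) rate_integral (rate x).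
Proof.
move=> x1.
have xx : x < x + 1 by rewrite ltrDl.
have [] := continuous_FTC1_closed xx (rate_integrable (x + 1)) x1 (rate_continuous (lt_trans ltr01 x1)).
by rewrite derive1E => h1 h2; split.
Qed.

Lemma rate_integral_le1 (x : R) : x <= 1 -> rate_integral x = 0.
Proof.
rewrite /rate_integral le_eqVlt => /predU1P[->|x1]; first by rewrite set_itv1 Rintegral_set1.
by rewrite set_itv_ge ?Rintegral_set0 // bnd_simp -ltNge.
Qed.

Lemma rate_integral_continuous (b : R) : 1 <= b -> {within `[1, b], continuous rate_integral}.
Proof. by move=> b1; exact: parameterized_integral_continuous b1 (rate_integrable b). Qed.

Lemma rate_integral_ndecr (x y : R) : x <= y -> rate_integral x <= rate_integral y.
Proof.
move=> xy; have [y1|y1] := leP y 1.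
  by rewrite !rate_integral_le1 // (le_trans xy).
have ge1 (a b : R) : 1 <= a -> a <= b -> rate_integral a <= rate_integral b.
  move=> a1 ab; have b1 := le_trans a1 ab.
  have dl r : r \in `]1, b[ -> derivable rate_integral r 1 /\ derive1 rate_integral r = rate r.
    rewrite in_itv /= => /andP[r1 _]; have [h1 h2] := rate_integral_isd r1.
    by rewrite derive1E.
  apply: (@ger0_derive1_ndecr _ rate_integral 1 b) => //; last exact: rate_integral_continuous.
    by move=> r /dl[].
  move=> r rI; have [_ ->] := dl r rI; apply/ltW/rate_gt0.
  by move: rI; rewrite in_itv /= => /andP[r1 _]; exact: lt_trans r1.
have [x1|x1] := leP x 1; last exact: ge1 (ltW x1) xy.
by rewrite (rate_integral_le1 x1) -(rate_integral_le1 (lexx 1)); exact: ge1 (lexx 1) (ltW y1).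
Qed.

Lemma rate_integral2_gt0 : 0 < rate_integral 2.
Proof.
have h12 : (1 : R) < 2 by rewrite ltr1n.
have [x||xi] := @MVT R rate_integral rate 1 2 h12.
- by rewrite in_itv /= => /andP[x1 _]; exact: rate_integral_isd.
- by apply: rate_integral_continuous; exact: ltW.
rewrite in_itv /= => /andP[x1 _]; rewrite (rate_integral_le1 (lexx 1)) subr0 => ->.
by rewrite mulr_gt0 ?rate_gt0 ?subr_gt0 // (lt_trans ltr01).
Qed.

(** The partial integrals are nondecreasing and bounded, so they converge to the
    improper integral. *)
Lemma improper_rate_integral (B : R) : (forall x, 1 <= x -> rate_integral x <= B) ->
  0 < \int[leb]_(r in `[1, +oo[) rate r <= B.
Proof.
move=> hB.
have hub : has_ubound (range rate_integral).
  exists B => _ [x _ <-]; have [x1|x1] := leP 1 x; first exact: hB.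
  by apply: le_trans (hB 1 (lexx 1)); apply: rate_integral_ndecr; exact: ltW.
have cvl := nondecreasing_cvgr (fun x y => @rate_integral_ndecr x y) hub.
set l := sup _ in cvl.
have lub x : rate_integral x <= l by apply: ub_le_sup => //; exists x.
have -> : \int[leb]_(r in `[1, +oo[) rate r = l - rate_integral 1.
  apply: Rintegral_ge0_continuous_FTC2y => //.
  - by move=> x x1; apply/ltW/rate_gt0; exact: lt_le_trans x1.
  - apply: continuous_in_subspaceT => r; rewrite inE /= in_itv /= andbT => r1.
    by apply: rate_continuous; exact: lt_le_trans r1.
  - by move=> x /rate_integral_isd[].
  - have := @rate_integral_continuous 2 ltac:(by rewrite ler1n).
    by move=> /(continuous_within_itvP rate_integral (ltr1n R 2 : (1 : R) < 2))[].
  - by move=> x; rewrite in_itv /= andbT => /rate_integral_isd[_]; rewrite derive1E.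
rewrite rate_integral_le1 // subr0 (lt_le_trans rate_integral2_gt0 (lub 2)) /=.
apply: ge_sup; first by exists (rate_integral 0), 0.
move=> _ [x _ <-]; have [x1|x1] := leP 1 x; first exact: hB.
by apply: le_trans (hB 1 (lexx 1)); apply: rate_integral_ndecr; exact: ltW.
Qed.

End comparison.

Section riccati.
Context {R : realType}.

(** The inequality says that 1 / Q plus a / eta times the integral of the rate
    up to 1 + eta t is nonincreasing. *)
Lemma riccati (E rb eta a T : R) (Q : R -> R) : 0 < E -> 0 <= rb -> 0 < eta -> 0 < a -> 0 < T ->
  {within `[0, T], continuous Q} -> 0 < Q 0 ->
  (forall t, 0 < t -> t < T -> exists2 q, is_derive t (1 : R) Q q &
     0 <= q /\ (0 < Q t -> a * rate E rb (1 + eta * t) * Q t ^+ 2 <= q)) ->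
  a / eta * rate_integral E rb (1 + eta * T) <= (Q 0)^-1.
Proof.
move=> E0 rb0 eta0 a0 T0 cQ Q0 dQ.
have dq t : t \in `]0, T[ -> exists q, [/\ derivable Q t 1, derive1 Q t = q, 0 <= q &
    (0 < Q t -> a * rate E rb (1 + eta * t) * Q t ^+ 2 <= q)].
  rewrite in_itv /= => /andP[t0 tT]; have [q [h1 h2] [h3 h4]] := dQ t t0 tT.
  by exists q; rewrite derive1E; split.
have Qpos t : 0 <= t -> t <= T -> 0 < Q t.
  move=> t0 tT; apply: (lt_le_trans Q0).
  apply: (@ger0_derive1_ndecr _ Q 0 T) => //.
    by move=> r /dq[q []].
  by move=> r /dq[q [_ -> ]].
(* Phi' = (a rate Q^2 - Q') / Q^2 *)
pose Phi t := (Q t)^-1 + a / eta * rate_integral E rb (1 + eta * t).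
have dPhi t : 0 < t -> t < T -> exists2 d, is_derive t (1 : R) Phi d & d <= 0.
  move=> t0 tT; have [q qd [q0 /(_ (Qpos t (ltW t0) (ltW tT))) qge]] := dQ t t0 tT.
  have Qt := Qpos t (ltW t0) (ltW tT).
  have Qn : Q t != 0 by rewrite gt_eqF.
  have d1 := isd_inv Qn qd.
  have r1 : 1 < 1 + eta * t by rewrite ltrDl mulr_gt0.
  have d2 := isd_add (isd_cst (1 : R) t (1 : R)) (isd_mul (isd_cst eta t (1 : R)) (isd_id t)).
  have d3 := isd_comp (g := fun t : R => 1 + eta * t) (rate_integral_isd E0 rb0 r1) d2.
  have d4 := isd_add d1 (isd_mul (isd_cst (a / eta) t (1 : R)) d3).
  eexists; first exact: d4.
  have -> : - q / Q t ^+ 2 + (a / eta * (rate E rb (1 + eta * t) * (0 + (eta * 1 + t * 0))) +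
      rate_integral E rb (1 + eta * t) * 0) =
      (a * rate E rb (1 + eta * t) * Q t ^+ 2 - q) / Q t ^+ 2.
    by field; rewrite Qn gt_eqF.
  by rewrite mulr_le0_ge0 ?subr_le0 // invr_ge0 sqr_ge0.
have cPhi : {within `[0, T], continuous Phi}.
  apply/subspace_continuousP => t tI; have := tI; rewrite /= in_itv /= => /andP[t0 tT].
  apply: cvgD.
    apply: cvgV; first by rewrite gt_eqF // Qpos.
    by move/subspace_continuousP : cQ; exact.
  apply: cvgM; first exact: cvg_cst.
  have b1 : 1 <= 1 + eta * T by rewrite lerDl mulr_ge0 // ltW.
  have cl := rate_integral_continuous E0 rb0 b1.
  have cl' : rate_integral E rb @ within `[1, 1 + eta * T] (nbhs (1 + eta * t)) --> rate_integral E rb (1 + eta * t).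
    move/subspace_continuousP : cl; apply; rewrite /= in_itv /= lerDl mulr_ge0 ?(ltW eta0) //=.
    by rewrite lerD2l ler_wpM2l // ltW.
  apply: (cvg_through (h := fun t => 1 + eta * t) _ _ cl').
    apply: cvg_within_filter; apply: cvgD; first exact: cvg_cst.
    by apply: cvgM; [exact: cvg_cst|exact: cvg_id].
  apply: near_withinW => r /=; rewrite !in_itv /= => /andP[r0 rT].
  by rewrite lerDl mulr_ge0 ?(ltW eta0) //= lerD2l ler_wpM2l // ltW.
have PhiT : Phi T <= Phi 0.
  apply: (@ler0_derive1_nincr _ Phi 0 T) => //; last exact: ltW.
  - by move=> t; rewrite in_itv /= => /andP[t0 tT]; have [d [h _] _] := dPhi t t0 tT.
  - by move=> t; rewrite in_itv /= => /andP[t0 tT]; have [d [_ h] d0] := dPhi t t0 tT; rewrite derive1E h.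
have P0 : Phi 0 = (Q 0)^-1 by rewrite /Phi mulr0 addr0 (rate_integral_le1 E rb (lexx 1)) mulr0 addr0.
rewrite P0 in PhiT; apply: le_trans PhiT; rewrite /Phi lerDr invr_ge0.
by apply: ltW; apply: Qpos => //; exact: ltW.
Qed.

End riccati.

(** * The bound on the initial radial momentum *)

Lemma virial_coef_gt0 {R : realType} (e : R) : 0 < e -> e < 1 / 3 -> 0 < 1 - 3 * e ^+ 2.
Proof.
move=> e0 e13; have : e * e < 1 / 3 * (1 / 3) by rewrite ltr_pM // ltW.
by rewrite expr2; lra.
Qed.

Section contradiction.
Context {R : realType}.
Variables (rho : R * R -> R) (n0 s0 : 'rV[R]_3 -> R) (u0 : 'rV[R]_3 -> 'rV[R]_3).
Variables (n s : 'rV[R]_4 -> R) (u : 'rV[R]_4 -> 'rV[R]_3).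
Hypotheses (eos : equation_of_state rho) (sol : fluid_solution rho n0 s0 u0 n s u).
Variables (nb sb : R).

Lemma energy_at0 : energy_at rho n s u nb sb 0 = energy rho nb sb n0 s0 u0.
Proof.
rewrite /energy_at /energy /integral3; apply: eq_Rintegral => z _.
rewrite energy_current_time /kinetic /enthalpy_at /energy_density /pressure_at /pt.
by rewrite (sol_initial_n sol) (sol_initial_s sol) (sol_initial_u sol) addrA.
Qed.

Lemma radial_at0 : radial_at rho n s u nb sb 0 = radial_momentum rho n0 s0 u0.
Proof.
rewrite /radial_at /radial_momentum /integral3; apply: eq_Rintegral => z _.
rewrite radial_current_time /enthalpy_at /energy_density /pressure_at /dot.
under eq_bigr => i _ do rewrite pt_space.
by rewrite /pt (sol_initial_n sol) (sol_initial_s sol) (sol_initial_u sol).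
Qed.

Hypotheses (nb0 : 0 < nb) (sb0 : 0 < sb).
Hypothesis data : forall y, ~ unit_ball3 y -> [/\ n0 y = nb, s0 y = sb & u0 y = 0].
Hypothesis A1 : rho_nonincreasing_in_entropy rho.
Hypothesis A2 : sound_speed_nondecreasing_in_pressure rho.
Hypothesis sb_le : forall y, sb <= s0 y.

Local Notation eta := (sound_speed rho (nb, sb)).
Local Notation rhob := (rho (nb, sb)).
Local Notation E := (energy rho nb sb n0 s0 u0).
Local Notation Q0 := (radial_momentum rho n0 s0 u0).

Hypotheses (E0 : 0 < E) (eta13 : eta < 1 / 3) (Q00 : 0 < Q0).

(** The time T at which 1 + eta T = x is arbitrary, since the solution is global. *)
Lemma rate_integral_bound (x : R) : 1 <= x ->
  (1 - 3 * eta ^+ 2) / (2 * eta) * rate_integral E rhob x <= Q0^-1.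
Proof.
have st : states (nb, sb) by split; exact: ltW.
have eta0 : 0 < eta by exact: sound_speed_gt0.
have rb0 : 0 <= rhob by exact: (eos_rho_ge0 eos).
have k0 := virial_coef_gt0 eta0 eta13.
rewrite le_eqVlt => /predU1P[<-|x1]; first by rewrite rate_integral_le1 // mulr0 invr_ge0 ltW.
pose T := (x - 1) / eta.
have T0 : 0 < T by rewrite divr_gt0 // subr_gt0.
have -> : x = 1 + eta * T by rewrite /T; field; rewrite gt_eqF.
have -> : (1 - 3 * eta ^+ 2) / (2 * eta) = (1 - 3 * eta ^+ 2) / 2 / eta by field; rewrite gt_eqF.
rewrite -radial_at0.
apply: riccati => //; first exact: divr_gt0.
- exact: (radial_continuous eos sol nb0 sb0 data T0).
- by rewrite radial_at0.
move=> t t0 tT.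
have [q qd qge] := radial_derivative eos sol nb0 sb0 data A1 A2 sb_le T0 t0 tT.
exists q => //.
have K0 : 0 <= kinetic_at rho n s u t.
  by apply: Rintegral_ge0 => z _; apply: (kinetic_ge0 eos sol); apply: pt_future; exact: ltW.
have eE : 0 <= 3 * eta ^+ 2 * energy_at rho n s u nb sb 0.
  by rewrite energy_at0 mulr_ge0 ?(ltW E0) // mulr_ge0 ?sqr_ge0.
split; first by apply: le_trans qge; rewrite addr_ge0 // mulr_ge0 // ltW.
move=> Qt; apply: le_trans qge; rewrite -[leLHS]addr0; apply: lerD => //.
have := radial_sqr_le eos sol nb0 sb0 data T0 (ltW t0) (ltW tT) Qt.
rewrite energy_at0; set r := 1 + eta * t; set D := (X in 2 * X) => h.
have D0 : 0 < D by apply: rate_den_gt0 => //; rewrite ltr_pwDl // mulr_ge0 // ltW.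
have -> : (1 - 3 * eta ^+ 2) / 2 * rate E rhob r * radial_at rho n s u nb sb t ^+ 2 =
  (1 - 3 * eta ^+ 2) * (radial_at rho n s u nb sb t ^+ 2 / (2 * D)).
  by rewrite /rate -/D; field; rewrite gt_eqF.
by rewrite ler_pM2l // ler_pdivrMr ?mulr_gt0 // mulrC.
Qed.

(** The bound holds for the partial integrals, hence for the improper one, which
    is positive and may be inverted. *)
Lemma radial_momentum_le : Q0 <= 2 * eta / (1 - 3 * eta ^+ 2) *
  (\int[lebesgue_measure]_(r in `[1, +oo[) rate E rhob r)^-1.
Proof.
have st : states (nb, sb) by split; exact: ltW.
have eta0 : 0 < eta by exact: sound_speed_gt0.
have rb0 : 0 <= rhob by exact: (eos_rho_ge0 eos).
have k0 := virial_coef_gt0 eta0 eta13.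
have c0 : 0 < 2 * eta / (1 - 3 * eta ^+ 2) by rewrite divr_gt0 // mulr_gt0.
have bound x : 1 <= x -> rate_integral E rhob x <= 2 * eta / (1 - 3 * eta ^+ 2) / Q0.
  move=> /rate_integral_bound; rewrite -(ler_pM2l c0) mulrA => h; apply: le_trans h.
  by rewrite (_ : _ * (_ / _) = 1) ?mul1r //; field; rewrite !gt_eqF.
have /andP[I0] := improper_rate_integral E0 rb0 bound.
rewrite ler_pdivlMr // => h; rewrite ler_pdivlMr // mulrC.
exact: h.
Qed.

End contradiction.

Unset Implicit Arguments.

Theorem theorem2p1 (R : realType) (rho : R * R -> R) (nbar sbar : R)
  (n0 s0 : 'rV[R]_3 -> R) (u0 : 'rV[R]_3 -> 'rV[R]_3) :
  equation_of_state rho ->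
  rho_nonincreasing_in_entropy rho ->
  sound_speed_nondecreasing_in_pressure rho ->
  0 < nbar -> 0 < sbar ->
  smooth3 n0 -> smooth3 s0 -> (forall i, smooth3 (fun x => u0 x 0 i)) ->
  (forall x, 0 <= n0 x) -> (forall x, 0 <= s0 x) ->
  (forall x, ~ unit_ball3 x -> [/\ n0 x = nbar, s0 x = sbar & u0 x = 0]) ->
  let etabar := sound_speed rho (nbar, sbar) in
  let rhobar := rho (nbar, sbar) in
  let E := energy rho nbar sbar n0 s0 u0 in
  let Q0 := radial_momentum rho n0 s0 u0 in
  etabar < 1 / 3 ->
  0 < E ->
  (forall x, unit_ball3 x -> sbar <= s0 x) ->
  Q0 > 2 * etabar / (1 - 3 * etabar ^+ 2) *
       (\int[lebesgue_measure]_(r in `[1, +oo[)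
          (E * r ^+ 2 + 4 * pi / 3 * rhobar * r ^+ 5)^-1)^-1 ->
  ~ exists (n s : 'rV[R]_4 -> R) (u : 'rV[R]_4 -> 'rV[R]_3),
      fluid_solution rho n0 s0 u0 n s u.
Proof.
move=> eos A1 A2 nb0 sb0 _ _ _ _ _ data etabar rhobar E Q0 eta13 E0 sge D4 [n [s [u sol]]].
have sb_le y : sbar <= s0 y.
  by have [/sge//|/data[_ ->]] := pselect (unit_ball3 y).
have st : states (nbar, sbar) by split; exact: ltW.
have eta0 : 0 < etabar by exact: sound_speed_gt0.
have Q00 : 0 < Q0.
  apply: le_lt_trans D4; apply: mulr_ge0.
    by apply: divr_ge0; [apply: mulr_ge0 => //; exact: ltW|exact/ltW/virial_coef_gt0].
  rewrite invr_ge0; apply: Rintegral_ge0 => r /=; rewrite in_itv /= andbT => r1.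
  apply/ltW/(@rate_gt0 R E rhobar E0 (eos_rho_ge0 eos st)); exact: lt_le_trans r1.
move: D4; apply/negP; rewrite -leNgt.
exact: (radial_momentum_le eos sol nb0 sb0 data A1 A2 sb_le E0 eta13 Q00).
Qed.
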